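(* Let $a>0$, let $A=\begin{pmatrix} 1 & a & a \\ a & 1 & a \\ a & a & 1 \end{pmatrix}$, let $\beta>0$, and let $\bar{x}(n)\in\Delta^2$ be the vector of proportions of the three colours at time $n$ in the urn process with matrix $A$ and reinforcement exponent $\beta$. (i) Fix $a<1$. Then there exists $\beta_1(a)$ (depending only on $a$) satisfying $1<\beta_1(a)<\frac{1+2a}{1-a}$, with $\beta_1(a)$ an increasing function of $a\in(0,1)$ satisfying $\beta_1(a)\to\infty$ as $a\to1$, such that the following three phases hold. (a) If $\beta<\beta_1(a)$, then almost surely $\bar{x}(n)\to\left(\frac13,\frac13,\frac13\right)$ as $n\to\infty$. (b) If $\beta_1(a)<\beta<\frac{1+2a}{1-a}$, then there exists $r_2>1$ such that almost surely $\bar{x}(n)$ converges to one of the four points of $\Delta^2$ given by $\left(\frac13,\frac13,\frac13\right)$, $\left(\frac{r_2}{2+r_2},\frac{1}{2+r_2},\frac{1}{2+r_2}\right)$, $\left(\frac{1}{2+r_2},\frac{r_2}{2+r_2},\frac{1}{2+r_2}\right)$ and $\left(\frac{1}{2+r_2},\frac{1}{2+r_2},\frac{r_2}{2+r_2}\right)$. Each of these four points has positive probability of being the limit. (c) If $\beta>\frac{1+2a}{1-a}$, then there exists $r_+>1$ such that almost surely $\bar{x}(n)$ converges to one of the three points of $\Delta^2$ given by $\left(\frac{r_+}{2+r_+},\frac{1}{2+r_+},\frac{1}{2+r_+}\right)$, $\left(\frac{1}{2+r_+},\frac{r_+}{2+r_+},\frac{1}{2+r_+}\right)$ and $\left(\frac{1}{2+r_+},\frac{1}{2+r_+},\frac{r_+}{2+r_+}\right)$.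 (ii) Fix $a\geq1$. Then (for every $\beta>0$) almost surely $\bar{x}(n)\to\left(\frac13,\frac13,\frac13\right)$ as $n\to\infty$.
   Context: Urn process. Let $A=(a_{ij})$ be a non-negative $3\times 3$ matrix and $\beta>0$. The process $x(n)=(x_1(n),x_2(n),x_3(n))\in\mathbb{N}^3$ (with $0\in\mathbb{N}$), $n=0,1,2,\dots$, counts the balls of each of three colours in an urn. It starts from a fixed $x(0)$ with $n_0:=x_1(0)+x_2(0)+x_3(0)>0$. Let $\mathcal{F}_n$ be the $\sigma$-algebra generated by $x(0),\dots,x(n)$, let $x^\beta(n)$ be the coordinatewise $\beta$-th power of $x(n)$, and let $u(n)=Ax^\beta(n)$. Then $$\mathbb{P}(x(n+1)-x(n)=\mathbf{e}_i\mid\mathcal{F}_n)=\frac{u_i(n)}{\sum_{j=1}^3u_j(n)},\qquad i=1,2,3,$$ where $\mathbf{e}_i$ is the $i$-th standard unit vector. Thus exactly one ball is added at each step. The proportions are $\bar{x}(n)=x(n)/(n+n_0)$, which lie in the simplex $\Delta^2=\{x\in[0,\infty)^3:x_1+x_2+x_3=1\}$. *)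

(* Defs.v *)
From HB Require Import structures.
From mathcomp Require Import all_boot all_order all_algebra.
From mathcomp Require Import all_classical all_reals all_analysis.

Set Implicit Arguments.
Unset Strict Implicit.
Unset Printing Implicit Defensive.

Import Order.TTheory GRing.Theory Num.Theory.
Import numFieldNormedType.Exports.

Local Open Scope classical_set_scope.
Local Open Scope ring_scope.

(* [f] is a version of the conditional probability of the event [E] given the
   sub-sigma-algebra [G]. *)
Definition is_cond_prob (R : realType) (d : measure_display)
    (T : measurableType d) (P : probability T R)
    (G : set (set T)) (E : set T) (f : T -> R) : Prop :=
  [/\ forall Y : set R, measurable Y -> G (f @^-1` Y),
      P.-integrable setT (EFin \o f) &
      forall B : set T, G B ->
        (\int[P]_(w in B) (f w)%:E = P (B `&` E))%E].

(* The state space is countable and carries its discrete sigma-algebra, hence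
   the quantification over all sets [Y] of states. *)
Definition natural_filtration (T S : Type) (x : nat -> T -> S) (n : nat) :
    set (set T) :=
  <<s [set x k @^-1` Y | k in [set k | (k <= n)%N] & Y in [set: set S]] >>.

Definition urn_weight (R : realType) (A : 'M[R]_3) (beta : R)
    (y : 'cV[nat]_3) : 'cV[R]_3 :=
  A *m map_mx (fun k : nat => k%:R `^ beta) y.

(* Subtraction in [nat] being truncated, the event x(n+1) - x(n) = e_i is
   written additively. *)
Record urn_process (R : realType) (A : 'M[R]_3) (beta : R) (x0 : 'cV[nat]_3)
    (d : measure_display) (T : measurableType d) (P : probability T R)
    (x : nat -> T -> 'cV[nat]_3) : Prop := UrnProcess {
  urn_start_gt0 : (0 < \sum_i x0 i ord0)%N ;
  urn_measurable : forall (n : nat) (Y : set 'cV[nat]_3),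
    measurable (x n @^-1` Y) ;
  urn_start : forall w, x 0%N w = x0 ;
  urn_step : forall (n : nat) (i : 'I_3),
    is_cond_prob P (natural_filtration x n)
      [set w | x n.+1 w = x n w + delta_mx i ord0]
      (fun w => urn_weight A beta (x n w) i ord0
                / \sum_j urn_weight A beta (x n w) j ord0)
}.

Definition proportions (R : realType) (T : Type) (x0 : 'cV[nat]_3)
    (x : nat -> T -> 'cV[nat]_3) (n : nat) (w : T) : 'cV[R]_3 :=
  \col_i ((x n w i ord0)%:R / (n + \sum_j x0 j ord0)%N%:R).

Definition urn_converges (R : realType) (T : Type) (x0 : 'cV[nat]_3)
    (x : nat -> T -> 'cV[nat]_3) (p : 'cV[R]_3) : set T :=
  [set w | proportions R x0 x n w @[n --> \oo] --> p].

Definition sym_mx (R : realType) (a : R) : 'M[R]_3 :=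
  \matrix_(i, j) (if i == j then 1 else a).

Definition barycenter (R : realType) : 'cV[R]_3 := const_mx (1 / 3).

Definition dominant_pt (R : realType) (r : R) (i : 'I_3) : 'cV[R]_3 :=
  \col_j ((if j == i then r else 1) / (2 + r)).

(* Main.v *)
(* Given the proportions x, colour i is drawn with probability
   pi_i(x) = p + c x_i^beta / sum_j x_j^beta, where p = a / (1 + 2 a) and
   c = (1 - a) / (1 + 2 a), so that x(n) follows the drift F = pi - x with steps
   of order 1/n.

   Convergence. If a >= 1 or beta <= 1 the squared distance to the barycenter is
   a Lyapunov function.  Otherwise p sum_j ln x_j + (c / beta) ln (sum_j x_j^beta)
   is one: its expected increment dominates |F|^2 / n up to O(1/n^2), hence
   F(x(n)) -> 0 almost surely, and x(n) converges because the zeros of F are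
   finite in number and its steps vanish.

   Equilibria. By strict convexity of t^beta two coordinates of a zero of F are
   equal, and the ratio r of the third one to them satisfies
   beta ln r = ln ((1 + a) r - 2 a) - ln (1 - a r).  The critical exponent is the
   infimum over 1 < r < 1/a of the beta for which r solves this equation.

   Unstable equilibria are not limits.  When the two equal coordinates repel each
   other, their difference leaves every neighbourhood by a supermartingale
   argument.  At the saddle r_1 (the smaller root r > 1) the urn is coupled
   monotonically with a copy having one more ball of the dominant colour; the gap
   would grow faster than the number of balls if both copies stayed near r_1.

   Stable equilibria are limits. They are strict local maxima of the potential,
   so a nearby start at a late time stays nearby with positive probability. *)
Require Import Defs.
From mathcomp Require Import all_boot all_order all_algebra.
From mathcomp Require Import all_classical all_reals all_analysis.
From mathcomp Require Import measurable_realfun ring lra.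
Import Order.TTheory GRing.Theory Num.Theory.
Import numFieldNormedType.Exports.
Local Open Scope classical_set_scope.
Local Open Scope ring_scope.

Set Implicit Arguments.
Unset Strict Implicit.
Unset Printing Implicit Defensive.

(** * Tangent-line inequalities *)

(** The law of the urn is known only through conditional probabilities on one space. Everything
    probabilistic is therefore reduced to one integral inequality over the events of having stayed
    in a set of states; no stopping time and no second chain is built. Vanishing of the drift,
    escape and survival differ only in the function fed to it. Proportions may be 0, where [ln] is
    not finite and [t ^ b] with [b < 1] is not Lipschitz. The first is cured by a tangent extension
    below [p / 2], where for [a < 1] the drift points inwards because every colour has probability
    at least [p]; the second by the quadratic function when [b <= 1]. The potential has partial
    derivative [1 + F_j / x_j], and [F] sums to 0: this is why its mean increment dominates a sum of
    squares of [F]. Two equal colours that repel are easy to follow, since by symmetry the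
    difference of their counts is an exact coordinate of the unstable direction. At the saddle the
    unstable direction lets the dominant colour grow or shrink, and no symmetry locates the boundary
    between both fates; comparing two ordered copies avoids locating it. *)

Lemma derive_incr (R : realType) (f df : R -> R) (u v : R) : u < v ->
  (forall x, u <= x <= v -> is_derive x 1 f (df x)) ->
  (forall x, u < x < v -> 0 < df x) -> f u < f v.
Proof.
move=> uv fd fpos.
have [||c /[!in_itv]/= c_uv fE] := @MVT _ f df u v uv.
- by move=> x /[!in_itv]/= /andP[ux xv]; apply: fd; rewrite !ltW.
- apply: derivable_within_continuous => x /[!in_itv]/= xuv.
  by have := fd x xuv => -[].
- by rewrite -subr_gt0 fE mulr_gt0 ?fpos// subr_gt0.
Qed.

Lemma derive_decr (R : realType) (f df : R -> R) (u v : R) : u < v ->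
  (forall x, u <= x <= v -> is_derive x 1 f (df x)) ->
  (forall x, u < x < v -> df x < 0) -> f v < f u.
Proof.
move=> uv fd fneg; rewrite -ltrN2.
apply: (@derive_incr _ (fun x => - f x) (fun x => - df x)) => // x xuv.
  by have ? := fd x xuv; apply: is_deriveN.
by rewrite oppr_gt0 fneg.
Qed.

Lemma IVT_itv (R : realType) (f df : R -> R) (u v : R) : u < v ->
  (forall x, u <= x <= v -> is_derive x 1 f (df x)) ->
  f u * f v < 0 -> exists2 c, u < c < v & f c = 0.
Proof.
move=> uv fd fuv.
have [|||c /[!in_itv]/= /andP[uc cv] fc0] := @IVT _ f u v 0.
- exact: ltW.
- apply: derivable_within_continuous => x /[!in_itv]/= xuv.
  by have := fd x xuv => -[].
- have [fu|fu|fu0] := ltgtP (f u) 0; last by rewrite fu0 mul0r ltxx in fuv.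
    have fv : 0 < f v by rewrite nmulr_rlt0 in fuv.
    by rewrite ge_min le_max ltW //= (ltW fv) orbT.
  have fv : f v < 0 by rewrite pmulr_rlt0 in fuv.
  by rewrite ge_min le_max (ltW fv) (ltW fu) orbT.
exists c => //; rewrite !lt_neqAle uc cv !andbT.
apply/andP; split; apply/eqP => cE.
  by rewrite cE fc0 mul0r ltxx in fuv.
by rewrite -cE fc0 mulr0 ltxx in fuv.
Qed.

(** [t ^ b - b * t] has derivative [b * (t ^ (b - 1) - 1)], which changes sign at 1 only, so 1 is
    its strict minimum. *)
Lemma powR_bernoulli (R : realType) (b t : R) : 1 < b -> 0 <= t -> t != 1 ->
  1 + b * (t - 1) < t `^ b.
Proof.
move=> b1 t0 t1.
have b1p : 0 < b - 1 by rewrite subr_gt0.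
(* The derivative of [powR] is available at positive points only; at 0 the claim reads
   [1 - b < 0]. *)
have [->|tn0] := eqVneq t 0; first by rewrite powR0 ?gt_eqF//; lra.
have {t0 tn0} t0 : 0 < t by rewrite lt_neqAle eq_sym tn0.
pose g x : R := x `^ b - b * x.
pose dg x : R := b * x `^ (b - 1) - b.
have gd (x : R) : 0 < x -> is_derive x (1 : R) g (dg x).
  move=> x0; have ? := is_derive1_powR b x0.
  rewrite /g /dg; apply: is_derive_eq; rewrite /GRing.scale/=; ring.
suff: g 1 < g t by rewrite /g powR1; lra.
have [tlt1|tgt1|//] := ltgtP t 1; last by move/eqP: t1.
- apply: (@derive_decr _ g dg) => // x /andP[tx x1].
    by apply: gd; lra.
  have x0 : 0 < x by lra.
  have : x `^ (b - 1) < 1 `^ (b - 1) by rewrite gt0_ltr_powR ?nnegrE//; lra.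
  rewrite powR1 /dg; nra.
- apply: (@derive_incr _ g dg) => // x /andP[tx x1].
    by apply: gd; lra.
  have x0 : 0 < x by lra.
  have : 1 `^ (b - 1) < x `^ (b - 1) by rewrite gt0_ltr_powR ?nnegrE//; lra.
  rewrite powR1 /dg; nra.
Qed.

(** Bernoulli at [y / x], scaled by [x ^ b]. Its strictness later excludes equilibria with three
    distinct coordinates. *)
Lemma powR_tangent_lt (R : realType) (b x y : R) : 1 < b -> 0 < x -> 0 <= y ->
  y != x -> x `^ b + b * x `^ (b - 1) * (y - x) < y `^ b.
Proof.
move=> b1 x0 y0 yx.
have := @powR_bernoulli _ b (y / x) b1 (divr_ge0 y0 (ltW x0)).
have -> : y / x != 1 by apply: contraNneq yx => yx1; rewrite -[y](divfK (lt0r_neq0 x0)) yx1 mul1r.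
move=> /(_ isT); have xb0 : 0 < x `^ b by rewrite powR_gt0.
rewrite -(ltr_pM2l xb0) -powRM ?(ltW x0)// ?divr_ge0 ?(ltW x0)//.
rewrite mulrCA divff ?gt_eqF// mulr1; congr (_ < _).
have b0 : 0 < b by lra.
rewrite -(mulr_powRB1 (ltW x0) b0).
by field; rewrite gt_eqF.
Qed.

Lemma powR_tangent (R : realType) (b x y : R) : 1 < b -> 0 <= x -> 0 <= y ->
  x `^ b + b * x `^ (b - 1) * (y - x) <= y `^ b.
Proof.
move=> b1; rewrite le_eqVlt => /predU1P[<- y0|x0 y0].
  by rewrite !powR0 ?gt_eqF ?subr_gt0 ?(lt_trans ltr01)// mulr0 mul0r add0r powR_ge0.
have [->|yx] := eqVneq y x; first by rewrite subrr mulr0 addr0.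
exact/ltW/powR_tangent_lt.
Qed.

(** The tangent at the larger point has slope at most [b] on the unit interval and bounds the
    increment. *)
Lemma powR_lip (R : realType) (b x y : R) : 1 < b -> 0 <= x <= 1 ->
  0 <= y <= 1 -> `|y `^ b - x `^ b| <= b * `|y - x|.
Proof.
move=> b1; wlog xy : x y / x <= y => [hw|] hx hy.
  have [xy|yx] := leP x y; first exact: hw.
  by rewrite distrC (distrC y); apply: hw => //; exact: ltW.
have b0 : 0 < b by lra.
have xyb : x `^ b <= y `^ b by rewrite ge0_ler_powR ?nnegrE//; lra.
rewrite !ger0_norm ?subr_ge0//.
have y0 : 0 <= y by lra.
have := @powR_tangent _ b y x b1 y0.
have : y `^ (b - 1) <= 1.
  have : y `^ (b - 1) <= 1 `^ (b - 1) by rewrite ge0_ler_powR ?nnegrE//; lra.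
  by rewrite powR1.
have := powR_ge0 y (b - 1); move: hx => /andP[x0 _] ? Y1 /(_ x0) h.
have : 0 <= b * (y - x) * (1 - y `^ (b - 1)).
  by rewrite !mulr_ge0 ?subr_ge0// ltW.
lra.
Qed.

(** * The phase function of the equilibria with two equal coordinates *)

(** The ratios at which both logarithms of [phase_logit] have positive arguments; for [0 < a < 1]
    every equilibrium ratio lies here ([phase_dom_equil]). *)
Definition phase_dom (R : realType) (a r : R) : bool :=
  (2 * a < (1 + a) * r) && (a * r < 1).

(** With [q = r ^ b], the drift vanishes at [dominant_pt r i] when [r = (q + 2 a) / (a q + 1 + a)].
    Solving for [q] gives the quotient whose logarithm this is. *)
Definition phase_logit (R : realType) (a r : R) : R :=
  ln ((1 + a) * r - 2 * a) - ln (1 - a * r).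

Definition phase_fun (R : realType) (a b r : R) : R :=
  phase_logit a r - b * ln r.

(** Numerator of minus the derivative of [phase_fun] in [r]. Being quadratic, it leaves at most two
    critical points, hence at most three zeros including [r = 1]. *)
Definition phase_quad (R : realType) (a b r : R) : R :=
  b * (((1 + a) * r - 2 * a) * (1 - a * r)) - r * ((1 + 2 * a) * (1 - a)).

(** The equilibrium equation freed of logarithms: it makes sense for every [r], has on [phase_dom]
    the sign opposite to [phase_fun], and is the numerator of the drift ([urn_drift_dom_fun]). *)
Definition equil_gap (R : realType) (a b r : R) : R :=
  r `^ b * (1 - a * r) - ((1 + a) * r - 2 * a).

(* The infimum over [r > 1] of the exponents [b] with [phase_fun a b r = 0], that
   is, for which [dominant_pt r i] is an equilibrium. *)
Definition beta_crit (R : realType) (a : R) : R :=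
  inf [set phase_logit a r / ln r | r in [set r | (1 < r) && (a * r < 1)]].

Section Phases.
Context {R : realType}.
Implicit Types (a b r : R).

Lemma phase_dom_gt0 a r : 0 < a -> phase_dom a r -> 0 < r.
Proof.
move=> a0 /andP[h _]; have : 0 < (1 + a) * r by lra.
by rewrite pmulr_rgt0//; lra.
Qed.

Lemma phase_domW a r : 0 < a -> a < 1 -> 1 <= r -> a * r < 1 -> phase_dom a r.
Proof. by move=> a0 a1 r1 ar; rewrite /phase_dom ar andbT; nra. Qed.

Lemma phase_dom_itv a u v x : 0 < a -> phase_dom a u -> phase_dom a v ->
  u <= x <= v -> phase_dom a x.
Proof.
move=> a0 /andP[u1 u2] /andP[v1 v2] /andP[ux xv]; apply/andP; split.
  by apply: (lt_le_trans u1); rewrite ler_pM2l//; lra.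
by apply: le_lt_trans v2; rewrite ler_pM2l.
Qed.

Lemma is_derive_phase_fun a b r : 0 < a -> phase_dom a r ->
  is_derive r (1 : R) (phase_fun a b)
    (- phase_quad a b r / (r * (((1 + a) * r - 2 * a) * (1 - a * r)))).
Proof.
move=> a0 dr; have r0 := phase_dom_gt0 a0 dr.
move: dr => /andP[dr1 dr2].
have n0 : 0 < (1 + a) * r - 2 * a by rewrite subr_gt0.
have d0 : 0 < 1 - a * r by rewrite subr_gt0.
have dn : is_derive r (1 : R) (fun x : R => (1 + a) * x - 2 * a) (1 + a).
  by apply: is_derive_eq; rewrite /GRing.scale/=; ring.
have dd : is_derive r (1 : R) (fun x : R => 1 - a * x) (- a).
  by apply: is_derive_eq; rewrite /GRing.scale/=; ring.
have h1 := @is_derive1_comp R (@ln R) (fun x : R => (1 + a) * x - 2 * a) r _ _ (is_derive1_ln n0) dn.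
have h2 := @is_derive1_comp R (@ln R) (fun x : R => 1 - a * x) r _ _ (is_derive1_ln d0) dd.
have h3 := is_derive1_ln r0.
rewrite /phase_fun /phase_logit /phase_quad.
apply: (@is_derive_eq _ _ _ _ _ _ _ _ (is_deriveB (is_deriveB h1 h2) (is_deriveM (is_derive_cst b r 1) h3))).
rewrite /GRing.scale/=; field.
by rewrite !gt_eqF.
Qed.

Lemma phase_fun1 a b : phase_fun a b 1 = 0.
Proof. by rewrite /phase_fun /phase_logit ln1 mulr0 subr0 !mulr1 (_ : 1 + a - 2 * a = 1 - a) ?subrr//; ring. Qed.

Lemma phase_fun_equil_gap a b r : 0 < a -> phase_dom a r ->
  ((phase_fun a b r < 0) = (0 < equil_gap a b r)) *
  ((0 < phase_fun a b r) = (equil_gap a b r < 0)) *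
  ((phase_fun a b r == 0) = (equil_gap a b r == 0)).
Proof.
move=> a0 dr; have r0 := phase_dom_gt0 a0 dr.
move: dr => /andP[dr1 dr2].
have n0 : 0 < (1 + a) * r - 2 * a by rewrite subr_gt0.
have d0 : 0 < 1 - a * r by rewrite subr_gt0.
have rb0 : 0 < r `^ b by rewrite powR_gt0.
have -> : phase_fun a b r = ln ((1 + a) * r - 2 * a) - ln (r `^ b * (1 - a * r)).
  rewrite /phase_fun /phase_logit lnM ?posrE// ln_powR; ring.
rewrite /equil_gap !subr_lt0 !subr_gt0 !subr_eq0 !ltr_ln ?posrE ?mulr_gt0//.
have p0 : 0 < r `^ b * (1 - a * r) by rewrite mulr_gt0.
do 2?split => //.
by rewrite [RHS]eq_sym; apply/eqP/eqP => [/ln_inj -> //|->].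
Qed.

(** Up to the upper threshold [phase_fun] increases to its zero at 1, so no equilibrium has one
    colour below two equal ones. *)
Lemma phase_fun_lt1 a b r : 0 < a -> a < 1 -> b <= (1 + 2 * a) / (1 - a) ->
  phase_dom a r -> r < 1 -> phase_fun a b r < 0.
Proof.
move=> a0 a1 b1 dr r1; rewrite -(phase_fun1 a b).
have a1' : 0 < 1 - a by rewrite subr_gt0.
have d1 : phase_dom a 1 by apply: phase_domW; lra.
apply: (derive_incr r1 (fun x xI => is_derive_phase_fun b a0 (phase_dom_itv a0 dr d1 xI))).
move=> x /andP[rx x1].
have dx : phase_dom a x by apply: (phase_dom_itv a0 dr d1); rewrite !ltW.
have x0 := phase_dom_gt0 a0 dx; move: dx => /andP[dx1 dx2].
have n0 : 0 < (1 + a) * x - 2 * a by rewrite subr_gt0.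
have d0 : 0 < 1 - a * x by rewrite subr_gt0.
rewrite divr_gt0 ?mulr_gt0// oppr_gt0 /phase_quad subr_lt0.
have : b * (1 - a) <= 1 + 2 * a by rewrite -ler_pdivlMr.
move=> b1'; rewrite -(ltr_pM2r a1').
have h : b * (1 - a) * (((1 + a) * x - 2 * a) * (1 - a * x)) <=
    (1 + 2 * a) * (((1 + a) * x - 2 * a) * (1 - a * x)).
  by rewrite ler_pM2r// mulr_gt0.
(* At the threshold exponent [(1 - a) * phase_quad] factors as
   [- (1 + 2 a) a (1 - x) (2 - (1 + a) x)]. *)
have h2 : 0 < (1 + 2 * a) * (a * ((1 - x) * (2 - (1 + a) * x))).
  rewrite !mulr_gt0//; last nra; lra.
lra.
Qed.

(** For [x >= 1] and positive [b], [b (1 - a x) <= b (1 - a) <= 1], which makes the derivative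
    positive throughout. This is the source of the lower bound [1 / (1 - a)] for [beta_crit], from
    which both [beta_crit > 1] and its divergence follow. *)
Lemma phase_fun_ge0 a b r : 0 < a -> a < 1 -> b * (1 - a) <= 1 ->
  1 < r -> a * r < 1 -> 0 <= phase_fun a b r.
Proof.
move=> a0 a1 b1 r1 ar1; rewrite -(phase_fun1 a b).
have d1 : phase_dom a 1 by apply: phase_domW; lra.
have dr : phase_dom a r by apply: phase_domW => //; exact: ltW.
apply/ltW/(derive_incr r1 (fun x xI => is_derive_phase_fun b a0 (phase_dom_itv a0 d1 dr xI))).
move=> x /andP[x1 xr].
have dx : phase_dom a x by apply: (phase_dom_itv a0 d1 dr); rewrite !ltW.
have x0 := phase_dom_gt0 a0 dx; move: dx => /andP[dx1 dx2].
have n0 : 0 < (1 + a) * x - 2 * a by rewrite subr_gt0.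
have d0 : 0 < 1 - a * x by rewrite subr_gt0.
rewrite divr_gt0 ?mulr_gt0// oppr_gt0 /phase_quad subr_lt0.
have dle : 1 - a * x <= 1 - a by nra.
have [b0|b0] := leP b 0.
  have : b * (((1 + a) * x - 2 * a) * (1 - a * x)) <= 0 by rewrite mulr_le0_ge0// mulr_ge0 ?ltW.
  have : 0 < x * ((1 + 2 * a) * (1 - a)) by rewrite !mulr_gt0//; lra.
  lra.
have h : b * (1 - a * x) <= 1 by nra.
have : ((1 + a) * x - 2 * a) * (b * (1 - a * x)) <= (1 + a) * x - 2 * a.
  by rewrite ler_piMr// ltW.
have : 0 < a * (1 - a * x) by rewrite mulr_gt0.
lra.
Qed.

Lemma beta_crit_lb_mem a r : 0 < a -> a < 1 -> 1 < r -> a * r < 1 ->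
  (1 - a)^-1 <= phase_logit a r / ln r.
Proof.
move=> a0 a1 r1 ar; have lr : 0 < ln r by rewrite ln_gt0.
rewrite ler_pdivlMr// -subr_ge0.
by apply: phase_fun_ge0 => //; rewrite mulVf// gt_eqF// subr_gt0.
Qed.

Lemma phase_mid a : 0 < a -> a < 1 -> exists r, 1 < r /\ a * r < 1.
Proof.
(* The midpoint of 1 and [1 / a]. *)
move=> a0 a1; exists ((1 + a) / (2 * a)); have a20 : 0 < 2 * a by lra.
split; first by rewrite ltr_pdivlMr//; lra.
by rewrite mulrA ltr_pdivrMr//; nra.
Qed.

Lemma beta_crit_has_inf a : 0 < a -> a < 1 ->
  has_inf [set phase_logit a r / ln r | r in [set r | (1 < r) && (a * r < 1)]].
Proof.
move=> a0 a1; split.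
  have [r [r1 ar]] := phase_mid a0 a1.
  by exists (phase_logit a r / ln r), r => //=; apply/andP.
by exists (1 - a)^-1 => _ [r /= /andP[r1 ar] <-]; exact: beta_crit_lb_mem.
Qed.

Lemma beta_crit_le a r : 0 < a -> a < 1 -> 1 < r -> a * r < 1 ->
  beta_crit a <= phase_logit a r / ln r.
Proof.
move=> a0 a1 r1 ar; apply: ge_inf; first by case: (beta_crit_has_inf a0 a1).
by exists r => //=; apply/andP.
Qed.

Lemma beta_crit_ge a m : 0 < a -> a < 1 ->
  (forall r, 1 < r -> a * r < 1 -> m <= phase_logit a r / ln r) ->
  m <= beta_crit a.
Proof.
move=> a0 a1 h; apply: lb_le_inf; first by case: (beta_crit_has_inf a0 a1).
by move=> _ [r /= /andP[r1 ar] <-]; exact: h.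
Qed.

Lemma beta_crit_lb a : 0 < a -> a < 1 -> (1 - a)^-1 <= beta_crit a.
Proof. by move=> a0 a1; apply: beta_crit_ge => // r; exact: beta_crit_lb_mem. Qed.

(** At the threshold exponent [phase_fun] starts from 0 at [r = 1] and decreases at first. The
    exponent attached to a point where it is negative is strictly smaller than the threshold, and so
    is the infimum. *)
Lemma beta_crit_ub a : 0 < a -> a < 1 -> beta_crit a < (1 + 2 * a) / (1 - a).
Proof.
move=> a0 a1; have a1' : 0 < 1 - a by rewrite subr_gt0.
(* The midpoint of 1 and [2 / (1 + a)], the zeros of [phase_quad] at the threshold exponent; it is
   positive between them. *)
pose r := (3 + a) / (2 * (1 + a)).
have a20 : 0 < 2 * (1 + a) by lra.
have rE : r * (2 * (1 + a)) = 3 + a by rewrite /r divfK// gt_eqF.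
have r1 : 1 < r by nra.
have r2 : (1 + a) * r < 2 by nra.
have ar : a * r < 1 by nra.
have lr : 0 < ln r by rewrite ln_gt0.
apply: le_lt_trans (beta_crit_le a0 a1 r1 ar) _.
rewrite ltr_pdivrMr// -subr_lt0 -/(phase_fun _ _ _).
have d1 : phase_dom a 1 by apply: phase_domW; lra.
have dr : phase_dom a r by apply: phase_domW => //; exact: ltW.
set b := (1 + 2 * a) / (1 - a).
have bE : b * (1 - a) = 1 + 2 * a by rewrite divfK// gt_eqF.
rewrite -(phase_fun1 a b).
apply: (derive_decr r1 (fun x xI => is_derive_phase_fun b a0 (phase_dom_itv a0 d1 dr xI))).
move=> x /andP[x1 xr].
have dx : phase_dom a x by apply: (phase_dom_itv a0 d1 dr); rewrite !ltW.
have x0 := phase_dom_gt0 a0 dx; move: dx => /andP[dx1 dx2].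
have n0 : 0 < (1 + a) * x - 2 * a by rewrite subr_gt0.
have d0 : 0 < 1 - a * x by rewrite subr_gt0.
rewrite mulNr oppr_lt0 divr_gt0 ?mulr_gt0// -(pmulr_lgt0 _ a1').
rewrite /phase_quad mulrBl mulrAC bE.
have : 0 < (1 + 2 * a) * (a * ((x - 1) * (2 - (1 + a) * x))).
  rewrite !mulr_gt0//; nra.
lra.
Qed.

(** A uniform margin, since plain monotonicity in [a] would not stay strict under the infimum over
    [r]. It is proportional to [ln r], so that division by [ln r] leaves the constant
    [(b - a) / 2]. *)
Lemma phase_logit_incr a b r : 0 < a -> a < b -> b < 1 -> 1 < r -> b * r < 1 ->
  phase_logit a r + (b - a) / 2 * ln r <= phase_logit b r.
Proof.
move=> a0 ab b1 r1 br.
have ar : a * r < 1 by nra.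
have da : 0 < 1 - a * r by lra.
have db : 0 < 1 - b * r by lra.
have na : 0 < (1 + a) * r - 2 * a by nra.
have nb : 0 < (1 + b) * r - 2 * b by nra.
set na_ := (1 + a) * r - 2 * a in na *; set nb_ := (1 + b) * r - 2 * b in nb *.
set da_ := 1 - a * r in da *; set db_ := 1 - b * r in db *.
have lr : ln r <= r - 1.
  by have := @le_ln1Dx _ (r - 1); rewrite subrKC; apply; lra.
have q0 : 0 < na_ * db_ / (da_ * nb_) by rewrite divr_gt0 ?mulr_gt0.
have hq : phase_logit a r - phase_logit b r <= na_ * db_ / (da_ * nb_) - 1.
  have -> : phase_logit a r - phase_logit b r = ln (na_ * db_ / (da_ * nb_)).
    rewrite ln_div ?posrE ?mulr_gt0// !lnM ?posrE// /phase_logit; ring.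
  have := @le_ln1Dx _ (na_ * db_ / (da_ * nb_) - 1).
  by rewrite subrKC; apply; rewrite ltrBrDl subrr.
have h1 : na_ * db_ / (da_ * nb_) - 1 <= - ((b - a) / 2 * (r - 1)).
  (* With [da_ <= 1] and [nb_ <= 2 r], the factor [(r + 2) / (da_ nb_)] is at least 1/2. *)
  have -> : na_ * db_ / (da_ * nb_) - 1 =
      - ((b - a) * ((r - 1) * (r + 2)) / (da_ * nb_)).
    by rewrite /na_ /nb_ /da_ /db_; field; rewrite -/da_ -/nb_ !gt_eqF.
  rewrite lerN2 ler_pdivlMr ?mulr_gt0//.
  rewrite (_ : (b - a) / 2 * (r - 1) * (da_ * nb_) =
     (b - a) * (r - 1) * (da_ * nb_ / 2)); last by ring.
  rewrite mulrA ler_pM2l; last by rewrite mulr_gt0//; lra.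
  have : da_ * nb_ <= 1 * nb_ by rewrite ler_pM2r// /da_; nra.
  have : nb_ <= 2 * r by rewrite /nb_; nra.
  lra.
have : (b - a) / 2 * ln r <= (b - a) / 2 * (r - 1).
  by rewrite ler_pM2l//; lra.
lra.
Qed.

(** An [r] with [b r < 1] also has [a r < 1]: the larger parameter has fewer candidates, each larger
    by at least [(b - a) / 2]. *)
Lemma beta_crit_incr a b : 0 < a -> a < b -> b < 1 -> beta_crit a < beta_crit b.
Proof.
move=> a0 ab b1; have a1 := lt_trans ab b1; have b0 := lt_trans a0 ab.
apply: (@lt_le_trans _ _ (beta_crit a + (b - a) / 2)); first lra.
apply: beta_crit_ge => // r r1 br.
have ar : a * r < 1 by nra.
have lr : 0 < ln r by rewrite ln_gt0.
have := beta_crit_le a0 a1 r1 ar; have := phase_logit_incr a0 ab b1 r1 br.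
rewrite ler_pdivlMr// ler_pdivlMr// mulrDl; lra.
Qed.

Lemma beta_crit_cvg : beta_crit a @[a --> (1 : R)^'-] --> +oo.
Proof.
apply/cvgryPge => A.
near=> a.
have a1 : a < 1 by near: a; exact: nbhs_left_lt.
have a0 : 0 < a by near: a; exact: nbhs_left_gt.
have aA : 1 - (`|A| + 1)^-1 < a.
  near: a; apply: nbhs_left_gt; rewrite ltrBlDr ltrDl invr_gt0 ltr_wpDl//.
apply: le_trans (beta_crit_lb a0 a1).
apply: (@le_trans _ _ (`|A| + 1)); first by have := ler_norm A; lra.
rewrite -[leLHS]invrK lef_pV2 ?posrE ?invr_gt0 ?subr_gt0 ?ltr_wpDl//; lra.
Unshelve. all: by end_near. Qed.

End Phases.

(** * Sign pattern of the phase function above the critical exponent *)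

Section PhaseRoots.
Context {R : realType}.
Implicit Types (a b r : R).

(** Subtracting the two root equations and cancelling [m1 - m2] gives Vieta's relations, so signs
    are read off without a discriminant. *)
Lemma phase_quad_factor a b m1 m2 r : m1 != m2 ->
  phase_quad a b m1 = 0 -> phase_quad a b m2 = 0 ->
  phase_quad a b r = - (b * a * (1 + a)) * ((r - m1) * (r - m2)).
Proof.
move=> m12 q1 q2.
pose A := - (b * a * (1 + a)).
pose B := b * (1 + a + 2 * a ^+ 2) - (1 + 2 * a) * (1 - a).
pose C := - (2 * a * b).
have qE x : phase_quad a b x = A * x ^+ 2 + B * x + C.
  by rewrite /phase_quad /A /B /C; ring.
move: q1 q2; rewrite !qE -/A => q1 q2.
have : (m1 - m2) * (A * (m1 + m2) + B) = 0 by rewrite -(subrr 0) -{1}q1 -q2; ring.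
move/eqP; rewrite mulf_eq0 subr_eq0 (negPf m12)/= => /eqP BE.
have {}BE : B = - A * (m1 + m2) by lra.
have CE : C = A * m1 * m2 by rewrite -[LHS]subr0 -q1 BE; ring.
by rewrite BE CE; ring.
Qed.

Lemma phase_fun_incr a b u v : 0 < a -> phase_dom a u -> phase_dom a v ->
  u < v -> (forall x, u < x < v -> phase_quad a b x < 0) ->
  phase_fun a b u < phase_fun a b v.
Proof.
move=> a0 du dv uv q.
apply: (derive_incr uv (fun x xI => is_derive_phase_fun b a0 (phase_dom_itv a0 du dv xI))).
move=> x xI; have dx : phase_dom a x.
  by apply: (phase_dom_itv a0 du dv); case/andP: xI => *; rewrite !ltW.
have x0 := phase_dom_gt0 a0 dx; move: dx => /andP[dx1 dx2].
by rewrite divr_gt0 ?oppr_gt0 ?q// !mulr_gt0// subr_gt0.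
Qed.

Lemma phase_fun_decr a b u v : 0 < a -> phase_dom a u -> phase_dom a v ->
  u < v -> (forall x, u < x < v -> 0 < phase_quad a b x) ->
  phase_fun a b v < phase_fun a b u.
Proof.
move=> a0 du dv uv q.
apply: (derive_decr uv (fun x xI => is_derive_phase_fun b a0 (phase_dom_itv a0 du dv xI))).
move=> x xI; have dx : phase_dom a x.
  by apply: (phase_dom_itv a0 du dv); case/andP: xI => *; rewrite !ltW.
have x0 := phase_dom_gt0 a0 dx; move: dx => /andP[dx1 dx2].
by rewrite mulNr oppr_lt0 divr_gt0 ?q// !mulr_gt0// subr_gt0.
Qed.

Lemma phase_fun_IVT a b u v : 0 < a -> phase_dom a u -> phase_dom a v ->
  u < v -> phase_fun a b u * phase_fun a b v < 0 ->
  exists2 c, u < c < v & phase_fun a b c = 0.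
Proof.
move=> a0 du dv uv h.
exact: (IVT_itv uv (fun x xI => is_derive_phase_fun b a0 (phase_dom_itv a0 du dv xI)) h).
Qed.

Lemma phase_quad_IVT a b u v : u < v ->
  phase_quad a b u * phase_quad a b v < 0 ->
  exists2 c, u < c < v & phase_quad a b c = 0.
Proof.
move=> uv h; pose dq x := - (2 * (b * a * (1 + a))) * x +
  (b * (1 + a + 2 * a ^+ 2) - (1 + 2 * a) * (1 - a)).
apply: (@IVT_itv _ _ dq _ _ uv _ h) => x _.
rewrite /phase_quad /dq; apply: is_derive_eq; rewrite /GRing.scale/=; ring.
Qed.

(** [- ln (1 - a r)] blows up at [1 / a] while the other terms stay bounded; an explicit [r] is
    produced. *)
Lemma phase_fun_end a b m : 0 < a -> a < 1 -> 0 < b -> 1 < m -> a * m < 1 ->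
  exists r, [/\ m < r, a * r < 1 & 0 < phase_fun a b r].
Proof.
move=> a0 a1 b0 m1 am.
have pb : 0 < a `^ b by rewrite powR_gt0.
have pb1 : a `^ b < 1.
  have : a `^ b < 1 `^ b by rewrite gt0_ltr_powR ?nnegrE ?ltW.
  by rewrite powR1.
(* With [a r = 1 - d], the numerator is at least [1 - a] and [r <= 1 / a], so [d < z] gives
   positivity; the factor [1 - a m] in [d] gives [r > m]. *)
pose z := (1 - a) * a `^ b.
have z0 : 0 < z by rewrite mulr_gt0// subr_gt0.
have z1 : z < 1 by rewrite /z; nra.
pose d := (1 - a * m) * z / 2.
have d0 : 0 < d by rewrite !mulr_gt0// ?subr_gt0//.
have dm : d < 1 - a * m by rewrite /d; nra.
have m0 : 0 < m by lra.
have am0 : 0 < a * m * z by rewrite mulr_gt0// mulr_gt0.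
have dz : d < z by rewrite /d; lra.
have rE : a * ((1 - d) / a) = 1 - d by rewrite mulrCA divff ?mulr1// gt_eqF.
exists ((1 - d) / a); set r := (1 - d) / a in rE *.
have mr : m < r by rewrite -(ltr_pM2l a0) rE; lra.
have ar : a * r < 1 by rewrite rE; lra.
split=> //.
have hr : ln r <= - ln a.
  rewrite -lnV ?posrE// ler_ln ?posrE ?invr_gt0//; last lra.
  by rewrite -(ler_pM2l a0) divff ?gt_eqF// ltW.
have hn : ln (1 - a) <= ln ((1 + a) * r - 2 * a).
  by rewrite ler_ln ?posrE; nra.
have hd : ln (1 - a * r) < ln (1 - a) + b * ln a.
  rewrite -ln_powR -lnM ?posrE ?subr_gt0// ltr_ln ?posrE ?subr_gt0//.
  by rewrite rE subKr.
have : b * ln r <= b * - ln a by rewrite ler_pM2l.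
rewrite /phase_fun /phase_logit; lra.
Qed.

Lemma phase_quad_end a b : 0 < a -> a < 1 -> phase_quad a b a^-1 < 0.
Proof.
move=> a0 a1; rewrite /phase_quad divff ?gt_eqF// subrr !mulr0 sub0r oppr_lt0.
by rewrite !mulr_gt0 ?invr_gt0//; lra.
Qed.

Lemma phase_quad1 a b : phase_quad a b 1 = (1 - a) * (b * (1 - a) - (1 + 2 * a)).
Proof. rewrite /phase_quad; ring. Qed.

(** [phase_quad] is negative at 0, positive at 1 and negative at [1 / a], so a single critical point
    [m] exceeds 1: [phase_fun] falls from 0 until [m] and then climbs above 0 by [phase_fun_end]. *)
Lemma phase_roots_hi a b : 0 < a -> a < 1 -> (1 + 2 * a) / (1 - a) < b ->
  exists rp, [/\ 1 < rp, a * rp < 1, phase_fun a b rp = 0,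
    forall r, 1 < r -> r < rp -> phase_fun a b r < 0 &
    forall r, rp < r -> a * r < 1 -> 0 < phase_fun a b r].
Proof.
move=> a0 a1 hb; have a1' : 0 < 1 - a by rewrite subr_gt0.
have b0 : 0 < b by apply: lt_trans hb; rewrite divr_gt0//; lra.
have q1 : 0 < phase_quad a b 1.
  by rewrite phase_quad1 mulr_gt0// subr_gt0 -ltr_pdivrMr.
have q0 : phase_quad a b 0 < 0.
  rewrite /phase_quad; have : 0 < b * (2 * a) by rewrite !mulr_gt0.
  lra.
have ia1 : 1 < a^-1 by rewrite invf_gt1.
have [m0 /andP[m00 m01] qm0] : exists2 c, 0 < c < 1 & phase_quad a b c = 0.
  by apply: phase_quad_IVT => //; rewrite nmulr_rlt0.
have [m /andP[m1 mi] qm] : exists2 c, 1 < c < a^-1 & phase_quad a b c = 0.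
  by apply: phase_quad_IVT => //; rewrite pmulr_rlt0// phase_quad_end.
have am : a * m < 1 by rewrite mulrC -ltr_pdivlMr// div1r.
have qE r := @phase_quad_factor a b m0 m r (negbT (lt_eqF (lt_trans m01 m1))) qm0 qm.
have A0 : 0 < b * a * (1 + a) by rewrite !mulr_gt0//; lra.
have qneg r : m < r -> phase_quad a b r < 0.
  move=> mr; rewrite qE mulNr oppr_lt0; apply: mulr_gt0 => //.
  by apply: mulr_gt0; lra.
have qpos r : 1 < r -> r < m -> 0 < phase_quad a b r.
  move=> r1 rm; rewrite qE mulNr -mulrN mulr_gt0// -mulrN opprB mulr_gt0// subr_gt0//.
  exact: lt_trans r1.
have [r' [mr' ar' hr']] := phase_fun_end a0 a1 b0 m1 am.
have d r : 1 <= r -> a * r < 1 -> phase_dom a r by exact: phase_domW.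
have aW x y : x <= y -> a * y < 1 -> a * x < 1.
  by move=> xy; apply: le_lt_trans; rewrite ler_pM2l.
have d1 : phase_dom a 1 by apply: d; lra.
have hm r : 1 < r -> r <= m -> phase_fun a b r < 0.
  move=> r1 rm; rewrite -(phase_fun1 a b).
  apply: phase_fun_decr => //; first by apply: d; [exact: ltW|exact: aW rm am].
  by move=> x /andP[x1 xr]; apply: qpos => //; exact: lt_le_trans rm.
have dm : phase_dom a m by apply: d => //; exact: ltW.
have dr' : phase_dom a r' by apply: d => //; apply: ltW; exact: lt_trans mr'.
have [rp /andP[mrp rpr'] h0] : exists2 c, m < c < r' & phase_fun a b c = 0.
  by apply: phase_fun_IVT => //; rewrite nmulr_rlt0// hm.
have arp : a * rp < 1 by exact: aW (ltW rpr') ar'.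
have rp1 : 1 < rp by exact: lt_trans mrp.
exists rp; split=> // r.
- move=> r1 rrp; have [rm|mr] := leP r m; first exact: hm.
  have ar := aW _ _ (ltW rrp) arp.
  rewrite -h0; apply: phase_fun_incr => //; try by apply: d => //; exact: ltW.
  by move=> x /andP[x1 xr]; apply: qneg; exact: lt_trans x1.
- move=> rpr ar; rewrite -h0; apply: phase_fun_incr => //;
    try by apply: d => //; apply: ltW => //; exact: lt_trans rpr.
  by move=> x /andP[x1 xr]; apply: qneg; exact: lt_trans x1.
Qed.

(** Below the upper threshold [phase_fun] leaves 1 upwards; above the critical exponent it is
    negative somewhere. So it rises to [m1], falls to [m2] and rises again, crossing 0 twice.
    Positivity of [phase_quad] at [r1] records that the first crossing has nonzero slope, which
    makes the saddle repelling. *)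
Lemma phase_roots_mid a b : 0 < a -> a < 1 -> beta_crit a < b ->
  b < (1 + 2 * a) / (1 - a) ->
  exists r1 r2, [/\ 1 < r1, r1 < r2, a * r2 < 1, 0 < phase_quad a b r1 &
    [/\ phase_fun a b r1 = 0, phase_fun a b r2 = 0,
    forall r, 1 < r -> r < r1 -> 0 < phase_fun a b r,
    forall r, r1 < r -> r < r2 -> phase_fun a b r < 0 &
    forall r, r2 < r -> a * r < 1 -> 0 < phase_fun a b r]].
Proof.
move=> a0 a1 hb1 hb2; have a1' : 0 < 1 - a by rewrite subr_gt0.
have b0 : 0 < b.
  by apply: lt_trans hb1; apply: lt_le_trans (beta_crit_lb a0 a1); rewrite invr_gt0.
have [r0 [r01 ar0 h0]] : exists r, [/\ 1 < r, a * r < 1 & phase_fun a b r < 0].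
  have [_ [r /= /andP[r1 ar] <-] lrb] := inf_lt (beta_crit_has_inf a0 a1).1 hb1.
  exists r; split=> //; rewrite /phase_fun subr_lt0.
  by rewrite -ltr_pdivrMr// ln_gt0.
have d r : 1 <= r -> a * r < 1 -> phase_dom a r by exact: phase_domW.
have aW x y : x <= y -> a * y < 1 -> a * x < 1.
  by move=> xy; apply: le_lt_trans; rewrite ler_pM2l.
have d1 : phase_dom a 1 by apply: d; lra.
have dr0 : phase_dom a r0 by apply: d => //; exact: ltW.
have q1 : phase_quad a b 1 < 0.
  by rewrite phase_quad1 pmulr_rlt0// subr_lt0 -ltr_pdivlMr.
(* If [phase_quad] were never positive, the mean value theorem would make [phase_fun] nonnegative at
   [r0]. *)
have [x0 /andP[x01 x0r] qx0] : exists2 x, 1 < x < r0 & 0 < phase_quad a b x.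
  apply: contrapT => nq; suff : phase_fun a b 1 <= phase_fun a b r0.
    by rewrite phase_fun1 leNgt h0.
  have [//||c /[!in_itv]/= cI E] := @MVT _ (phase_fun a b)
      (fun r => - phase_quad a b r / (r * (((1 + a) * r - 2 * a) * (1 - a * r)))) 1 r0 r01.
  - move=> x /[!in_itv]/= /andP[x1 xr]; apply: is_derive_phase_fun => //.
    by apply: (phase_dom_itv a0 d1 dr0); rewrite !ltW.
  - apply: derivable_within_continuous => x /[!in_itv]/= xI.
    by have := is_derive_phase_fun b a0 (phase_dom_itv a0 d1 dr0 xI) => -[].
  - move: E; rewrite phase_fun1 subr0 => E; rewrite leNgt; apply/negP => h.
    apply: nq; exists c => //; rewrite ltNge; apply/negP => qc.
    have dc : phase_dom a c by apply: (phase_dom_itv a0 d1 dr0); case/andP: cI => *; rewrite !ltW.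
    have c0 := phase_dom_gt0 a0 dc; move: dc => /andP[dc1 dc2].
    suff : 0 <= phase_fun a b r0 by rewrite leNgt h0.
    rewrite E mulr_ge0 ?subr_ge0 ?(ltW r01)// divr_ge0 ?oppr_ge0//.
    by rewrite !mulr_ge0 ?subr_ge0// ltW.
have ax0 : a * x0 < 1 by exact: aW (ltW x0r) ar0.
have xi : x0 < a^-1 by rewrite -(ltr_pM2l a0) divff ?gt_eqF.
have [m1 /andP[m11 m1x] qm1] : exists2 c, 1 < c < x0 & phase_quad a b c = 0.
  by apply: phase_quad_IVT => //; rewrite nmulr_rlt0.
have [m2 /andP[xm2 m2i] qm2] : exists2 c, x0 < c < a^-1 & phase_quad a b c = 0.
  by apply: phase_quad_IVT => //; rewrite pmulr_rlt0// phase_quad_end.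
have am2 : a * m2 < 1 by rewrite mulrC -ltr_pdivlMr// div1r.
have m12 := lt_trans m1x xm2.
have qE r := @phase_quad_factor a b m1 m2 r (negbT (lt_eqF m12)) qm1 qm2.
have A0 : 0 < b * a * (1 + a) by rewrite !mulr_gt0//; lra.
have qlo r : r < m1 -> phase_quad a b r < 0.
  move=> rm; rewrite qE mulNr oppr_lt0 mulr_gt0//.
  by rewrite nmulr_lgt0 subr_lt0//; exact: lt_trans m12.
have qhi r : m2 < r -> phase_quad a b r < 0.
  move=> rm; rewrite qE mulNr oppr_lt0 mulr_gt0//.
  by rewrite mulr_gt0 ?subr_gt0//; exact: lt_trans rm.
have qmi r : m1 < r -> r < m2 -> 0 < phase_quad a b r.
  by move=> r1 rm; rewrite qE mulNr -mulrN mulr_gt0// -mulrN opprB mulr_gt0// subr_gt0.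
have hlo r : 1 < r -> r <= m1 -> 0 < phase_fun a b r.
  move=> r1 rm; rewrite -(phase_fun1 a b).
  apply: phase_fun_incr => //; first by apply: d; [exact: ltW|apply: aW ax0; lra].
  by move=> x /andP[x1 xr]; apply: qlo => //; exact: lt_le_trans rm.
have m1r0 : m1 < r0.
  by rewrite ltNge; apply/negP => /(hlo _ r01); rewrite ltNge ltW.
have m21 := lt_trans m11 m12.
have dm1 : phase_dom a m1 by apply: d; [exact: ltW|exact: aW (ltW m1x) ax0].
have dm2 : phase_dom a m2 by apply: d => //; exact: ltW.
(* Beyond [m1], [phase_fun] is smallest at [m2], hence at most its negative value at [r0]. *)
have hm2 : phase_fun a b m2 < 0.
  have [rm|rm|<-//] := ltgtP r0 m2.
    apply: lt_trans h0; apply: phase_fun_decr => // x /andP[? ?].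
    by apply: qmi => //; exact: lt_trans m1r0 _.
  apply: lt_trans h0; apply: phase_fun_incr => // x /andP[? ?]; exact: qhi.
have [r' [mr' ar' hr']] := phase_fun_end a0 a1 b0 m21 am2.
have dr' : phase_dom a r' by apply: d => //; apply: ltW; exact: lt_trans mr'.
have [r1 /andP[mr1 r1m] hr1] : exists2 c, m1 < c < m2 & phase_fun a b c = 0.
  by apply: phase_fun_IVT => //; rewrite pmulr_rlt0// hlo.
have [r2 /andP[mr2 r2m] hr2] : exists2 c, m2 < c < r' & phase_fun a b c = 0.
  by apply: phase_fun_IVT => //; rewrite nmulr_rlt0.
have ar1 : a * r1 < 1 by exact: aW (ltW r1m) am2.
have ar2 : a * r2 < 1 by exact: aW (ltW r2m) ar'.
have r11 := lt_trans m11 mr1; have r21 := lt_trans m21 mr2.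
have dr1 : phase_dom a r1 by apply: d => //; exact: ltW.
have dr2 : phase_dom a r2 by apply: d => //; exact: ltW.
exists r1, r2; split => //; first exact: lt_trans mr2.
  exact: qmi.
split=> // r.
- move=> rr1 rr; have [rm|mr] := leP r m1; first exact: hlo.
  rewrite -hr1; apply: phase_fun_decr => //.
    by apply: d; [exact: ltW|exact: aW (ltW rr) ar1].
  by move=> x /andP[x1 xr]; apply: qmi; [exact: lt_trans x1|exact: lt_trans r1m].
- move=> rr1 rr; have r1' := lt_trans r11 rr1.
  have dr : phase_dom a r by apply: d; [exact: ltW|exact: aW (ltW rr) ar2].
  have [rm|mr|->//] := ltgtP r m2.
    rewrite -hr1; apply: phase_fun_decr => //.
    by move=> x /andP[x1 xr]; apply: qmi; [exact: lt_trans x1|exact: lt_trans rm].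
  rewrite -hr2; apply: phase_fun_incr => //.
  by move=> x /andP[x1 xr]; apply: qhi; exact: lt_trans x1.
- move=> rr1 ar; rewrite -hr2; apply: phase_fun_incr => //.
    by apply: d => //; apply/ltW/(lt_trans r21).
  by move=> x /andP[x1 xr]; apply: qhi; exact: lt_trans x1.
Qed.

End PhaseRoots.

(** * Drift and Lyapunov functions on the simplex *)

Section Simplex.
Context {R : realType}.
Implicit Types (x y : 'I_3 -> R).

Lemma sum3 (V : nmodType) (i j k : 'I_3) (f : 'I_3 -> V) :
  i != j -> i != k -> j != k -> \sum_l f l = f i + f j + f k.
Proof.
move=> ij ik jk; rewrite (bigD1 i)//= (bigD1 j) 1?eq_sym//= (bigD1 k)/=; last first.
  by rewrite !(eq_sym k) ik jk.
rewrite big1 ?addr0 ?addrA// => l /andP[/andP[li lj] lk].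
by move: i j k l ij ik jk li lj lk => [[|[|[|//]]] ?] [[|[|[|//]]] ?] [[|[|[|//]]] ?] [[|[|[|//]]] ?].
Qed.

Lemma ord3_cases (i j k l : 'I_3) : i != j -> i != k -> j != k ->
  [\/ l = i, l = j | l = k].
Proof.
move=> ij ik jk; have [->|li] := eqVneq l i; first by constructor 1.
have [->|lj] := eqVneq l j; first by constructor 2.
have [->|lk] := eqVneq l k; first by constructor 3.
by move: i j k l ij ik jk li lj lk => [[|[|[|//]]] ?] [[|[|[|//]]] ?] [[|[|[|//]]] ?] [[|[|[|//]]] ?].
Qed.

(** Lets computations be made for three pairwise distinct colours without a privileged numbering. *)
Lemma ord3_compl (i : 'I_3) : exists j k : 'I_3, [/\ i != j, i != k & j != k].
Proof.
have h2 : (2 < 3)%N by []. have h1 : (1 < 3)%N by [].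
move: i => [[|[|[|//]]] ?]; [exists (Ordinal h1), (Ordinal h2)|
  exists ord0, (Ordinal h2)|exists ord0, (Ordinal h1)]; by split.
Qed.

Definition simplex3 x := (forall i, 0 <= x i) /\ \sum_i x i = 1.

(** Drawing colour [i] moves the proportions a fraction [g] of the way to vertex [i]; in the urn [g]
    is the inverse of the number of balls after the draw. *)
Definition simplex_step x (g : R) (i : 'I_3) : 'I_3 -> R :=
  fun j => x j + g * ((j == i)%:R - x j).

Lemma simplex3_le1 x i : simplex3 x -> x i <= 1.
Proof.
by move=> [x0 <-]; rewrite (bigD1 i)//= lerDl sumr_ge0.
Qed.

Lemma simplex_step_simplex3 x g i : simplex3 x -> 0 <= g <= 1 ->
  simplex3 (simplex_step x g i).
Proof.
move=> [x0 x1] /andP[g0 g1]; split=> [j|].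
  rewrite /simplex_step; have := x0 j; case: (j == i) => /= ?; nra.
rewrite big_split/= x1 -mulr_sumr sumrB x1 (bigD1 i)//= eqxx big1 ?addr0 ?subrr ?mulr0 ?addr0//.
by move=> j /negPf ->.
Qed.

Lemma simplex_step_dist x g i j : simplex3 x -> 0 <= g ->
  `|simplex_step x g i j - x j| <= g.
Proof.
move=> sx g0; rewrite /simplex_step addrC addKr normrM ger0_norm//.
rewrite -[leRHS]mulr1 ler_wpM2l// ler_norml.
have := simplex3_le1 j sx; have := sx.1 j; case: (j == i) => /= *; lra.
Qed.

Definition pow_sum (b : R) x : R := \sum_i x i `^ b.

(** Some coordinate is at least 1/3. The bound keeps the denominators of the shares away from 0
    uniformly. *)
Lemma pow_sum_lb b x : 0 <= b -> simplex3 x -> (1 / 3) `^ b <= pow_sum b x.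
Proof.
move=> b0 [x0 x1].
have [i xi] : exists i, 1 / 3 <= x i.
  apply: contrapT => /forallNP h.
  suff : \sum_i x i < \sum_(i < 3) (1 / 3 : R).
    by rewrite x1 sumr_const card_ord -mulr_natr; lra.
  apply: ltr_sum; first by apply/hasP; exists ord0; rewrite ?mem_index_enum.
  by move=> i _; rewrite ltNge; apply/negP/h.
rewrite /pow_sum (bigD1 i)//=; apply: ler_wpDr.
  by apply: sumr_ge0 => j _; exact: powR_ge0.
by rewrite ge0_ler_powR ?nnegrE//; lra.
Qed.

Lemma pow_sum_gt0 b x : 0 <= b -> simplex3 x -> 0 < pow_sum b x.
Proof.
by move=> b0 sx; apply: lt_le_trans (pow_sum_lb b0 sx); rewrite powR_gt0//; lra.
Qed.

Lemma pow_sum_le3 b x : 0 <= b -> simplex3 x -> pow_sum b x <= 3.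
Proof.
move=> b0 sx; have -> : 3 = \sum_(i < 3) (1 : R) by rewrite sumr_const card_ord.
apply: ler_sum => i _.
have : x i `^ b <= 1 `^ b.
  by rewrite ge0_ler_powR ?nnegrE ?ler01//; [exact: sx.1|exact: simplex3_le1].
by rewrite powR1.
Qed.

Definition share (b : R) x (i : 'I_3) : R := x i `^ b / pow_sum b x.

Lemma share_ge0 b x i : 0 <= share b x i.
Proof. by rewrite divr_ge0 ?powR_ge0// sumr_ge0// => j _; exact: powR_ge0. Qed.

Lemma sum_share b x : 0 <= b -> simplex3 x -> \sum_i share b x i = 1.
Proof.
by move=> b0 sx; rewrite -mulr_suml divff// gt_eqF// pow_sum_gt0.
Qed.

Lemma share_le1 b x i : 0 <= b -> simplex3 x -> share b x i <= 1.
Proof.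
move=> b0 sx; rewrite -(sum_share b0 sx) (bigD1 i)//= lerDl sumr_ge0// => j _.
exact: share_ge0.
Qed.

End Simplex.

Section Drift.
Context {R : realType}.
Variables (p c b : R).
Hypotheses (p0 : 0 < p) (pc0 : 0 < p + c) (pc1 : 3 * p + c = 1) (b0 : 0 < b).
Implicit Types (x y : 'I_3 -> R).

Definition urn_prob x i : R := p + c * share b x i.
Definition urn_drift x i : R := urn_prob x i - x i.

(** [c] is negative when [a > 1], hence the minimum: the values run between [p] (share 0) and
    [p + c] (share 1). *)
Lemma urn_prob_lb x i : simplex3 x -> Num.min p (p + c) <= urn_prob x i.
Proof.
move=> sx; have := share_ge0 b x i; have := share_le1 i (ltW b0) sx.
by rewrite /urn_prob ge_min; have [c0|c0] := leP 0 c => *; apply/orP; [left|right]; nra.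
Qed.

Lemma urn_prob_gt0 x i : simplex3 x -> 0 < urn_prob x i.
Proof. by move=> sx; apply: lt_le_trans (urn_prob_lb i sx); rewrite lt_min p0. Qed.

Lemma sum_urn_prob x : simplex3 x -> \sum_i urn_prob x i = 1.
Proof.
move=> sx; rewrite big_split/= -mulr_sumr (sum_share (ltW b0) sx) mulr1.
by rewrite sumr_const card_ord -mulr_natl.
Qed.

Lemma sum_urn_drift x : simplex3 x -> \sum_i urn_drift x i = 0.
Proof. by move=> sx; rewrite sumrB sum_urn_prob// sx.2 subrr. Qed.

Lemma urn_prob_le1 x i : simplex3 x -> urn_prob x i <= 1.
Proof.
move=> sx; rewrite -(sum_urn_prob sx) (bigD1 i)//= lerDl sumr_ge0// => j _.
by rewrite ltW// urn_prob_gt0.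
Qed.

Lemma urn_drift_norm x i : simplex3 x -> `|urn_drift x i| <= 1.
Proof.
move=> sx; rewrite ler_norml /urn_drift.
have := urn_prob_le1 i sx; have := urn_prob_gt0 i sx.
have := simplex3_le1 i sx; have := sx.1 i => *; lra.
Qed.

Definition urn_mean (L : ('I_3 -> R) -> R) x (g : R) : R :=
  \sum_i urn_prob x i * L (simplex_step x g i).

(** Averaging the displacement [e_i - x] over the draw gives exactly the drift, so a first-order
    bound for each draw becomes one in terms of the drift. *)
Lemma urn_mean_lb (L : ('I_3 -> R) -> R) x (grad : 'I_3 -> R) (g e : R) :
  simplex3 x ->
  (forall i, L x + g * (\sum_j grad j * ((j == i)%:R - x j)) - e <=
     L (simplex_step x g i)) ->
  L x + g * (\sum_j grad j * urn_drift x j) - e <= urn_mean L x g.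
Proof.
move=> sx h.
apply: (@le_trans _ _ (\sum_i urn_prob x i *
    (L x + g * (\sum_j grad j * ((j == i)%:R - x j)) - e))); last first.
  by apply: ler_sum => i _; rewrite ler_wpM2l// ltW// urn_prob_gt0.
have -> : \sum_i urn_prob x i * (L x + g * (\sum_j grad j * ((j == i)%:R - x j)) - e)
  = \sum_i (urn_prob x i * (L x - e) +
       g * (urn_prob x i * (\sum_j grad j * ((j == i)%:R - x j)))).
  by apply: eq_bigr => i _; ring.
rewrite big_split/= -mulr_suml sum_urn_prob// mul1r -mulr_sumr.
suff -> : \sum_i urn_prob x i * (\sum_j grad j * ((j == i)%:R - x j)) =
    \sum_j grad j * urn_drift x j by rewrite addrAC.
under eq_bigr do rewrite mulr_sumr.
rewrite exchange_big/=; apply: eq_bigr => j _.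
have d : \sum_i urn_prob x i * (j == i)%:R = urn_prob x j.
  rewrite (bigD1 j)//= eqxx mulr1 big1 ?addr0// => i /negPf ij.
  by rewrite eq_sym ij mulr0.
transitivity (\sum_i (grad j * (urn_prob x i * (j == i)%:R) -
    grad j * x j * urn_prob x i)).
  by apply: eq_bigr => i _; ring.
by rewrite sumrB -!mulr_sumr d sum_urn_prob// /urn_drift; ring.
Qed.

(** The left side is [- V + c U], where [U] pairs [x - 1 / 3] with the shares. [U >= 0] because the
    shares are ordered like [x], which settles [c <= 0]; for [b <= 1] the shares are less spread
    than [x], so [U <= V]. *)
Lemma urn_drift_quad x : c <= 0 \/ c < 1 /\ b <= 1 -> simplex3 x ->
  \sum_j (x j - 1 / 3) * urn_drift x j <=
    - (1 - Num.max 0 c) * \sum_j (x j - 1 / 3) ^+ 2.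
Proof.
move=> hc sx; have S0 := pow_sum_gt0 (ltW b0) sx.
have [j [k [ij ik jk]]] := ord3_compl (ord0 : 'I_3).
set i := ord0 in ij ik.
have s3 := fun f : 'I_3 -> R => sum3 f ij ik jk.
have := sx.2; have := sum_share (ltW b0) sx.
rewrite !s3 => w1 x1.
set V := (X in _ <= _ * X).
pose U := (x i - 1 / 3) * share b x i + (x j - 1 / 3) * share b x j +
  (x k - 1 / 3) * share b x k.
have -> : (x i - 1 / 3) * urn_drift x i + (x j - 1 / 3) * urn_drift x j +
  (x k - 1 / 3) * urn_drift x k = - V + c * U.
  rewrite /V /U /urn_drift /urn_prob.
  have -> : p = (1 - c) / 3 by move: pc1; lra.
  have -> : x k = 1 - x i - x j by rewrite -x1; ring.
  have -> : share b x k = 1 - share b x i - share b x j by rewrite -w1; ring.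
  by field.
(* Both [x] and the shares sum to 1, which turns [U] into a sum over pairs. *)
have UE : 3 * U = (x i - x j) * (share b x i - share b x j) +
  (x i - x k) * (share b x i - share b x k) +
  (x j - x k) * (share b x j - share b x k).
  rewrite /U; have -> : x k = 1 - x i - x j by rewrite -x1; ring.
  have -> : share b x k = 1 - share b x i - share b x j by rewrite -w1; ring.
  by field.
have mono u v : 0 <= (x u - x v) * (share b x u - share b x v).
  rewrite /share -mulrBl mulrA divr_ge0 ?(ltW S0)//.
  have xu := sx.1 u; have xv := sx.1 v.
  have [uv|vu] := leP (x u) (x v).
    rewrite mulr_le0// ?subr_le0//.
    by rewrite ge0_ler_powR ?nnegrE// ltW.
  rewrite mulr_ge0 ?subr_ge0// ?(ltW vu)//.
  by rewrite ge0_ler_powR ?nnegrE// ltW.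
have U0 : 0 <= U by rewrite -(pmulr_rge0 _ (ltr0n R 3)) UE !addr_ge0.
have V0 : 0 <= V by rewrite /V !addr_ge0// sqr_ge0.
have VE : V = x i ^+ 2 + x j ^+ 2 + x k ^+ 2 - 1 / 3.
  rewrite /V; have -> : x k = 1 - x i - x j by rewrite -x1; ring.
  by field.
have UE2 : U = x i * share b x i + x j * share b x j + x k * share b x k - 1 / 3.
  rewrite /U; have -> : share b x k = 1 - share b x i - share b x j by rewrite -w1; ring.
  by field.
clearbody U V.
have [c0|c0] := leP c 0; first by nra.
case: hc => [|[c1 b1]]; first by rewrite leNgt c0.
suff : U <= V by nra.
rewrite UE2 VE lerB//.
rewrite /share !mulrA -!mulrDl ler_pdivrMr//.
have SE : pow_sum b x = x i `^ b + x j `^ b + x k `^ b by rewrite /pow_sum s3.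
(* For [0 < s <= t], [t ^ (b - 1) <= s ^ (b - 1)] because [b <= 1]; the three pairwise inequalities
   add up to [U <= V]. *)
have ineq u v : 0 <= (x v - x u) * (x u `^ b * x v - x v `^ b * x u).
  have xu := sx.1 u; have xv := sx.1 v.
  have key s t : 0 <= s -> s <= t -> t `^ b * s <= s `^ b * t.
    rewrite le_eqVlt => /predU1P[<-|s0] st.
      by rewrite mulr0 mulr_ge0// powR_ge0.
    have t0 := lt_le_trans s0 st.
    have sp z : 0 < z -> z = z `^ b * z `^ (1 - b).
      move=> z0; rewrite -powRD; first by rewrite subrKC powRr1// ltW.
      by apply/implyP => _; rewrite gt_eqF.
    rewrite {1}(sp s s0) {2}(sp t t0) mulrCA ler_wpM2l ?powR_ge0//.
    by rewrite ler_wpM2l ?powR_ge0// ge0_ler_powR ?nnegrE ?subr_ge0// ltW.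
  have [uv|vu] := leP (x u) (x v).
    by rewrite mulr_ge0 ?subr_ge0//; exact: key.
  by rewrite mulr_le0 ?subr_le0// ?(ltW vu)//; apply: key => //; exact: ltW.
have := ineq i j; have := ineq i k; have := ineq j k.
rewrite SE => h1 h2 h3; rewrite -[leLHS]mulr1 -[X in _ * X <= _]x1.
lra.
Qed.

End Drift.

(** * Second-order bounds for the terms of the potential *)

Section Lyapunov.
Context {R : realType}.
Implicit Types (x y : 'I_3 -> R).

Lemma ln_leB1 (z : R) : 0 < z -> ln z <= z - 1.
Proof. by move=> z0; have := @le_ln1Dx _ (z - 1); rewrite subrKC; apply; lra. Qed.

Lemma ln_geB1V (z : R) : 0 < z -> 1 - z^-1 <= ln z.
Proof.
move=> z0; have := ln_leB1 (etrans (invr_gt0 z) z0).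
by rewrite lnV ?posrE//; lra.
Qed.

Lemma ln1D_lb (u : R) : - (1 / 2) <= u -> u - 2 * u ^+ 2 <= ln (1 + u).
Proof.
move=> hu; have u0 : 0 < 1 + u by lra.
apply: le_trans (ln_geB1V u0).
rewrite -(ler_pM2r u0) [leRHS]mulrBl mulVf ?gt_eqF// mul1r.
have : 0 <= u ^+ 2 * (1 + 2 * u) by rewrite mulr_ge0 ?sqr_ge0//; lra.
rewrite -[2]/(1 *+ 2) expr2; lra.
Qed.

(* A concave, continuously differentiable extension of [ln] (shifted so as to
   agree with it on [[eta, +oo[]) by its tangent at [eta]. *)
Definition ln_ext (eta t : R) : R := ln (Num.max t eta) + Num.min t eta / eta - 1.

(** The derivative [1 / Num.max x eta] is Lipschitz with constant [1 / eta ^ 2], hence a quadratic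
    error. The cases follow the sides of [eta] on which [x] and [y] lie, and all rest on
    [1 - 1 / z <= ln z]. *)
Lemma ln_ext_lb (eta x y : R) : 0 < eta ->
  ln_ext eta x + (y - x) / Num.max x eta - (y - x) ^+ 2 / eta ^+ 2
    <= ln_ext eta y.
Proof.
move=> e0.
have lnB (u v : R) : 0 < u -> 0 < v -> (v - u) / v <= ln v - ln u.
  move=> u0 v0; rewrite -ln_div ?posrE//.
  apply: le_trans (ln_geB1V (divr_gt0 v0 u0)); rewrite invf_div.
  by rewrite mulrBl divff ?gt_eqF.
have sq (z : R) : z ^+ 2 / eta ^+ 2 = (z / eta) ^+ 2 by rewrite expr_div_n.
rewrite /ln_ext sq; have [xe|ex] := leP x eta; have [ye|ey] := leP y eta.
- have : 0 <= ((y - x) / eta) ^+ 2 by exact: sqr_ge0.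
  rewrite !mulrBl; lra.
- have h := lnB _ _ e0 (lt_trans e0 ey).
  have : (y - x) / eta - ((y - x) / eta) ^+ 2 <= (y - eta) / y + (eta - x) / eta.
    have y0 := lt_trans e0 ey.
    have -> : (y - eta) / y = (y - eta) / eta - (y - eta) / eta * ((y - eta) / y).
      by field; rewrite !gt_eqF.
    have : (y - eta) / eta * ((y - eta) / y) <= ((y - x) / eta) ^+ 2.
      rewrite expr2; apply: ler_pM.
      - by rewrite divr_ge0 ?(ltW e0)//; lra.
      - by rewrite divr_ge0 ?(ltW y0)//; lra.
      - by rewrite ler_pM2r ?invr_gt0//; lra.
      - rewrite ler_pM ?invr_ge0 ?(ltW y0)//; try lra.
        by rewrite lef_pV2 ?posrE// ltW.
    have -> : (y - x) / eta = (y - eta) / eta + (eta - x) / eta by field; rewrite gt_eqF.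
    lra.
  rewrite divff ?gt_eqF// [(eta - x) / eta]mulrBl divff ?gt_eqF//; lra.
- have x0 := lt_trans e0 ex.
  have h := lnB _ _ x0 e0.
  have : (y - x) / x - ((y - x) / eta) ^+ 2 <= (eta - x) / eta + (y - eta) / eta.
    have -> : (eta - x) / eta + (y - eta) / eta = (y - x) / eta by field; rewrite gt_eqF.
    have -> : (y - x) / x = (y - x) / eta + (x - y) / eta * ((x - eta) / x).
      by field; rewrite !gt_eqF.
    have : (x - y) / eta * ((x - eta) / x) <= ((y - x) / eta) ^+ 2.
      rewrite -sqrrN -mulNr opprB expr2; apply: ler_pM.
      - by rewrite divr_ge0 ?(ltW e0)//; lra.
      - by rewrite divr_ge0 ?(ltW x0)//; lra.
      - by [].
      - rewrite ler_pM ?invr_ge0 ?(ltW x0)//; try lra.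
        by rewrite lef_pV2 ?posrE// ltW.
    lra.
  rewrite divff ?gt_eqF// [(y - eta) / eta]mulrBl divff ?gt_eqF//; lra.
- have x0 := lt_trans e0 ex; have y0 := lt_trans e0 ey.
  have h := lnB _ _ x0 y0.
  have : (y - x) / x - ((y - x) / eta) ^+ 2 <= (y - x) / y.
    have -> : (y - x) / x = (y - x) / y + (y - x) ^+ 2 / (x * y).
      by field; rewrite !gt_eqF.
    rewrite lerBlDr lerD2l -sq ler_wpM2l ?sqr_ge0// lef_pV2 ?posrE ?mulr_gt0 ?exprn_gt0//.
    by rewrite expr2 ler_pM// ltW.
  rewrite divff ?gt_eqF//; lra.
Qed.

Lemma ln_ext_le0 (eta t : R) : 0 < eta <= 1 -> t <= 1 -> ln_ext eta t <= 0.
Proof.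
move=> /andP[e0 e1] t1; rewrite /ln_ext.
have : ln (Num.max t eta) <= 0 by rewrite ln_le0// ge_max t1.
have : Num.min t eta / eta <= 1 by rewrite ler_pdivrMr// mul1r ge_min lexx orbT.
lra.
Qed.

Lemma ln_extE (eta t : R) : 0 < eta -> eta <= t -> ln_ext eta t = ln t.
Proof.
by move=> e0 et; rewrite /ln_ext max_l// min_r// divff ?gt_eqF// addrK.
Qed.

(** Convexity of [t ^ b] bounds the new power sum below by its tangent, so only [ln] costs a
    second-order term; the bound on [g] brings the relative increment [u] into the range of
    [ln1D_lb]. *)
Lemma ln_pow_sum_lb (b g : R) x y : 1 < b -> simplex3 x -> simplex3 y ->
  (forall j, `|y j - x j| <= g) -> 3 * b / (1 / 3) `^ b * g <= 1 / 2 ->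
  ln (pow_sum b x) + \sum_j (b * x j `^ (b - 1) / pow_sum b x) * (y j - x j)
     - 2 * (3 * b / (1 / 3) `^ b * g) ^+ 2 <= ln (pow_sum b y).
Proof.
move=> b1 sx sy yx hg; have b0 : 0 < b by lra.
have Sx := pow_sum_gt0 (ltW b0) sx; have Sy := pow_sum_gt0 (ltW b0) sy.
have s0 : 0 < (1 / 3 : R) `^ b by rewrite powR_gt0//; lra.
set K := 3 * b / (1 / 3) `^ b in hg *.
set u := \sum_j _.
have uK : `|u| <= K * g.
  apply: le_trans (ler_norm_sum _ _ _) _.
  apply: (@le_trans _ _ (\sum_(j < 3) b / (1 / 3) `^ b * g)); last first.
    by rewrite sumr_const card_ord -[leLHS]mulr_natl /K; lra.
  apply: ler_sum => j _; rewrite normrM ler_pM//.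
  rewrite ger0_norm; last by rewrite divr_ge0 ?mulr_ge0 ?powR_ge0 ?ltW.
  rewrite ler_pM ?mulr_ge0 ?powR_ge0 ?invr_ge0 ?(ltW b0) ?(ltW Sx)//.
    have : x j `^ (b - 1) <= 1 `^ (b - 1).
      rewrite ge0_ler_powR ?nnegrE ?ler01//; [lra|exact: sx.1|exact: simplex3_le1].
    by rewrite powR1 => ?; rewrite ler_piMr// ltW.
  by rewrite lef_pV2 ?posrE// pow_sum_lb// ltW.
have u2 : - (1 / 2) <= u by move: uK; rewrite ler_norml => /andP[]; lra.
have SS : pow_sum b x * (1 + u) <= pow_sum b y.
  rewrite mulrDr mulr1 mulr_sumr -big_split/=; apply: ler_sum => j _.
  rewrite mulrA (mulrCA (pow_sum b x)) divff ?gt_eqF// mulr1.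
  exact: powR_tangent (sx.1 j) (sy.1 j).
have u1 : 0 < 1 + u by lra.
have : ln (pow_sum b x * (1 + u)) <= ln (pow_sum b y).
  by rewrite ler_ln ?posrE ?mulr_gt0.
rewrite lnM ?posrE// => h1.
have h2 := ln1D_lb u2.
have : u ^+ 2 <= (K * g) ^+ 2.
  rewrite -[u ^+ 2]ger0_norm ?sqr_ge0// normrX lerXn2r ?nnegrE//.
  by apply: le_trans uK.
lra.
Qed.

Lemma share_lip (b g : R) x y i : 1 < b -> simplex3 x -> simplex3 y ->
  (forall j, `|y j - x j| <= g) ->
  `|share b y i - share b x i| <= 4 * b / (1 / 3) `^ b * g.
Proof.
move=> b1 sx sy yx; have b0 : 0 < b by lra.
have Sx := pow_sum_gt0 (ltW b0) sx; have Sy := pow_sum_gt0 (ltW b0) sy.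
have s0 : 0 < (1 / 3 : R) `^ b by rewrite powR_gt0//; lra.
have g0 : 0 <= g by apply: le_trans (yx i).
have hp j : `|y j `^ b - x j `^ b| <= b * g.
  apply: le_trans (powR_lip b1 _ _) _; try by rewrite ?sx.1 ?sy.1 simplex3_le1.
  by rewrite ler_pM2l.
have hS : `|pow_sum b x - pow_sum b y| <= 3 * (b * g).
  rewrite -sumrB; apply: le_trans (ler_norm_sum _ _ _) _.
  have -> : 3 * (b * g) = \sum_(j < 3) (b * g) by rewrite sumr_const card_ord mulr_natl.
  by apply: ler_sum => j _; rewrite distrC.
have -> : share b y i - share b x i =
   ((y i `^ b - x i `^ b) + share b x i * (pow_sum b x - pow_sum b y)) / pow_sum b y.
  by rewrite /share; field; rewrite !gt_eqF.
rewrite normrM normfV (gtr0_norm Sy).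
have -> : 4 * b / (1 / 3) `^ b * g = (4 * (b * g)) / (1 / 3) `^ b by ring.
rewrite ler_pM ?invr_ge0 ?(ltW Sy)//; last first.
  by rewrite lef_pV2 ?posrE// pow_sum_lb// ltW.
apply: le_trans (ler_normD _ _) _.
have : `|share b x i * (pow_sum b x - pow_sum b y)| <= 3 * (b * g).
  rewrite normrM -[leRHS]mul1r ler_pM// ger0_norm ?share_ge0//.
  by rewrite share_le1// ltW.
have := hp i; lra.
Qed.

End Lyapunov.

Section LyapunovPair.
Context {R : realType}.
Implicit Types (x y : 'I_3 -> R).

(** What makes [psi] vanish along almost every path: [L] being bounded above makes the expected sum
    of [g * psi] finite, and the Lipschitz condition along steps forbids isolated peaks of [psi].
    The drift bound is asked for small [g], that is, at late times. *)
Definition lyapunov_pair (p c b : R) (L psi : ('I_3 -> R) -> R) :=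
  exists C g0 M : R, [/\ 0 <= C, 0 < g0 <= 1,
    forall x, simplex3 x -> L x <= M /\ 0 <= psi x,
    forall x g, simplex3 x -> 0 <= g <= g0 ->
      L x + g * psi x - C * g ^+ 2 <= urn_mean p c b L x g &
    forall x i g, simplex3 x -> 0 <= g <= 1 ->
      `|psi (simplex_step x g i) - psi x| <= C * g].

Lemma sqr_lip (u v : R) : `|u| <= 1 -> `|v| <= 1 -> `|u ^+ 2 - v ^+ 2| <= 2 * `|u - v|.
Proof.
move=> u1 v1; rewrite subr_sqr normrM mulrC ler_wpM2r//.
by apply: le_trans (ler_normD _ _) _; lra.
Qed.

Lemma sum3_norm_le (f : 'I_3 -> R) (e : R) : (forall j, `|f j| <= e) ->
  `|\sum_j f j| <= 3 * e.
Proof.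
move=> fe; apply: le_trans (ler_norm_sum _ _ _) _.
have -> : 3 * e = \sum_(j < 3) e by rewrite sumr_const card_ord mulr_natl.
exact: ler_sum.
Qed.

(** The increment of the squared distance is its linear term plus at most [3 g ^ 2]. The constant 12
    comes from the Lipschitz condition: three coordinates, each with constant 2, times a factor at
    most 2. *)
Lemma lyapunov_pair_quad (p c b : R) : 0 < p -> 0 < p + c -> 3 * p + c = 1 ->
  0 < b -> c <= 0 \/ c < 1 /\ b <= 1 ->
  lyapunov_pair p c b (fun x => - \sum_j (x j - 1 / 3) ^+ 2)
    (fun x => 2 * (1 - Num.max 0 c) * \sum_j (x j - 1 / 3) ^+ 2).
Proof.
move=> p0 pc0 pc1 b0 hc.
have m1 : 0 <= 1 - Num.max 0 c <= 1.
  by have [c0|c0] := leP c 0; case: hc => [|[]]; lra.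
exists 12, 1, 0; split=> //; first by rewrite ltr01 lexx.
- move=> x sx; have ? : 0 <= \sum_j (x j - 1 / 3) ^+ 2 by rewrite sumr_ge0// => *; rewrite sqr_ge0.
  split; first lra.
  by rewrite !mulr_ge0//; lra.
- move=> x g sx /andP[g0 g1].
  pose grad j := - (2 * (x j - 1 / 3)).
  apply: le_trans (urn_mean_lb p0 pc0 pc1 b0 (grad := grad) (e := 12 * g ^+ 2) sx _).
    rewrite lerB// lerD2l ler_wpM2l//.
    have := urn_drift_quad pc1 b0 hc sx.
    have -> : \sum_j grad j * urn_drift p c b x j =
        - (2 * \sum_j (x j - 1 / 3) * urn_drift p c b x j).
      by rewrite mulr_sumr -sumrN; apply: eq_bigr => j _; rewrite /grad; ring.
    lra.
  move=> i; set V := \sum_j (x j - 1 / 3) ^+ 2.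
  have -> : \sum_j (simplex_step x g i j - 1 / 3) ^+ 2 =
      V - g * (\sum_j grad j * ((j == i)%:R - x j)) +
      \sum_j (simplex_step x g i j - x j) ^+ 2.
    rewrite mulr_sumr -sumrB -big_split/=; apply: eq_bigr => j _.
    rewrite /simplex_step /grad; ring.
  have : \sum_j (simplex_step x g i j - x j) ^+ 2 <= 3 * g ^+ 2.
    apply: le_trans (ler_norm _) _; apply: sum3_norm_le => j.
    by rewrite normrX lerXn2r ?nnegrE//; exact: simplex_step_dist.
  have : 0 <= g ^+ 2 by rewrite sqr_ge0.
  lra.
- move=> x i g sx /andP[g0 g1].
  rewrite -mulrBr normrM ger0_norm; last lra.
  apply: (@le_trans _ _ (2 * (6 * g))); last lra.
  apply: ler_pM => //; try lra.
  rewrite -sumrB; apply: (@le_trans _ _ (3 * (2 * g))); last lra.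
  apply: sum3_norm_le => j.
  have sy := simplex_step_simplex3 i sx (introT andP (conj g0 g1)).
  apply: le_trans (sqr_lip _ _) _.
  + by have := simplex3_le1 j sy; have := sy.1 j; rewrite ler_norml; lra.
  + by have := simplex3_le1 j sx; have := sx.1 j; rewrite ler_norml; lra.
  rewrite ler_wpM2l// opprB addrA subrK; exact: simplex_step_dist.
Qed.

(** The potential of the overview with [ln] extended below [p / 2]. For [0 <= c], a coordinate below
    [p / 2] has drift at least [p / 2], so the extension keeps the right sign. *)
Definition urn_potential (p c b : R) x : R :=
  p * (\sum_j ln_ext (p / 2) (x j)) + c / b * ln (pow_sum b x).

(** Where [x j > p / 2] the bracket equals [F / x j], because [p / x + c x ^ (b - 1) / S] is
    [urn_prob / x], and [x j <= 1]. Elsewhere the bracket is at least 1 and [0 <= F <= 1]. *)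
Lemma urn_potential_grad (p c b : R) x j : 0 < p -> 0 <= c -> 3 * p + c = 1 ->
  1 < b -> simplex3 x ->
  urn_drift p c b x j ^+ 2 <=
  (p / Num.max (x j) (p / 2) + c * x j `^ (b - 1) / pow_sum b x - 1) *
    urn_drift p c b x j.
Proof.
move=> p0 c0 pc1 b1 sx; have b0 : 0 < b by lra.
have pc0 : 0 < p + c by lra.
have S0 := pow_sum_gt0 (ltW b0) sx.
have x0 := sx.1 j; have x1 := simplex3_le1 j sx.
set F := urn_drift _ _ _ _ _.
have F1 : `|F| <= 1 by exact: urn_drift_norm.
have w0 : 0 <= c * share b x j by rewrite mulr_ge0// share_ge0.
have FE : F = p + c * share b x j - x j by [].
have [xe|ex] := leP (x j) (p / 2).
- have F0 : 0 <= F by rewrite FE; lra.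
  have F1' : F <= 1 by move: F1; rewrite ler_norml => /andP[].
  have g2 : 1 <= p / (p / 2) + c * x j `^ (b - 1) / pow_sum b x - 1.
    have -> : p / (p / 2) = 2 by field; rewrite gt_eqF.
    have : 0 <= c * x j `^ (b - 1) / pow_sum b x.
      by rewrite divr_ge0 ?(ltW S0)// mulr_ge0// powR_ge0.
    lra.
  rewrite expr2 ler_wpM2r//; lra.
- have xp : 0 < x j by apply: le_lt_trans ex; lra.
  have -> : p / x j + c * x j `^ (b - 1) / pow_sum b x - 1 = F / x j.
    rewrite FE /share -(mulr_powRB1 x0 b0); field.
    by rewrite !gt_eqF.
  rewrite expr2 mulrAC ler_pdivlMr// ler_piMr// -expr2; exact: sqr_ge0.
Qed.

Lemma lyapunov_pair_potential (p c b : R) : 0 < p -> 0 <= c -> 3 * p + c = 1 ->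
  1 < b ->
  lyapunov_pair p c b (urn_potential p c b)
    (fun x => \sum_j urn_drift p c b x j ^+ 2).
Proof.
move=> p0 c0 pc1 b1; have b0 : 0 < b by lra.
have pc0 : 0 < p + c by lra.
have c1 : c <= 1 by lra.
have s0 : 0 < (1 / 3 : R) `^ b by rewrite powR_gt0//; lra.
pose K := 3 * b / (1 / 3) `^ b.
have K0 : 0 < K by rewrite !mulr_gt0// invr_gt0.
pose C1 := p * (3 / (p / 2) ^+ 2) + c / b * (2 * K ^+ 2).
pose C2 := 6 * (4 * b / (1 / 3) `^ b + 1).
have C10 : 0 <= C1.
  rewrite addr_ge0// ?mulr_ge0 ?invr_ge0 ?exprn_ge0//; lra.
have C20 : 0 <= C2 by rewrite mulr_ge0// addr_ge0// divr_ge0 ?mulr_ge0// ltW.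
(* The second bound keeps the relative increment of the power sum within 1/2, as [ln_pow_sum_lb]
   requires. *)
pose g1 := Num.min 1 (1 / 2 / K).
exists (C1 + C2), g1, (c / b * ln 3); split.
- exact: addr_ge0.
- by rewrite /g1 lt_min ge_min lexx andbT ltr01/= divr_gt0//; lra.
- move=> x sx; split; last by rewrite sumr_ge0// => *; rewrite sqr_ge0.
  rewrite -[leRHS]add0r; apply: lerD.
    rewrite mulr_ge0_le0 ?(ltW p0)//; apply: sumr_le0 => j _.
    by apply: ln_ext_le0; [lra|exact: simplex3_le1].
  rewrite ler_wpM2l ?divr_ge0 ?(ltW b0)//.
  by rewrite ler_ln ?posrE ?pow_sum_gt0 ?pow_sum_le3// ltW.
- move=> x g sx /andP[g0]; rewrite le_min => /andP[gle1 gK].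
  have hK : K * g <= 1 / 2 by rewrite mulrC -ler_pdivlMr.
  pose grad j := p / Num.max (x j) (p / 2) + c * x j `^ (b - 1) / pow_sum b x.
  have C2g : 0 <= C2 * g ^+ 2 by rewrite mulr_ge0// sqr_ge0.
  apply: le_trans (urn_mean_lb p0 pc0 pc1 b0 (grad := grad) (e := C1 * g ^+ 2) sx _).
    suff : \sum_j urn_drift p c b x j ^+ 2 <= \sum_j grad j * urn_drift p c b x j.
      by move=> h; have := ler_wpM2l g0 h; lra.
    (* The drift sums to 0, so 1 may be subtracted from every component of the gradient. *)
    rewrite -[leRHS]subr0 -[X in _ <= _ - X](sum_urn_drift pc1 b0 sx) -sumrB; apply: ler_sum => j _.
    have := urn_potential_grad j p0 c0 pc1 b1 sx; rewrite /grad; lra.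
  move=> i; have sy := simplex_step_simplex3 i sx (introT andP (conj g0 gle1)).
  set y := simplex_step x g i in sy *.
  have yx j : `|y j - x j| <= g by exact: simplex_step_dist.
  have yE j : y j - x j = g * ((j == i)%:R - x j) by rewrite /y /simplex_step; ring.
  have hS := ln_pow_sum_lb b1 sx sy yx hK.
  have e0 : 0 < p / 2 by lra.
  have hl : \sum_j ln_ext (p / 2) (x j) + \sum_j (y j - x j) / Num.max (x j) (p / 2)
      - 3 / (p / 2) ^+ 2 * g ^+ 2 <= \sum_j ln_ext (p / 2) (y j).
    have -> : 3 / (p / 2) ^+ 2 * g ^+ 2 = \sum_(j < 3) g ^+ 2 / (p / 2) ^+ 2.
      by rewrite sumr_const card_ord -mulr_natl; ring.
    rewrite -big_split/= -sumrB; apply: ler_sum => j _.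
    apply: le_trans (ln_ext_lb (x j) (y j) e0); rewrite lerB// ler_pM2r ?invr_gt0 ?exprn_gt0//.
    by rewrite -[leLHS]ger0_norm ?sqr_ge0// normrX lerXn2r ?nnegrE.
  rewrite -/K in hS.
  have := ler_wpM2l (ltW p0) hl.
  have cb0 : 0 <= c / b by rewrite divr_ge0// ltW.
  have := ler_wpM2l cb0 hS.
  rewrite /urn_potential.
  have -> : g * (\sum_j grad j * ((j == i)%:R - x j)) =
     p * (\sum_j (y j - x j) / Num.max (x j) (p / 2)) +
     c / b * (\sum_j b * x j `^ (b - 1) / pow_sum b x * (y j - x j)).
    rewrite !mulr_sumr -big_split/=; apply: eq_bigr => j _.
    rewrite yE /grad; have S0 := pow_sum_gt0 (ltW b0) sx.
    have m0 : 0 < Num.max (x j) (p / 2) by rewrite lt_max e0 orbT.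
    by field; rewrite !gt_eqF.
  rewrite /C1 exprMn; lra.
- move=> x i g sx /andP[g0 gle1].
  have sy := simplex_step_simplex3 i sx (introT andP (conj g0 gle1)).
  set y := simplex_step x g i in sy *.
  have yx j : `|y j - x j| <= g by exact: simplex_step_dist.
  rewrite -sumrB; apply: (@le_trans _ _ (3 * (2 * ((4 * b / (1 / 3) `^ b + 1) * g)))).
    apply: sum3_norm_le => j; apply: le_trans (sqr_lip _ _) _; try exact: urn_drift_norm.
    rewrite ler_wpM2l//.
    have -> : urn_drift p c b y j - urn_drift p c b x j =
      c * (share b y j - share b x j) - (y j - x j).
      by rewrite /urn_drift /urn_prob; ring.
    apply: le_trans (ler_normB _ _) _.
    rewrite (_ : (_ + 1) * g = 4 * b / (1 / 3) `^ b * g + g); last by ring.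
    apply: lerD; last exact: yx.
    rewrite normrM (ger0_norm c0).
    apply: le_trans (share_lip j b1 sx sy yx).
    by rewrite ler_piMl.
  have : 0 <= C1 * g by rewrite mulr_ge0.
  rewrite /C2; lra.
Qed.

End LyapunovPair.

(** * One-step means and stopped supermartingales *)

Section Filtration.
Context {T S : Type}.
Variable x : nat -> T -> S.

Lemma natural_filtration_pre n k (Y : set S) : (k <= n)%N ->
  natural_filtration x n (x k @^-1` Y).
Proof.
by move=> kn; apply: sub_sigma_algebra; exists k => //; exists Y.
Qed.

Lemma natural_filtrationI n (A B : set T) :
  natural_filtration x n A -> natural_filtration x n B ->
  natural_filtration x n (A `&` B).
Proof.
move=> hA hB; rewrite /natural_filtration.
have [h0 hC hU] := smallest_sigma_algebra setT
  [set x k @^-1` Y | k in [set k | (k <= n)%N] & Y in [set: set S]].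
rewrite -[A `&` B]setCK setCI -setTD -bigcup2E; apply: (hC); apply: hU => -[|[|k]] /=.
- by rewrite -setTD; exact: hC.
- by rewrite -setTD; exact: hC.
- exact: h0.
Qed.

Lemma natural_filtration_homo n m : (n <= m)%N ->
  natural_filtration x n `<=` natural_filtration x m.
Proof.
move=> nm; apply: sub_smallest2r; first exact: smallest_sigma_algebra.
by move=> _ [k /= kn [Y _ <-]]; exists k; [exact: leq_trans nm|exists Y].
Qed.

End Filtration.

Definition ball_count (s : 'cV[nat]_3) : nat := (\sum_i s i ord0)%N.

Definition add_ball (s : 'cV[nat]_3) (i : 'I_3) : 'cV[nat]_3 := s + delta_mx i ord0.

Lemma ball_count_add_ball s i : ball_count (add_ball s i) = (ball_count s).+1.
Proof.
rewrite /ball_count /add_ball; under eq_bigr do rewrite mxE.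
rewrite big_split/= -[in RHS]addn1; congr (_ + _)%N.
rewrite (bigD1 i)//= mxE !eqxx big1 ?addn0// => j /negPf ij.
by rewrite mxE ij.
Qed.

Lemma add_ball_inj s : injective (add_ball s).
Proof.
move=> i j /matrixP/(_ i ord0); rewrite !mxE !eqxx andbT.
by move/addnI; case: eqVneq.
Qed.

Section Markov.
Context {R : realType} {d : measure_display} {T : measurableType d}.
Variables (P : probability T R) (x : nat -> T -> 'cV[nat]_3).
Variables (pr : 'cV[nat]_3 -> 'I_3 -> R).
Hypothesis mx : forall n Y, measurable (x n @^-1` Y).
Hypothesis pr_cond : forall n i, is_cond_prob P (natural_filtration x n)
  [set w | x n.+1 w = add_ball (x n w) i] (fun w => pr (x n w) i).
Hypothesis pr_ge0 : forall s i, (0 < ball_count s)%N -> 0 <= pr s i.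
Hypothesis pr_sum1 : forall s, (0 < ball_count s)%N -> \sum_i pr s i = 1.

Lemma natural_filtration_measurable n A : natural_filtration x n A -> measurable A.
Proof.
apply: smallest_sub; first exact: sigma_algebra_measurable.
by move=> _ [k _ [Y _ <-]]; exact: mx.
Qed.

Lemma measurable_state (d' : measure_display) (U : measurableType d') D n
  (f : 'cV[nat]_3 -> U) : measurable_fun D (fun w => f (x n w)).
Proof.
apply: (@measurable_funTS _ _ _ _ D (f \o x n)).
by move=> _ Y _; rewrite setTI comp_preimage; exact: mx.
Qed.

Lemma measurable_EFin_state D n (f : 'cV[nat]_3 -> R) :
  measurable_fun D (fun w => (f (x n w))%:E).
Proof. by apply/measurable_EFinP; exact: (@measurable_state _ _ D n f). Qed.

Lemma measurable_EFin_indic (D A : set T) : measurable A ->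
  measurable_fun D (fun w => (\1_A w : R)%:E).
Proof. by move=> mA; apply/measurable_EFinP; exact: measurable_indic. Qed.

(** The event compares two random states; it splits over the countably many values of the first. *)
Lemma measurable_add_ball n i : measurable [set w | x n.+1 w = add_ball (x n w) i].
Proof.
have -> : [set w | x n.+1 w = add_ball (x n w) i] =
    \bigcup_k (if unpickle k is Some s then
      x n @^-1` [set s] `&` x n.+1 @^-1` [set add_ball s i] else set0).
  apply/seteqP; split=> w /=.
    by move=> h; exists (pickle (x n w)) => //=; rewrite pickleK.
  by move=> [k _]; case: unpickle => // s [/= ->].
apply: bigcupT_measurable => k; case: unpickle => [s|]; last exact: measurable0.
by apply: measurableI; exact: mx.
Qed.

Definition step_mean (f : 'cV[nat]_3 -> R) (s : 'cV[nat]_3) : R :=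
  \sum_i pr s i * f (add_ball s i).

Lemma cond_prob_state n i s B : natural_filtration x n B ->
  (forall w, B w -> x n w = s) ->
  P (B `&` [set w | x n.+1 w = add_ball (x n w) i]) = ((pr s i)%:E * P B)%E.
Proof.
move=> hB Bs; have [_ _ <-//] := pr_cond n i.
rewrite -integral_cst; last exact: natural_filtration_measurable hB.
by apply: eq_integral => w /[!inE] /Bs ->.
Qed.

(** The conditional probabilities of three disjoint events sum to 1, so the rest of [B] is null.
    That exactly one ball is added is thus derived, and holds almost surely. *)
Lemma step_null n s B : (0 < ball_count s)%N -> natural_filtration x n B ->
  (forall w, B w -> x n w = s) ->
  P (B `&` [set w | forall i, x n.+1 w <> add_ball (x n w) i]) = 0%E.
Proof.
move=> s0 hB Bs; have mB := natural_filtration_measurable hB.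
pose E i := [set w | x n.+1 w = add_ball (x n w) i].
pose N := [set w | forall i, x n.+1 w <> add_ball (x n w) i].
have mE i : measurable (E i) by exact: measurable_add_ball.
have mN : measurable N.
  have -> : N = \bigcap_i ~` E i.
    by apply/seteqP; split=> w /= h i; [move=> _; exact: h i|exact: (h i I)].
  by apply: fin_bigcap_measurable => // i _; exact: measurableC.
rewrite -/N setIC.
have : (\int[P]_(w in B) ((\1_N w)%:E + \sum_i (\1_(E i) w)%:E) = P B)%E.
  rewrite -[RHS]mul1e -integral_cst//; apply: eq_integral => w _ /=.
  have [Nw|] := pselect (N w).
    rewrite indicE mem_set// big1 ?adde0// => i _.
    by rewrite indicE memNset//; exact: Nw.
  move=> Nw; have [i wi] : exists i, E i w.
    by apply: contrapT => /forallNP h; apply: Nw.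
  rewrite indicE memNset// add0e (bigD1 i)//= indicE mem_set// big1 ?adde0//.
  move=> j /eqP ji; rewrite indicE memNset// => wj; apply: ji.
  by apply: (@add_ball_inj (x n w)); rewrite -wi -wj.
have hE i : P (E i `&` B) = ((pr s i)%:E * P B)%E by rewrite setIC; exact: cond_prob_state.
rewrite ge0_integralD//; last 3 first.
- exact: measurable_EFin_indic.
- by move=> w _; rewrite sume_ge0// => i _; rewrite lee_fin indicE.
- by apply: emeasurable_sum => i; exact: measurable_EFin_indic.
rewrite ge0_integral_sum//; last first.
  by move=> i; exact: measurable_EFin_indic.
rewrite integral_indic//.
have -> : (\sum_i \int[P]_(w in B) (\1_(E i) w)%:E = \sum_i (pr s i)%:E * P B)%E.
  by apply: eq_bigr => i _; rewrite integral_indic//; exact: hE.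
rewrite -ge0_sume_distrl; last by move=> i _; rewrite lee_fin pr_ge0.
rewrite sumEFin pr_sum1// mul1e.
have fB : P B \is a fin_num by exact: fin_num_measure.
have fN : P (N `&` B) \is a fin_num by apply: fin_num_measure; exact: measurableI.
move=> h; have {h} : (P (N `&` B) + P B = P B)%E := h.
move: fB fN; case: (P B) => // u _; case: (P (N `&` B)) => // v _ [] h.
by congr EFin; lra.
Qed.

Lemma markov_state n s B (f : 'cV[nat]_3 -> R) : (0 < ball_count s)%N ->
  (forall s, 0 <= f s) -> natural_filtration x n B ->
  (forall w, B w -> x n w = s) ->
  (\int[P]_(w in B) (f (x n.+1 w))%:E = (step_mean f s)%:E * P B)%E.
Proof.
move=> s0 f0 hB Bs; have mB := natural_filtration_measurable hB.
pose E i := [set w | x n.+1 w = add_ball (x n w) i].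
have mE i : measurable (E i) by exact: measurable_add_ball.
have hE i : P (E i `&` B) = ((pr s i)%:E * P B)%E by rewrite setIC; exact: cond_prob_state.
transitivity (\int[P]_(w in B) (\sum_i (f (add_ball s i))%:E * (\1_(E i) w : R)%:E))%E.
  apply: ae_eq_integral => //.
  - exact: measurable_EFin_state.
  - apply: emeasurable_sum => i; apply: emeasurable_funM; first exact: measurable_cst.
    exact: measurable_EFin_indic.
  exists (B `&` [set w | forall i, x n.+1 w <> add_ball (x n w) i]); split.
  + apply: measurableI => //.
    have -> : [set w | forall i, x n.+1 w <> add_ball (x n w) i] =
        \bigcap_i ~` E i.
      by apply/seteqP; split=> w /= h i; [move=> _; exact: h i|exact: (h i I)].
    by apply: fin_bigcap_measurable => // i _; exact: measurableC.
  + exact: step_null hB Bs.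
  + move=> w /= /not_implyP [Bw h]; split=> // i wi; apply: h.
    have xs := Bs w Bw.
    rewrite (bigD1 i)//= indicE mem_set//= mule1 big1 ?adde0 ?wi ?xs//.
    move=> j /eqP ji; rewrite indicE memNset ?mule0// => wj; apply: ji.
    by apply: (@add_ball_inj (x n w)); rewrite -wi -wj.
rewrite ge0_integral_sum//; first last.
- by move=> i w _; rewrite mule_ge0// lee_fin ?indicE.
- move=> i; apply: emeasurable_funM; first exact: measurable_cst.
  exact: measurable_EFin_indic.
transitivity (\sum_i ((pr s i * f (add_ball s i))%:E * P B))%E.
  apply: eq_bigr => i _; rewrite ge0_integralZl_EFin//; last exact: measurable_EFin_indic.
  rewrite integral_indic//; transitivity ((f (add_ball s i))%:E * ((pr s i)%:E * P B))%E.
    by congr (_ * _)%E; exact: hE.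
  by rewrite muleA -EFinM mulrC.
rewrite -ge0_sume_distrl ?sumEFin//.
by move=> i _; rewrite lee_fin mulr_ge0// pr_ge0.
Qed.

(** Both sides split along the countably many values of [x n], on each of which the transition
    probabilities are constant. This integrated Markov property replaces conditional
    expectations. *)
Lemma markov_step n B (f : 'cV[nat]_3 -> R) :
  (forall s, 0 <= f s) -> natural_filtration x n B ->
  (forall w, B w -> (0 < ball_count (x n w))%N) ->
  (\int[P]_(w in B) (f (x n.+1 w))%:E =
   \int[P]_(w in B) (step_mean f (x n w))%:E)%E.
Proof.
move=> f0 hB Bpos; have mB := natural_filtration_measurable hB.
pose F k := B `&` x n @^-1` [set s | pickle s = k].
have hF k : natural_filtration x n (F k).
  by apply: natural_filtrationI => //; exact: natural_filtration_pre.
have mF k : measurable (F k) by exact: natural_filtration_measurable (hF k).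
have BE : B = \bigcup_k F k.
  apply/seteqP; split=> w; last by move=> [k _] [].
  by move=> Bw; exists (pickle (x n w)).
have tF : trivIset setT F.
  by apply/trivIsetP => i j _ _ ij; apply/seteqP; split=> // w [[_ /= hi] [_ /= hj]]; move: ij; rewrite -hi -hj eqxx.
have sm0 w : B w -> 0 <= step_mean f (x n w).
  by move=> Bw; rewrite sumr_ge0// => i _; rewrite mulr_ge0// pr_ge0// Bpos.
rewrite BE ge0_integral_bigcup//; last 2 first.
- exact: measurable_EFin_state.
- by move=> w _; rewrite lee_fin.
rewrite ge0_integral_bigcup//; last 2 first.
- exact: measurable_EFin_state.
- by move=> w; rewrite -BE => Bw; rewrite lee_fin sm0.
apply: eq_eseriesr => k _.
have [F0|/set0P[w0 [Bw0 kw0]]] := eqVneq (F k) set0; first by rewrite F0 !integral_set0.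
have Fs w : F k w -> x n w = x n w0.
  by move=> [_ /= kw]; apply: (pcan_inj pickleK); rewrite kw -kw0.
rewrite (markov_state (Bpos _ Bw0) f0 (hF k) Fs) -integral_cst//.
by apply: eq_integral => w /[!inE] /Fs ->.
Qed.

End Markov.

Lemma setDDU_chain (T : Type) (A B C : set T) : C `<=` B -> B `<=` A ->
  A `\` C = (A `\` B) `|` (B `\` C).
Proof.
move=> CB BA; apply/seteqP; split=> w /=.
  by move=> [Aw nC]; have [Bw|nB] := pselect (B w); [right|left].
by move=> [[Aw nB]|[Bw nC]]; split=> //; [move=> /CB|exact: BA].
Qed.

(** * The supermartingale inequality up to the exit from a set of states *)

Section StoppedSupermartingale.
Context {R : realType} {d : measure_display} {T : measurableType d}.
Variables (P : probability T R) (x : nat -> T -> 'cV[nat]_3).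
Variables (pr : 'cV[nat]_3 -> 'I_3 -> R).
Hypothesis mx : forall n Y, measurable (x n @^-1` Y).
Hypothesis pr_cond : forall n i, is_cond_prob P (natural_filtration x n)
  [set w | x n.+1 w = add_ball (x n w) i] (fun w => pr (x n w) i).
Hypothesis pr_ge0 : forall s i, (0 < ball_count s)%N -> 0 <= pr s i.
Hypothesis pr_sum1 : forall s, (0 < ball_count s)%N -> \sum_i pr s i = 1.

(** Integrals over these decreasing events take the place of a stopped process. [U] depends on time
    because the number of balls does. *)
Definition stay (A : set T) (U : nat -> set 'cV[nat]_3) (N j : nat) : set T :=
  A `&` [set w | forall k, (k <= j)%N -> U (N + k)%N (x (N + k)%N w)].

Lemma stay0 A U N : stay A U N 0 = A `&` x N @^-1` U N.
Proof.
apply/seteqP; split=> w /= [Aw h]; split=> //=.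
  by have := h 0%N isT; rewrite addn0.
by case=> // _; rewrite addn0.
Qed.

Lemma stayS A U N j : stay A U N j.+1 = stay A U N j `&` x (N + j.+1)%N @^-1` U (N + j.+1)%N.
Proof.
apply/seteqP; split=> w /=.
  by move=> [Aw h]; split; [split=> // k kj; apply: h; exact: leqW|exact: h].
move=> [[Aw h] Uw]; split=> // k; rewrite leq_eqVlt => /predU1P[->//|].
by rewrite ltnS; exact: h.
Qed.

Lemma natural_filtration_stay A U N j : natural_filtration x N A ->
  natural_filtration x (N + j) (stay A U N j).
Proof.
move=> hA; elim: j => [|j IH].
  rewrite stay0 addn0; apply: natural_filtrationI => //.
  exact: natural_filtration_pre.
rewrite stayS; apply: natural_filtrationI; last exact: natural_filtration_pre.
by apply: natural_filtration_homo IH; rewrite leq_add2l.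
Qed.

Lemma measurable_stay A U N j : natural_filtration x N A -> measurable (stay A U N j).
Proof.
by move=> hA; apply: (natural_filtration_measurable mx (n := (N + j)%N)); exact: natural_filtration_stay.
Qed.

Lemma stay_decr A U N j k : (j <= k)%N -> stay A U N k `<=` stay A U N j.
Proof. by move=> jk w [Aw h]; split=> // l lj; apply: h; exact: leq_trans jk. Qed.

Variables (A : set T) (U : nat -> set 'cV[nat]_3) (N : nat).
Hypothesis hA : natural_filtration x N A.
Hypothesis U_pos : forall n s, U n s -> (0 < ball_count s)%N.
Variables (f h : nat -> 'cV[nat]_3 -> R) (r : nat -> R) (eps : R).
Hypothesis f_ge0 : forall k s, U (N + k)%N s -> 0 <= f k s.
Hypothesis h_ge0 : forall k s, U (N + k)%N s -> 0 <= h k s.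
Hypothesis r_ge0 : forall k, 0 <= r k.
Hypothesis eps_ge0 : 0 <= eps.
Hypothesis step_le : forall k s, U (N + k)%N s ->
  step_mean pr (fun s' => if s' \in U (N + k.+1)%N then f k.+1 s' else eps) s + h k s
    <= f k s + r k.

Let B := stay A U N.
Let I k := (\int[P]_(w in B k) (f k (x (N + k)%N w))%:E)%E.
Let H k := (\int[P]_(w in B k) (h k (x (N + k)%N w))%:E)%E.

(** On leaving [U] the function is replaced by the constant [eps], so the probability lost between
    two consecutive events is charged [eps]. *)
Lemma stopped_step k :
  (H k + I k.+1 + eps%:E * P (B k `\` B k.+1) <= I k + (r k)%:E * P (B k))%E.
Proof.
have mB j : measurable (B j) by exact: measurable_stay.
have hB : natural_filtration x (N + k) (B k) by exact: natural_filtration_stay.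
have BU w : B k w -> U (N + k)%N (x (N + k)%N w) by move=> [_ /(_ k (leqnn _))].
pose g s' := if s' \in U (N + k.+1)%N then f k.+1 s' else eps.
have g0 s' : 0 <= g s'.
  by rewrite /g; case: ifPn => // /set_mem; exact: f_ge0.
have BS : B k.+1 `<=` B k by exact: stay_decr.
have <- : (H k + \int[P]_(w in B k) (g (x (N + k.+1)%N w))%:E =
    H k + I k.+1 + eps%:E * P (B k `\` B k.+1))%E.
  rewrite -addeA; congr (_ + _)%E.
  have -> : (\int[P]_(w in B k) (g (x (N + k.+1)%N w))%:E =
    \int[P]_(w in B k.+1 `|` (B k `\` B k.+1)) (g (x (N + k.+1)%N w))%:E)%E.
    by rewrite setDUK.
  rewrite ge0_integral_setU//; last 4 first.
  - exact: measurableD.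
  - exact: (measurable_EFin_state mx).
  - by move=> w _; rewrite lee_fin.
  - by apply/disj_setPS => w [? []].
  congr (_ + _)%E.
    apply: eq_integral => w /[!inE] -[_ /(_ k.+1 (leqnn _)) Uw].
    by rewrite /g mem_set.
  rewrite -integral_cst; last exact: measurableD.
  apply: eq_integral => w /[!inE] -[Bw nB]; rewrite /g ifF//.
  by apply/negP => /set_mem Uw; apply: nB; rewrite /B stayS.
rewrite addnS (markov_step mx pr_cond)//; last by move=> w /BU; exact: U_pos.
rewrite -/g /H -ge0_integralD//; last 4 first.
- by move=> w /BU Uw; rewrite lee_fin h_ge0.
- exact: (measurable_EFin_state mx).
- move=> w /BU Uw; rewrite lee_fin sumr_ge0// => i _.
  by rewrite mulr_ge0// pr_ge0//; exact: U_pos Uw.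
- exact: (measurable_EFin_state mx).
rewrite -integral_cst// /I -ge0_integralD//; last 3 first.
- by move=> w /BU Uw; rewrite lee_fin f_ge0.
- exact: (measurable_EFin_state mx).
- by move=> w _; rewrite lee_fin.
apply: ge0_le_integral => //.
- move=> w /BU Uw; rewrite adde_ge0// lee_fin ?h_ge0// sumr_ge0// => i _.
  by rewrite mulr_ge0// pr_ge0//; exact: U_pos Uw.
- apply: emeasurable_funD; exact: (measurable_EFin_state mx).
- apply: emeasurable_funD; [exact: (measurable_EFin_state mx)|exact: measurable_cst].
- by move=> w /BU Uw; rewrite -!EFinD lee_fin addrC; exact: step_le.
Qed.

(** Telescopes [stopped_step]. A positive [h] bounds the time spent in [U], a positive [eps] the
    probability of leaving it; with both 0 it bounds a survival probability. *)
Lemma stopped_supermartingale j :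
  (\sum_(k < j) H k + I j + eps%:E * P (B 0 `\` B j)
     <= I 0 + (\sum_(k < j) r k)%:E * P (B 0))%E.
Proof.
have mB k : measurable (B k) by exact: measurable_stay.
elim: j => [|j IH].
  by rewrite !big_ord0 setDv measure0 mule0 mul0e adde0 add0e adde0.
rewrite !big_ord_recr/= (@setDDU_chain _ _ (B j)); last 2 first.
- exact: stay_decr.
- exact: stay_decr.
rewrite measureU; last 3 first.
- exact: measurableD.
- exact: measurableD.
- by apply/seteqP; split=> w // [[_ ?] []].
have P0 X : measurable X -> (0 <= P X)%E by move=> _; exact: measure_ge0.
rewrite ge0_muleDr ?measure_ge0//.
have -> : (\sum_(k < j) H k + H j + I j.+1 + (eps%:E * P (B 0 `\` B j) +
     eps%:E * P (B j `\` B j.+1)) =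
   (\sum_(k < j) H k + eps%:E * P (B 0 `\` B j)) +
   (H j + I j.+1 + eps%:E * P (B j `\` B j.+1)))%E.
  by rewrite addeACA -!addeA; congr (_ + _)%E; rewrite !addeA; congr (_ + _)%E; rewrite addeC !addeA.
apply: le_trans (leeD2l _ (stopped_step j)) _.
have -> : (\sum_(k < j) H k + eps%:E * P (B 0 `\` B j) + (I j + (r j)%:E * P (B j)) =
  (\sum_(k < j) H k + I j + eps%:E * P (B 0 `\` B j)) + (r j)%:E * P (B j))%E.
  by rewrite addeA; congr (_ + _)%E; rewrite addeAC.
rewrite EFinD ge0_muleDl ?lee_fin ?sumr_ge0// [leRHS]addeA; apply: leeD; first exact: IH.
apply: lee_wpmul2l; first by rewrite lee_fin.
by apply: le_measure; rewrite ?inE//; exact: stay_decr.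
Qed.

End StoppedSupermartingale.

(** * Harmonic sums and vanishing of a slowly varying sequence *)

Section RealSequences.
Context {R : realType}.

Lemma sum_inv_ge_ln (m j : nat) :
  ln (m + j).+1%:R - ln m.+1%:R <= \sum_(k < j) ((m + k).+1%:R : R)^-1.
Proof.
elim: j => [|j IH]; first by rewrite big_ord0 addn0 subrr.
rewrite big_ord_recr/= addnS.
have t0 : 0 < (m + j).+1%:R :> R by rewrite ltr0n.
have -> : (m + j).+2%:R = (m + j).+1%:R * (1 + ((m + j).+1%:R : R)^-1).
  by rewrite mulrDr mulr1 divff ?gt_eqF// natr1.
rewrite lnM ?posrE ?addr_gt0 ?invr_gt0//.
have := @le_ln1Dx R ((m + j).+1%:R^-1).
have -> : (-1 < ((m + j).+1%:R : R)^-1) by apply: lt_trans (_ : 0 < _); rewrite ?invr_gt0//; lra.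
by move=> /(_ isT) h; rewrite addrAC; exact: lerD.
Qed.

Lemma sum_inv_unbounded (m : nat) (K : R) :
  exists j, K <= \sum_(k < j) ((m + k).+1%:R : R)^-1.
Proof.
pose z : R := expR (K + ln m.+1%:R).
exists (Num.truncn z).+1; apply: le_trans (sum_inv_ge_ln _ _).
rewrite lerBrDr -ler_expR lnK ?posrE//.
apply: le_trans (ltW (truncnS_gt _)) _.
by rewrite ler_nat -addSn leq_addl.
Qed.

Lemma sum_inv_sqr_le (m j : nat) : (0 < m)%N ->
  \sum_(k < j) ((m + k).+1%:R : R)^-1 ^+ 2 <= m%:R^-1.
Proof.
move=> m0; suff : \sum_(k < j) ((m + k).+1%:R : R)^-1 ^+ 2 <= m%:R^-1 - (m + j)%:R^-1.
  by move/le_trans; apply; rewrite gerBl invr_ge0.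
elim: j => [|j IH]; first by rewrite big_ord0 addn0 subrr.
rewrite big_ord_recr/= addnS.
set t : R := (m + j)%:R in IH *.
have t0 : 0 < t by rewrite ltr0n addn_gt0 m0.
have -> : (m + j).+1%:R = t + 1 by rewrite -natr1.
have : (t + 1)^-1 ^+ 2 <= t^-1 - (t + 1)^-1.
  have -> : t^-1 - (t + 1)^-1 = t^-1 * (t + 1)^-1 by field; rewrite !gt_eqF//; lra.
  by rewrite expr2 ler_pM2r ?invr_gt0 ?lef_pV2 ?posrE//; lra.
lra.
Qed.

(** The increments of [psi] need not be summable, but those of [psi ^ 2] are: they are
    [O(g * psi + g ^ 2)], and both terms have bounded sums. So [psi ^ 2] converges, and a positive
    limit would contradict the divergence of the harmonic series. *)
Lemma step_sum_cvg0 (psi : nat -> R) (m : nat) (C K : R) : 0 <= C ->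
  (forall k, 0 <= psi k) ->
  (forall k, `|psi k.+1 - psi k| <= C * (m + k).+1%:R^-1) ->
  (forall j, \sum_(k < j) (m + k).+1%:R^-1 * psi k <= K) ->
  psi k @[k --> \oo] --> 0.
Proof.
move=> C0 psi0 dpsi hK.
pose g k : R := (m + k).+1%:R^-1.
have g0 k : 0 < g k by rewrite invr_gt0 ltr0n.
pose v k := psi k ^+ 2.
pose dv k := v k.+1 - v k.
have dvb k : `|dv k| <= 2 * C * (g k * psi k) + C ^+ 2 * g k ^+ 2.
  have -> : dv k = (psi k.+1 - psi k) * (psi k.+1 - psi k + 2 * psi k).
    by rewrite /dv /v; ring.
  rewrite normrM.
  have h1 := dpsi k; have h2 : `|psi k.+1 - psi k + 2 * psi k| <= C * g k + 2 * psi k.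
    apply: le_trans (ler_normD _ _) _; rewrite lerD// ger0_norm// mulr_ge0//.
  have -> : 2 * C * (g k * psi k) + C ^+ 2 * g k ^+ 2 = (C * g k) * (C * g k + 2 * psi k) by ring.
  by rewrite ler_pM.
have bnd j : \sum_(0 <= k < j) `|dv k| <= 2 * C * K + C ^+ 2 * 2.
  rewrite big_mkord.
  apply: (@le_trans _ _ (\sum_(k < j) (2 * C * (g k * psi k) + C ^+ 2 * g k ^+ 2))).
    by apply: ler_sum => k _; exact: dvb.
  rewrite big_split/= -!mulr_sumr lerD// ler_wpM2l ?sqr_ge0 ?mulr_ge0//.
    exact: hK.
  case: j => [|j]; first by rewrite big_ord0.
  rewrite big_ord_recl/= /g addn0.
  have h1 : \sum_(i < j) ((m + bump 0 i).+1%:R : R)^-1 ^+ 2 <= m.+1%:R^-1.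
    apply: le_trans (sum_inv_sqr_le j (ltn0Sn m)).
    by apply: ler_sum => i _; rewrite /bump/= add1n addnS addSn.
  have h2 : (m.+1%:R : R)^-1 <= 1 by rewrite invf_le1 ?ler1n.
  have h3 : ((m.+1%:R : R)^-1) ^+ 2 <= 1 by rewrite exprn_ile1 ?invr_ge0.
  by rewrite -[2]/(1 + 1); apply: lerD => //; exact: le_trans h2.
have cv : cvgn v.
  have cs : cvgn (series dv).
    apply: normed_cvg.
    suff : cvgn (fun n => \sum_(0 <= k < n) `|dv k|) by [].
    apply: nondecreasing_is_cvgn.
      by apply/nondecreasing_seqP => n; rewrite big_nat_recr//= lerDl.
    by exists (2 * C * K + C ^+ 2 * 2) => _ [j _ <-]; exact: bnd.
  have -> : v = (fun k => v 0%N + series dv k).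
    apply/funext => k; rewrite /series/= telescope_sumr// addrC subrK//.
  by apply: is_cvgD => //; exact: is_cvg_cst.
have v0 k : 0 <= v k by rewrite sqr_ge0.
have l0 : 0 <= limn v by apply: limr_ge => //; near=> k.
have vl : v k @[k --> \oo] --> 0.
  suff -> : 0 = limn v by [].
  apply/eqP; rewrite eq_le l0/= leNgt; apply/negP => lp.
  have [n0 _ hn0] : \forall k \near \oo, limn v / 2 < v k.
    by apply: (cvgr_gt (limn v)) => //; lra.
  pose dl := Num.sqrt (limn v / 2).
  have dl0 : 0 < dl by rewrite sqrtr_gt0; lra.
  have hdl k : (n0 <= k)%N -> dl <= psi k.
    move=> nk; have h := hn0 k nk.
    by rewrite -[psi k]ger0_norm// -sqrtr_sqr ler_wsqrtr// ltW.
  have [j hj] := sum_inv_unbounded (m + n0) ((K + 1) / dl).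
  have := hK (n0 + j)%N; rewrite big_split_ord/=.
  have h1 : 0 <= \sum_(i < n0) (m + i).+1%:R^-1 * psi i.
    by rewrite sumr_ge0// => i _; rewrite mulr_ge0// invr_ge0.
  have h2 : dl * \sum_(k < j) ((m + n0 + k).+1%:R : R)^-1 <=
     \sum_(i < j) (m + (n0 + i)).+1%:R^-1 * psi (n0 + i)%N.
    rewrite mulr_sumr; apply: ler_sum => i _; rewrite mulrC addnA ler_wpM2l ?invr_ge0//.
    by apply: hdl; rewrite leq_addr.
  move: hj; rewrite ler_pdivrMr// mulrC => hj; lra.
apply/cvgrPdist_lt => e e0.
have e2 : 0 < e ^+ 2 by rewrite exprn_gt0.
move/cvgrPdist_lt : vl => /(_ _ e2); apply: filterS => k.
rewrite !sub0r !normrN !ger0_norm// => h.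
by rewrite ltNge; apply/negP => ek; move: h; rewrite ltNge lerXn2r ?nnegrE ?(ltW e0).
Unshelve. all: by end_near. Qed.

End RealSequences.

(** * The urn as a Markov chain on states *)

(* For the matrix [sym_mx a] the probability of drawing colour [i] is
   [urn_share a + urn_gain a * x_i ^ b / \sum_j x_j ^ b]. *)
Definition urn_share (R : realType) (a : R) : R := a / (1 + 2 * a).
Definition urn_gain (R : realType) (a : R) : R := (1 - a) / (1 + 2 * a).

Section UrnParams.
Context {R : realType}.
Variable a : R.
Hypothesis a0 : 0 < a.

Lemma urn_share_gt0 : 0 < urn_share a.
Proof. by rewrite divr_gt0//; move: a0; lra. Qed.

Lemma urn_share_gain_gt0 : 0 < urn_share a + urn_gain a.
Proof. by rewrite -mulrDl divr_gt0//; move: a0; lra. Qed.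

Lemma urn_share_gain : 3 * urn_share a + urn_gain a = 1.
Proof. by rewrite /urn_share /urn_gain; field; rewrite gt_eqF//; move: a0; lra. Qed.

End UrnParams.

Section States.
Context {R : realType}.

Definition state_prop (s : 'cV[nat]_3) : 'I_3 -> R :=
  fun i => (s i ord0)%:R / (ball_count s)%:R.

Lemma simplex3_state_prop s : (0 < ball_count s)%N -> simplex3 (state_prop s).
Proof.
move=> s0; split=> [i|]; first by rewrite divr_ge0.
by rewrite -mulr_suml -natr_sum divff// pnatr_eq0 -lt0n.
Qed.

Lemma state_prop_add_ball s i : (0 < ball_count s)%N ->
  state_prop (add_ball s i) = simplex_step (state_prop s) (ball_count s).+1%:R^-1 i.
Proof.
move=> s0; apply/funext => j; rewrite /state_prop /simplex_step ball_count_add_ball.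
rewrite !mxE eqxx andbT natrD -natr1.
have t0 : 0 < (ball_count s)%:R :> R by rewrite ltr0n.
by field; rewrite !gt_eqF//; lra.
Qed.

(** There are finitely many states with [m] balls; this bounds the initial expectation of a test
    function. *)
Lemma state_bounded (F : 'cV[nat]_3 -> R) (m : nat) :
  exists K, forall s, ball_count s = m -> F s <= K.
Proof.
exists (\sum_(t : 'cV['I_m.+1]_3) `|F (map_mx (@nat_of_ord m.+1) t)|) => s sm.
pose t : 'cV['I_m.+1]_3 := map_mx (@inord m) s.
have st : s = map_mx (@nat_of_ord m.+1) t.
  apply/matrixP => i j; rewrite !mxE inordK// ltnS -sm /ball_count.
  by rewrite (ord1 j) (bigD1 i)//= leq_addr.
rewrite {1}st (bigD1 t)//=; apply: le_trans (ler_norm _) _.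
by rewrite lerDl sumr_ge0.
Qed.

End States.

Section Urn.
Context {R : realType} {d : measure_display} {T : measurableType d}.
Variables (a b : R) (P : probability T R) (x0 : 'cV[nat]_3).
Variable x : nat -> T -> 'cV[nat]_3.
Hypothesis a0 : 0 < a.
Hypothesis b0 : 0 < b.
Hypothesis hx : urn_process (sym_mx a) b x0 P x.

Let p := urn_share a.
Let c := urn_gain a.
Let p0 : 0 < p := urn_share_gt0 a0.
Let pc0 : 0 < p + c := urn_share_gain_gt0 a0.
Let pc1 : 3 * p + c = 1 := urn_share_gain a0.
Let n0 := ball_count x0.

Let n0_gt0 : (0 < n0)%N.
Proof. by case: hx. Qed.

Let mx : forall n Y, measurable (x n @^-1` Y).
Proof. by case: hx. Qed.

Definition urn_pr (s : 'cV[nat]_3) (i : 'I_3) : R :=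
  urn_weight (sym_mx a) b s i ord0 / \sum_j urn_weight (sym_mx a) b s j ord0.

(** The common factor [(ball_count s) ^ b] cancels, so the transition probabilities depend on the
    proportions alone. *)
Lemma urn_prE s i : (0 < ball_count s)%N ->
  urn_pr s i = urn_prob p c b (state_prop s) i.
Proof.
move=> s0; pose S := \sum_k (s k ord0)%:R `^ b : R.
have tb0 : 0 < (ball_count s)%:R `^ b :> R by rewrite powR_gt0// ltr0n.
have propE k : state_prop s k `^ b = (s k ord0)%:R `^ b / (ball_count s)%:R `^ b.
  by rewrite /state_prop powRM ?invr_ge0// -powR_inv1// powRAC powR_inv1// powR_ge0.
have SE : pow_sum b (state_prop s) = S / (ball_count s)%:R `^ b.
  by rewrite /S mulr_suml; apply: eq_bigr => k _; rewrite propE.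
have S0 : 0 < S.
  have := pow_sum_gt0 (ltW b0) (simplex3_state_prop s0).
  by rewrite SE pmulr_lgt0// invr_gt0.
have wE k : urn_weight (sym_mx a) b s k ord0 = (1 - a) * (s k ord0)%:R `^ b + a * S.
  rewrite /urn_weight mxE /S mulr_sumr (bigD1 k)//= [in RHS](bigD1 k)//= !mxE eqxx mul1r.
  rewrite addrA mulrBl mul1r subrK; congr (_ + _); apply: eq_bigr => j jk.
  by rewrite !mxE eq_sym (negPf jk).
have -> : urn_pr s i = ((1 - a) * (s i ord0)%:R `^ b + a * S) / ((1 + 2 * a) * S).
  rewrite /urn_pr wE; congr (_ / _).
  under eq_bigr do rewrite wE.
  by rewrite big_split/= -mulr_sumr sumr_const card_ord -/S -mulr_natl; ring.
rewrite /urn_prob /share propE SE /p /c /urn_share /urn_gain.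
have a12 : 0 < 1 + 2 * a by move: a0; lra.
by field; rewrite !gt_eqF.
Qed.

Lemma urn_pr_cond n i : is_cond_prob P (natural_filtration x n)
  [set w | x n.+1 w = add_ball (x n w) i] (fun w => urn_pr (x n w) i).
Proof. by case: hx => _ _ _; apply. Qed.

Lemma urn_pr_gt0 s i : (0 < ball_count s)%N -> 0 < urn_pr s i.
Proof. by move=> s0; rewrite urn_prE// urn_prob_gt0//; exact: simplex3_state_prop. Qed.

Lemma urn_pr_ge0 s i : (0 < ball_count s)%N -> 0 <= urn_pr s i.
Proof. by move=> s0; exact/ltW/urn_pr_gt0. Qed.

Lemma urn_pr_sum1 s : (0 < ball_count s)%N -> \sum_i urn_pr s i = 1.
Proof.
move=> s0; under eq_bigr do rewrite urn_prE//.
by apply: sum_urn_prob => //; exact: simplex3_state_prop.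
Qed.

Lemma step_mean_urn (L : ('I_3 -> R) -> R) s : (0 < ball_count s)%N ->
  step_mean urn_pr (fun s' => L (state_prop s')) s =
  urn_mean p c b L (state_prop s) (ball_count s).+1%:R^-1.
Proof.
by move=> s0; apply: eq_bigr => i _; rewrite urn_prE// state_prop_add_ball.
Qed.

Definition level n : set 'cV[nat]_3 := [set s | ball_count s = (n + n0)%N].

Lemma level_pos n s : level n s -> (0 < ball_count s)%N.
Proof. by move=> ->; rewrite addn_gt0 n0_gt0 orbT. Qed.

Lemma level_add_ball n s i : level n s -> level n.+1 (add_ball s i).
Proof. by rewrite /level/= ball_count_add_ball addSn => ->. Qed.

Lemma step_ae n : P.-negligible
  [set w | (0 < ball_count (x n w))%N /\ forall i, x n.+1 w <> add_ball (x n w) i].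
Proof.
pose F k : set T := if unpickle k is Some s then
  if (0 < ball_count s)%N then x n @^-1` [set s] `&`
    [set w | forall i, x n.+1 w <> add_ball (x n w) i] else set0 else set0.
apply: (@negligibleS _ _ _ _ (\bigcup_k F k)).
  move=> w /= [s0 h]; exists (pickle (x n w)) => //.
  by rewrite /F pickleK s0.
apply: negligible_bigcup => k; rewrite /F; case: unpickle => [s|]; last exact: negligible_set0.
case: ifPn => [s0|_]; last exact: negligible_set0.
apply/negligibleP; last first.
  by apply: (step_null mx urn_pr_cond urn_pr_ge0 urn_pr_sum1 s0) => //;
    exact: natural_filtration_pre.
apply: measurableI; first exact: mx.
have -> : [set w | forall i, x n.+1 w <> add_ball (x n w) i] =
  \bigcap_i ~` [set w | x n.+1 w = add_ball (x n w) i].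
  by apply/seteqP; split=> w /= h i; [move=> _; exact: h i|exact: (h i I)].
by apply: fin_bigcap_measurable => // i _; apply: measurableC; exact: measurable_add_ball.
Qed.

(** Countably many null events are discarded at once; the number of balls then follows by induction
    from the fixed start. Pathwise arguments rest on this. *)
Lemma urn_path_ae : {ae P, forall w, forall n, level n (x n w) /\
  exists i, x n.+1 w = add_ball (x n w) i}.
Proof.
have : {ae P, forall w, forall n, ~ ((0 < ball_count (x n w))%N /\
    forall i, x n.+1 w <> add_ball (x n w) i)}.
  apply: ae_foralln => n; have := step_ae n.
  by apply: negligibleS => w /= /contrapT.
apply: filterS => w h.
have st n : level n (x n w) -> exists i, x n.+1 w = add_ball (x n w) i.
  by move=> /level_pos s0; apply: contrapT => /forallNP nx; exact: (h n).
have lv n : level n (x n w).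
  elim: n => [|n IH]; first by case: hx => _ _ h0 _; rewrite /level/= h0 add0n.
  by have [i ->] := st n IH; exact: level_add_ball.
by move=> n; split=> //; exact: st.
Qed.

End Urn.

Lemma integral_le_cst (R : realType) (d : measure_display) (T : measurableType d)
  (P : probability T R) (D : set T) (F : T -> R) (K : R) :
  measurable D -> measurable_fun D (fun w => (F w)%:E) ->
  (forall w, D w -> 0 <= F w <= K) -> 0 <= K ->
  (\int[P]_(w in D) (F w)%:E <= K%:E)%E.
Proof.
move=> mD mF hF K0; apply: (@le_trans _ _ (\int[P]_(w in D) (cst K%:E w))%E).
  apply: ge0_le_integral => //.
  - by move=> w /hF /andP[]; rewrite lee_fin.
  - by move=> w /hF /andP[]; rewrite /= lee_fin.
rewrite integral_cst// -[leRHS]mule1; apply: lee_wpmul2l; first by rewrite lee_fin.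
exact: probability_le1.
Qed.

(** * Lyapunov functions along almost every path *)

Section UrnLimits.
Context {R : realType} {d : measure_display} {T : measurableType d}.
Variables (a b : R) (P : probability T R) (x0 : 'cV[nat]_3).
Variable x : nat -> T -> 'cV[nat]_3.
Hypothesis a0 : 0 < a.
Hypothesis b0 : 0 < b.
Hypothesis hx : urn_process (sym_mx a) b x0 P x.

Let p := urn_share a.
Let c := urn_gain a.
Let n0 := ball_count x0.
Let pr := urn_pr a b.

Let n0_gt0 : (0 < n0)%N.
Proof. by case: hx. Qed.

Let mx : forall n Y, measurable (x n @^-1` Y).
Proof. by case: hx. Qed.

Let supermartingale A U N hA U_pos f h r eps f0 h0 r0 e0 st j :=
  @stopped_supermartingale R d T P x pr mx (urn_pr_cond hx)
    (urn_pr_ge0 a0 b0) (urn_pr_sum1 a0 b0) A U N hA U_pos f h r eps f0 h0 r0 e0 st j.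

Lemma natural_filtration_start n : natural_filtration x n setT.
Proof. by rewrite -(preimage_setT (x 0%N)); exact: natural_filtration_pre. Qed.

(** [M - L] is nonnegative and loses [g * psi] on average up to [C g ^ 2]. So the sum of [g * psi]
    has finite expectation, is finite almost surely, and [step_sum_cvg0] applies. *)
Lemma lyapunov_cvg0 (L psi : ('I_3 -> R) -> R) : lyapunov_pair p c b L psi ->
  {ae P, forall w, psi (state_prop (x n w)) @[n --> \oo] --> 0}.
Proof.
move=> [C [g0 [M [C0 /andP[g00 g01] hLM hdrift hlip]]]].
(* From time [N] on every step size is at most [g0]. *)
pose N := Num.truncn g0^-1.
pose g k : R := (N + n0 + k).+1%:R^-1.
have gpos k : 0 < g k by rewrite invr_gt0 ltr0n.
have gle k : g k <= g0.
  rewrite -[leRHS]invrK lef_pV2 ?posrE ?invr_gt0 ?ltr0n//.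
  apply: le_trans (ltW (truncnS_gt _)) _.
  by rewrite ler_nat ltnS -addnA leq_addr.
pose U := level x0.
have Upos n s : U n s -> (0 < ball_count s)%N by exact: (level_pos hx).
have Ug k s : U (N + k)%N s -> (ball_count s).+1%:R^-1 = g k.
  by rewrite /U /level/= => ->; rewrite addnAC.
pose f (k : nat) s := M - L (state_prop s).
pose h k s := g k * psi (state_prop s).
pose r k := C * g k ^+ 2.
have f_ge0 k s : U (N + k)%N s -> 0 <= f k s.
  by move=> /Upos s0; rewrite subr_ge0; case: (hLM _ (simplex3_state_prop s0)).
have h_ge0 k s : U (N + k)%N s -> 0 <= h k s.
  move=> /Upos s0; rewrite mulr_ge0 ?(ltW (gpos k))//.
  by case: (hLM _ (simplex3_state_prop s0)).
have r_ge0 k : 0 <= r k by rewrite mulr_ge0// sqr_ge0.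
have st k s : U (N + k)%N s ->
  step_mean pr (fun s' => if s' \in U (N + k.+1)%N then f k.+1 s' else 0) s + h k s
    <= f k s + r k.
  move=> Us; have s0 := Upos _ _ Us.
  have -> : step_mean pr (fun s' => if s' \in U (N + k.+1)%N then f k.+1 s' else 0) s =
      M - step_mean pr (fun s' => L (state_prop s')) s.
    rewrite -[X in X - _]mulr1 -(urn_pr_sum1 a0 b0 s0) mulr_sumr -sumrB.
    apply: eq_bigr => i _; rewrite mem_set; last by rewrite addnS; exact: level_add_ball.
    by rewrite /f mulrBr [M * _]mulrC.
  rewrite (step_mean_urn a0 b0)// (Ug _ _ Us).
  have := hdrift _ (g k) (simplex3_state_prop s0).
  rewrite (ltW (gpos k)) gle => /(_ isT); rewrite /f /h /r -/p -/c; lra.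
have hA : natural_filtration x N setT by exact: natural_filtration_start.
have sm := supermartingale hA Upos f_ge0 h_ge0 r_ge0 (lexx 0) st.
pose B := stay x setT U N.
have mB k : measurable (B k) by exact: measurable_stay.
pose H k := (\int[P]_(w in B k) (h k (x (N + k)%N w))%:E)%E.
have BU k w : B k w -> U (N + k)%N (x (N + k)%N w) by move=> [_ /(_ k (leqnn _))].
have [K0 hK0] := state_bounded (f 0%N) (N + n0).
have Hb j : (\sum_(k < j) H k <= (`|K0| + C)%:E)%E.
  have := sm j; rewrite mul0e adde0 => smj; apply: (le_trans _ (le_trans smj _)).
  - rewrite leeDl// integral_ge0// => w /BU Uw.
    by rewrite lee_fin f_ge0.
  - rewrite EFinD; apply: leeD.
      apply: integral_le_cst => //; first exact: (measurable_EFin_state mx).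
      move=> w /BU Uw; rewrite f_ge0//=; apply: le_trans (ler_norm _).
      by apply: hK0; have := Uw; rewrite addn0.
    rewrite -[leRHS]mule1; apply: lee_pmul; rewrite ?measure_ge0 ?lee_fin ?sumr_ge0//.
      rewrite -mulr_sumr ler_piMr//.
      apply: le_trans (sum_inv_sqr_le _ _) _; first by rewrite addn_gt0 n0_gt0 orbT.
      by rewrite invf_le1 ?ler1n ?ltr0n addn_gt0 n0_gt0 orbT.
    exact: probability_le1.
(* The paths that have the right number of balls at all times from [N] on; almost every path is
   one. *)
pose D := \bigcap_k B k.
have mD : measurable D by exact: bigcapT_measurable.
pose hs w := (\sum_(0 <= k <oo) (h k (x (N + k)%N w))%:E)%E.
have hD k w : D w -> 0 <= h k (x (N + k)%N w) by move=> /(_ k I)/BU; exact: h_ge0.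
have ihs : P.-integrable D hs.
  apply/integrableP; split.
    apply: ge0_emeasurable_sum => // k; first by move=> w Dw _; rewrite lee_fin hD.
    by move=> _; exact: (measurable_EFin_state mx).
  apply: (@le_lt_trans _ _ (`|K0| + C)%:E); last exact: ltry.
  under eq_integral.
    move=> w /[!inE] Dw; rewrite gee0_abs; last first.
      by apply: nneseries_ge0 => k _ _; rewrite lee_fin hD.
    over.
  have mh k : measurable_fun D (fun w => (h k (x (N + k)%N w))%:E).
    exact: (measurable_EFin_state mx).
  rewrite (integral_nneseries P mD mh); last by move=> k w Dw; rewrite lee_fin hD.
  apply: lime_le.
    by apply: is_cvg_nneseries => k _ _; apply: integral_ge0 => w Dw; rewrite lee_fin hD.
  near=> j; rewrite big_mkord; apply: le_trans (Hb j).
  apply: lee_sum => k _; apply: ge0_subset_integral => //.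
  - exact: (measurable_EFin_state mx).
  - by move=> w /BU; rewrite lee_fin; exact: h_ge0.
  - by move=> w; exact.
have := integrable_ae mD ihs; apply: filterS2 (urn_path_ae a0 b0 hx) => w path fin.
have Dw : D w.
  by move=> k _; split=> // l _; case: (path (N + l)%N).
have {}fin := fin Dw.
suff : (fun k => psi (state_prop (x (N + k)%N w))) @ \oo --> 0.
  move=> cv; rewrite -(cvg_shiftn N); apply: cvg_trans cv.
  by apply: near_eq_cvg; near=> k => /=; rewrite addnC.
apply: (@step_sum_cvg0 _ _ (N + n0) C (fine (hs w))) => //.
- move=> k; have s0 := Upos _ _ (path (N + k)%N).1.
  by case: (hLM _ (simplex3_state_prop s0)).
- move=> k; have [Us [i si]] := path (N + k)%N; have s0 := Upos _ _ Us.
  rewrite addnS si state_prop_add_ball// (Ug _ _ Us).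
  by apply: hlip; [exact: simplex3_state_prop|rewrite (ltW (gpos k)) (le_trans (gle k))].
- move=> j; rewrite -lee_fin fineK// -sumEFin.
  have := @nneseries_lim_ge R (fun k => (h k (x (N + k)%N w))%:E) xpredT 0%N j.
  rewrite big_mkord; apply=> k _ _; rewrite lee_fin; exact: hD.
Unshelve. all: by end_near. Qed.

End UrnLimits.

(** * Escape from a set of states and survival in it *)

Section UrnStay.
Context {R : realType} {d : measure_display} {T : measurableType d}.
Variables (a b : R) (P : probability T R) (x0 : 'cV[nat]_3).
Variable x : nat -> T -> 'cV[nat]_3.
Hypothesis a0 : 0 < a.
Hypothesis b0 : 0 < b.
Hypothesis hx : urn_process (sym_mx a) b x0 P x.

Let p := urn_share a.
Let c := urn_gain a.
Let n0 := ball_count x0.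
Let pr := urn_pr a b.

Let n0_gt0 : (0 < n0)%N.
Proof. by case: hx. Qed.

Let mx : forall n Y, measurable (x n @^-1` Y).
Proof. by case: hx. Qed.

Let supermartingale A U N hA U_pos f h r eps f0 h0 r0 e0 st j :=
  @stopped_supermartingale R d T P x pr mx (urn_pr_cond hx)
    (urn_pr_ge0 a0 b0) (urn_pr_sum1 a0 b0) A U N hA U_pos f h r eps f0 h0 r0 e0 st j.

Let pr_ge0 s i : (0 < ball_count s)%N -> 0 <= pr s i.
Proof. exact: urn_pr_ge0. Qed.

Let pr_sum1 s : (0 < ball_count s)%N -> \sum_i pr s i = 1.
Proof. exact: urn_pr_sum1. Qed.

Let inv_level (N k : nat) : R := (N + n0 + k).+1%:R^-1.

Let inv_level_gt0 N k : 0 < inv_level N k.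
Proof. by rewrite invr_gt0 ltr0n. Qed.

Lemma measurable_stay_forever U N :
  measurable [set w | forall k, U (N + k)%N (x (N + k)%N w)].
Proof.
have -> : [set w | forall k, U (N + k)%N (x (N + k)%N w)] =
    \bigcap_k x (N + k)%N @^-1` U (N + k)%N.
  by apply/seteqP; split=> w h k; [move=> _; exact: h|exact: h].
by apply: bigcapT_measurable => k; exact: mx.
Qed.

Section Stay.
Variable U : nat -> set 'cV[nat]_3.
Hypothesis U_level : forall n s, U n s -> level x0 n s.

Let U_pos n s : U n s -> (0 < ball_count s)%N.
Proof. by move=> /U_level; exact: (level_pos hx). Qed.

Let measurable_stay_start A N j : natural_filtration x N A -> measurable (stay x A U N j).
Proof. exact: measurable_stay. Qed.

(** On paths that never leave, [W] would lose on average [kappa] times a divergent harmonic sum,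
    although it is bounded below. *)
Lemma stay_null (N : nat) (W : nat -> 'cV[nat]_3 -> R) (M kappa : R) :
  0 < kappa ->
  (forall k s, level x0 (N + k) s -> - M <= W k s) ->
  (forall k s, U (N + k)%N s ->
    step_mean pr (W k.+1) s <= W k s - kappa / (N + n0 + k).+1%:R) ->
  P [set w | forall k, U (N + k)%N (x (N + k)%N w)] = 0%E.
Proof.
move=> k0 WM Wstep.
pose f k s := W k s + M.
pose h k (s : 'cV[nat]_3) := kappa * inv_level N k.
have f_ge0 k s : U (N + k)%N s -> 0 <= f k s.
  by move=> /U_level /WM; rewrite /f; lra.
have h_ge0 k s : U (N + k)%N s -> 0 <= h k s.
  by move=> _; rewrite mulr_ge0 ?ltW.
have st k s : U (N + k)%N s ->
  step_mean pr (fun s' => if s' \in U (N + k.+1)%N then f k.+1 s' else 0) s + h k s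
    <= f k s + 0.
  move=> Us; have s0 := U_pos Us.
  suff : step_mean pr (fun s' => if s' \in U (N + k.+1)%N then f k.+1 s' else 0) s <=
      step_mean pr (W k.+1) s + M.
    move: (Wstep _ _ Us); rewrite /f /h -/(inv_level N k).
    by move: (inv_level N k) => z; lra.
  rewrite -[M]mul1r -(pr_sum1 s0) mulr_suml -big_split/=; apply: ler_sum => i _.
  rewrite -mulrDr ler_wpM2l ?pr_ge0//; case: ifP => // _.
  have : level x0 (N + k.+1) (add_ball s i).
    by rewrite addnS; apply: level_add_ball; exact: U_level.
  by move=> /WM; lra.
have hA : natural_filtration x N setT by exact: natural_filtration_start.
have sm := supermartingale hA U_pos f_ge0 h_ge0 (fun=> lexx 0) (lexx 0) st.
pose B := stay x setT U N.
have mB k : measurable (B k) by exact: measurable_stay_start.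
have BU k w : B k w -> U (N + k)%N (x (N + k)%N w) by move=> [_ /(_ k (leqnn _))].
have [K0 hK0] := state_bounded (f 0%N) (N + n0).
set D := [set w | _].
have mD : measurable D by exact: measurable_stay_forever.
have DB k : D `<=` B k by move=> w Dw; split=> // l _; exact: Dw.
have Hb j : (\sum_(k < j) (kappa * inv_level N k)%:E * P D <= `|K0|%:E)%E.
  have := sm j; rewrite mul0e adde0 [X in (_ <= _ + X%:E * _)%E -> _]big1// mul0e adde0 => smj.
  apply: (le_trans _ (le_trans smj _)).
    apply: (@le_trans _ _ (\sum_(k < j) \int[P]_(w in B k) (h k (x (N + k)%N w))%:E)%E).
      apply: lee_sum => k _.
      rewrite -[leRHS]/(\int[P]_(w in B k) cst (kappa * inv_level N k)%:E w)%E.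
      rewrite integral_cst//; apply: lee_wpmul2l.
        by rewrite lee_fin mulr_ge0 ?ltW.
      by apply: le_measure; rewrite ?inE.
    rewrite leeDl// integral_ge0// => w /BU Uw.
    by rewrite lee_fin f_ge0.
  apply: integral_le_cst => //; first exact: (measurable_EFin_state mx).
  move=> w /BU Uw; rewrite f_ge0//=; apply: le_trans (ler_norm _).
  by apply: hK0; have := U_level Uw; rewrite addn0.
have : P D \is a fin_num by exact: fin_num_measure.
have PD0 : (0 <= P D)%E by exact: measure_ge0.
move: Hb PD0; case: (P D) => // q Hb; rewrite lee_fin le_eqVlt => /predU1P[<-//|q0 _].
have kq : 0 < kappa * q by rewrite mulr_gt0.
have [j hj] := sum_inv_unbounded (N + n0) ((`|K0| + 1) / (kappa * q)).
have := Hb j; under eq_bigr do rewrite -EFinM.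
rewrite sumEFin lee_fin.
have -> : \sum_(i < j) kappa * inv_level N i * q = kappa * q * \sum_(i < j) (N + n0 + i).+1%:R^-1.
  by rewrite mulr_sumr; apply: eq_bigr => i _; rewrite mulrAC.
move: hj; rewrite ler_pdivrMr// mulrC => hj h2.
by move: (le_trans hj h2); rewrite gerDl ler10.
Qed.

(** Started from [s0], the mean of [V] grows by at most [C / (N + n0)] in total and leaving costs at
    least [eps]. So the conditional probability of leaving is at most [(V s0 + C / (N + n0)) / eps],
    which is below 1. *)
Lemma stay_positive (N : nat) (s0 : 'cV[nat]_3) (V : 'cV[nat]_3 -> R) (C eps : R) :
  0 <= C -> 0 < eps -> U N s0 -> (0 < P (x N @^-1` [set s0]))%E ->
  (forall k s, U (N + k)%N s -> 0 <= V s) ->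
  (forall k s i, U (N + k)%N s -> ~ U (N + k.+1)%N (add_ball s i) ->
    eps <= V (add_ball s i)) ->
  (forall k s, U (N + k)%N s ->
    step_mean pr V s <= V s + C * (N + n0 + k).+1%:R^-1 ^+ 2) ->
  V s0 + C / (N + n0)%:R < eps ->
  (0 < P [set w | forall k, U (N + k)%N (x (N + k)%N w)])%E.
Proof.
move=> C0 e0 Us0 Ps0 V0 Vexit Vstep hs0.
pose A := x N @^-1` [set s0].
pose r k := C * inv_level N k ^+ 2.
have hA : natural_filtration x N A by exact: natural_filtration_pre.
have r_ge0 k : 0 <= r k by rewrite mulr_ge0// sqr_ge0.
have st k s : U (N + k)%N s ->
  step_mean pr (fun s' => if s' \in U (N + k.+1)%N then V s' else eps) s + 0
    <= V s + r k.
  move=> Us; rewrite addr0; apply: le_trans (Vstep _ _ Us); apply: ler_sum => i _.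
  rewrite ler_wpM2l ?pr_ge0//; first exact: U_pos Us.
  by case: ifPn => // /negP nU; apply: (Vexit k) => // ?; apply: nU; exact: mem_set.
have sm := @supermartingale _ _ _ hA U_pos (fun=> V) (fun _ _ => 0) r eps V0
  (fun _ _ _ => lexx 0) r_ge0 (ltW e0) st.
pose B := stay x A U N.
have mB k : measurable (B k) by exact: measurable_stay_start.
have BU k w : B k w -> U (N + k)%N (x (N + k)%N w) by move=> [_ /(_ k (leqnn _))].
pose theta := V s0 + C / (N + n0)%:R.
have B0E : B 0%N = A.
  rewrite /B stay0; apply/seteqP; split=> w /=; first by case.
  by move=> Aw; split=> //; rewrite (Aw : x N w = s0).
have fB k : P (B k) \is a fin_num by exact: fin_num_measure.
pose q k := fine (P (B k)).
have qE k : P (B k) = (q k)%:E by rewrite fineK.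
have q0 : 0 < q 0%N by rewrite -lte_fin -qE B0E.
have Bdec k : B k `<=` B 0%N by exact: stay_decr.
have hq j : (1 - theta / eps) * q 0%N <= q j.
  have PD : P (B 0%N `\` B j) = (q 0%N - q j)%:E.
    have Plt : (P (B 0%N) < +oo)%E by rewrite qE ltry.
    have -> : (P (B 0%N `\` B j) = P (B 0%N) - P (B j))%E.
      by rewrite -{2}(setIidr (Bdec j)); exact: measureD.
    by rewrite !qE.
  have := sm j; rewrite -/B PD.
  have -> : (\int[P]_(w in B 0%N) (V (x (N + 0)%N w))%:E = (V s0)%:E * P (B 0%N))%E.
    rewrite -integral_cst//; apply: eq_integral => w /[!inE]; rewrite B0E addn0.
    by move=> ->.
  have : (0 <= \int[P]_(w in B j) (V (x (N + j)%N w))%:E)%E.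
    by apply: integral_ge0 => w /BU Uw; rewrite lee_fin (V0 j).
  rewrite big1; last by move=> k _; rewrite integral0.
  rewrite add0e qE -!EFinM -EFinD.
  move=> I0 smj; have : ((eps * (q 0%N - q j))%:E <=
      (V s0 * q 0%N + (\sum_(k < j) r k) * q 0%N)%:E)%E.
    by apply: le_trans smj; rewrite leeDr.
  rewrite lee_fin => h.
  have h2 : (\sum_(k < j) r k) * q 0%N <= C / (N + n0)%:R * q 0%N.
    rewrite ler_wpM2r ?(ltW q0)// -mulr_sumr ler_wpM2l//.
    by apply: sum_inv_sqr_le; rewrite addn_gt0 n0_gt0 orbT.
  have h3 : eps * (q 0%N - q j) <= theta * q 0%N.
    by rewrite /theta mulrDl; lra.
  rewrite -(ler_pM2l e0); apply: (@le_trans _ _ ((eps - theta) * q 0%N)); last lra.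
  by rewrite le_eqVlt; apply/orP; left; apply/eqP; field; rewrite gt_eqF.
set D := [set w | _]; have mD : measurable D by exact: measurable_stay_forever.
have mBc : measurable (\bigcap_k B k) by exact: bigcapT_measurable.
have BD : \bigcap_k B k `<=` D by move=> w h k; apply: BU; exact: h.
have l0 : 0 < (1 - theta / eps) * q 0%N.
  by rewrite mulr_gt0// subr_gt0 ltr_pdivrMr// mul1r.
apply: (@lt_le_trans _ _ ((1 - theta / eps) * q 0%N)%:E); first by rewrite lte_fin.
apply: (@le_trans _ _ (P (\bigcap_k B k))); last by apply: le_measure; rewrite ?inE.
have cv := @nonincreasing_cvg_mu _ _ _ P B.
have {}cv : P (B k) @[k --> \oo] --> P (\bigcap_k B k).
  apply: cv => //; first by rewrite ltey_eq fin_num_measure.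
  by move=> i j ij; rewrite subsetEset; exact: stay_decr.
rewrite -(cvg_lim _ cv)//; apply: lime_ge; first by apply/cvg_ex; exists (P (\bigcap_k B k)).
by near=> k; rewrite qE lee_fin hq.
Unshelve. all: by end_near. Qed.

(** The probability of [j] further steps inside [U], by backward recursion. As a plain function of
    the state it can be compared between two starting states without a joint process. *)
Fixpoint survive (j n : nat) (s : 'cV[nat]_3) : R :=
  if s \in U n then
    if j is j'.+1 then \sum_i pr s i * survive j' n.+1 (add_ball s i) else 1
  else 0.

Lemma survive_ge0 j n s : 0 <= survive j n s.
Proof.
elim: j n s => [|j IH] n s /=; case: ifPn => // /set_mem Us.
by rewrite sumr_ge0// => i _; rewrite mulr_ge0// pr_ge0//; exact: U_pos Us.
Qed.

Lemma survive_le1 j n s : survive j n s <= 1.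
Proof.
elim: j n s => [|j IH] n s /=; case: ifPn => // /set_mem Us.
rewrite -(pr_sum1 (U_pos Us)); apply: ler_sum => i _.
by rewrite ler_piMr// pr_ge0//; exact: U_pos Us.
Qed.

Lemma stay_prob_le A N j theta : natural_filtration x N A -> 0 <= theta ->
  (forall s, U N s -> survive j N s <= theta) ->
  (P (stay x A U N j) <= theta%:E * P A)%E.
Proof.
move=> hA t0 hs.
pose f k s := survive (j - k) (N + k) s.
have st k s : U (N + k)%N s ->
  step_mean pr (fun s' => if s' \in U (N + k.+1)%N then f k.+1 s' else 0) s + 0
    <= f k s + 0.
  move=> Us; rewrite !addr0.
  apply: (@le_trans _ _ (step_mean pr (f k.+1) s)).
    apply: ler_sum => i _; rewrite ler_wpM2l ?pr_ge0//; first exact: U_pos Us.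
    by case: ifP => // _; exact: survive_ge0.
  have [kj|jk] := ltnP k j.
    by rewrite /f -(subnSK kj) /= mem_set// addnS.
  (* From step [j] on the truncated subtraction gives 0 and [survive] is 1 on [U], so the inequality
     persists. *)
  move: (jk); rewrite -subn_eq0 => /eqP E; rewrite /f E /= mem_set//.
  rewrite -(pr_sum1 (U_pos Us)); apply: ler_sum => i _.
  by rewrite ler_piMr ?survive_le1// pr_ge0//; exact: U_pos Us.
have sm := @supermartingale _ _ _ hA U_pos f (fun _ _ => 0) (fun=> 0) 0
  (fun k s _ => survive_ge0 (j - k) (N + k) s) (fun _ _ _ => lexx 0) (fun=> lexx 0) (lexx 0) st.
have mB k : measurable (stay x A U N k) by exact: measurable_stay_start.
have := sm j; rewrite mul0e adde0 [X in (_ <= _ + X%:E * _)%E -> _]big1// mul0e adde0.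
rewrite big1; last by move=> k _; rewrite integral0.
rewrite add0e.
have -> : (\int[P]_(w in stay x A U N j) (f j (x (N + j)%N w))%:E = P (stay x A U N j))%E.
  rewrite -[RHS]mul1e -integral_cst//; apply: eq_integral => w /[!inE] -[_ /(_ j (leqnn j)) Uw].
  by rewrite /f subnn /= mem_set.
move=> h; apply: (le_trans h).
apply: (@le_trans _ _ (\int[P]_(w in stay x A U N 0) (cst theta%:E w))%E).
  apply: ge0_le_integral => //.
  - by move=> w _; rewrite lee_fin survive_ge0.
  - exact: (measurable_EFin_state mx).
  - move=> w [_ /(_ 0%N (leqnn _))]; rewrite addn0 => Uw.
    by rewrite /= lee_fin /f subn0 !addn0 hs.
rewrite integral_cst//; apply: lee_wpmul2l; first by rewrite lee_fin.
apply: le_measure; rewrite ?inE//; last by move=> w [].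
exact: natural_filtration_measurable hA.
Qed.

(** Letting [m] grow in [P D <= theta * P (B m)] gives [P D <= theta * P D]. The horizon [j] may
    depend on [m]; [theta] is uniform. *)
Lemma escape_null N theta : 0 <= theta < 1 ->
  (forall m, exists j, forall s, U (N + m)%N s -> survive j (N + m) s <= theta) ->
  P [set w | forall k, U (N + k)%N (x (N + k)%N w)] = 0%E.
Proof.
move=> /andP[t0 t1] hs.
pose B := stay x setT U N.
have hA : natural_filtration x N setT by exact: natural_filtration_start.
have mB k : measurable (B k) by exact: measurable_stay_start.
set D := [set w | _]; have mD : measurable D by exact: measurable_stay_forever.
have DE : D = \bigcap_k B k.
  apply/seteqP; split=> w h; first by move=> k _; split=> // l _; exact: h.
  by move=> k; have [_ ] := h k I; apply.
have hD m : (P D <= theta%:E * P (B m))%E.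
  have [j hj] := hs m.
  have hB : natural_filtration x (N + m) (B m) by exact: natural_filtration_stay.
  apply: le_trans (stay_prob_le hB t0 hj).
  apply: le_measure; rewrite ?inE//; first exact: measurable_stay_start.
  move=> w Dw; split; first by split=> // k _; exact: Dw.
  by move=> k _; rewrite -addnA; exact: Dw.
have cv : P (B k) @[k --> \oo] --> P D.
  rewrite DE; apply: nonincreasing_cvg_mu => //.
  - by rewrite ltey_eq fin_num_measure.
  - exact: bigcapT_measurable.
  - by move=> i j ij; rewrite subsetEset; exact: stay_decr.
have fD : P D \is a fin_num by exact: fin_num_measure.
have h : (P D <= theta%:E * P D)%E.
  have cv2 : (theta%:E * P (B k))%E @[k --> \oo] --> (theta%:E * P D)%E by exact: cvgeZl.
  rewrite -(cvg_lim _ cv2)//; apply: lime_ge.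
    by apply/cvg_ex; exists (theta%:E * P D)%E.
  by near=> k; exact: hD.
have PD0 : (0 <= P D)%E by exact: measure_ge0.
move: h PD0 fD; case: (P D) => // q; rewrite -EFinM !lee_fin => h q0 _.
congr EFin; apply/eqP; rewrite eq_le q0 andbT leNgt; apply/negP => qp.
by move: h; rewrite leNgt gtr_pMl ?t1.
Unshelve. all: by end_near. Qed.

End Stay.

(** Every colour has positive probability at each draw; the induction removes from the target one
    ball that was not there at the start. *)
Lemma reach_gt0 n (s : 'cV[nat]_3) : (forall i, (x0 i ord0 <= s i ord0)%N) -> level x0 n s ->
  (0 < P (x n @^-1` [set s]))%E.
Proof.
elim: n s => [|n IH] s x0s ls.
  have -> : s = x0.
    apply/matrixP => i j; rewrite (ord1 j); apply/eqP; rewrite eqn_leq x0s andbT.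
    have := ls; rewrite /level/= add0n /n0 /ball_count => E.
    move: (leqnn (\sum_i s i ord0)); rewrite {2}E (bigD1 i)//= [X in (_ <= X)%N](bigD1 i)//=.
    move=> h; have : (\sum_(k | k != i) x0 k ord0 <= \sum_(k | k != i) s k ord0)%N.
      by apply: leq_sum => k _; exact: x0s.
    by move=> h2; rewrite -(leq_add2r (\sum_(k | k != i) x0 k ord0)); apply: leq_trans h; rewrite leq_add2l.
  have -> : x 0%N @^-1` [set x0] = setT.
    by apply/seteqP; split=> w // _ /=; case: hx.
  by rewrite probability_setT.
have [i xi] : exists i, (x0 i ord0 < s i ord0)%N.
  apply: contrapT => /forallNP h; have := ls; rewrite /level/=.
  have -> : s = x0.
    apply/matrixP => i j; rewrite (ord1 j); apply/eqP; rewrite eqn_leq x0s andbT.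
    by rewrite leqNgt; apply/negP/h.
  by rewrite -/n0 addSn => /eqP; rewrite -[X in X == _]add0n -addSn eqn_add2r.
pose s' : 'cV[nat]_3 := \col_j (s j ord0 - (j == i))%N.
have ss : s = add_ball s' i.
  apply/matrixP => j k; rewrite (ord1 k) !mxE eqxx andbT.
  case: eqVneq => [->|_]; last by rewrite subn0 addr0.
  by rewrite -[RHS]/(_ - _ + _)%N subnK//; exact: leq_ltn_trans xi.
have ls' : level x0 n s'.
  by move: ls; rewrite /level/= {1}ss ball_count_add_ball addSn => -[].
have x0s' k : (x0 k ord0 <= s' k ord0)%N.
  rewrite !mxE; case: eqVneq => [->|_]; last by rewrite subn0.
  by rewrite subn1 -ltnS prednK//; exact: leq_ltn_trans xi.
have P' := IH s' x0s' ls'.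
apply: (@lt_le_trans _ _ (P (x n @^-1` [set s'] `&` [set w | x n.+1 w = add_ball (x n w) i]))).
  rewrite (cond_prob_state mx (urn_pr_cond hx) i (s := s'))//; last exact: natural_filtration_pre.
  by rewrite mule_gt0// lte_fin urn_pr_gt0//; exact: (level_pos hx ls').
apply: le_measure; rewrite ?inE//.
  by apply: measurableI => //; exact: measurable_add_ball.
by move=> w [/= xn ->]; rewrite xn -ss.
Qed.

End UrnStay.

(** * Equilibria and local maxima of the potential *)

Section Equilibria.
Context {R : realType}.
Implicit Types (a b r : R) (i j : 'I_3).

(** [phase_quad] is concave and positive at 1. At the larger zero [v] it is negative, otherwise
    [phase_fun] would decrease strictly from 0 to 0 between [v] and 1. By concavity it is then
    negative between [u] and [v], where [phase_fun] would increase strictly from 0 to 0. *)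
Lemma phase_roots_lo a b u v : 0 < a -> a < 1 -> (1 + 2 * a) / (1 - a) < b ->
  phase_dom a u -> phase_dom a v -> u < 1 -> v < 1 ->
  phase_fun a b u = 0 -> phase_fun a b v = 0 -> u = v.
Proof.
move=> a0 a1 hb.
wlog uv : u v / u <= v.
  move=> hw du dv u1 v1 hu hv; have [uv|vu] := leP u v; first exact: hw.
  by apply/esym; apply: hw => //; exact: ltW.
move=> du dv u1 v1 hu hv; have a1' : 0 < 1 - a by rewrite subr_gt0.
move: uv; rewrite le_eqVlt => /predU1P[//|uv].
have b0 : 0 < b by apply: lt_trans hb; rewrite divr_gt0//; lra.
have d1 : phase_dom a 1 by apply: phase_domW => //; rewrite mulr1.
have q1 : 0 < phase_quad a b 1.
  by rewrite phase_quad1 mulr_gt0// subr_gt0 -ltr_pdivrMr.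
have A0 : 0 < b * a * (1 + a) by rewrite !mulr_gt0//; lra.
have conc x y z : x < y -> y < z -> 0 <= phase_quad a b x -> 0 < phase_quad a b z ->
    0 < phase_quad a b y.
  move=> xy yz qx qz.
  have : (z - x) * phase_quad a b y = (z - y) * phase_quad a b x +
     (y - x) * phase_quad a b z + b * a * (1 + a) * ((z - x) * ((z - y) * (y - x))).
    by rewrite /phase_quad; ring.
  have h1 : 0 <= (z - y) * phase_quad a b x by rewrite mulr_ge0// subr_ge0 ltW.
  have h2 : 0 < (y - x) * phase_quad a b z by rewrite mulr_gt0// subr_gt0.
  have h3 : 0 < b * a * (1 + a) * ((z - x) * ((z - y) * (y - x))).
    by apply: mulr_gt0 => //; apply: mulr_gt0; [lra|apply: mulr_gt0; lra].
  have zx : 0 < z - x by lra.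
  by move=> E; rewrite -(pmulr_rgt0 _ zx) E; lra.
have qv : phase_quad a b v < 0.
  rewrite ltNge; apply/negP => qv.
  suff : phase_fun a b 1 < phase_fun a b v by rewrite hv phase_fun1 ltxx.
  by apply: phase_fun_decr => // x /andP[vx x1]; exact: conc qv q1.
suff : phase_fun a b u < phase_fun a b v by rewrite hu hv ltxx.
apply: phase_fun_incr => // x /andP[ux xv]; rewrite ltNge; apply/negP => qx.
by have := conc _ _ _ xv v1 qx q1; rewrite ltNge ltW.
Qed.

(** [dominant_pt] as a function on colours, the form used on the simplex. For [r < 1] colour [i] is
    a minority, and [r = 1] is the barycenter for every [i]. *)
Definition dom_fun r i : 'I_3 -> R := fun l => (if l == i then r else 1) / (2 + r).

Lemma sum_dom (x y : R) i : \sum_(l < 3) (if l == i then x else y) = x + 2 * y.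
Proof.
have [j [k [ij ik jk]]] := ord3_compl i.
rewrite (sum3 _ ij ik jk) eqxx !(eq_sym _ i) (negPf ij) (negPf ik); ring.
Qed.

Lemma dom_fun_simplex r i : 0 < r -> simplex3 (dom_fun r i).
Proof.
move=> r0; have r2 : 0 < 2 + r by lra.
split=> [l|]; first by rewrite divr_ge0 ?(ltW r2)//; case: ifP => // _; exact: ltW.
by rewrite -mulr_suml sum_dom mulr1 addrC divff// gt_eqF.
Qed.

Lemma dom_fun_pow b r i l : 0 < r ->
  dom_fun r i l `^ b = (if l == i then r `^ b else 1) / (2 + r) `^ b.
Proof.
move=> r0; have r2 : 0 < 2 + r by lra.
rewrite /dom_fun powRM ?invr_ge0 ?(ltW r2)//; last by case: ifP => // _; exact: ltW.
rewrite -powR_inv1 ?(ltW r2)// powRAC powR_inv1 ?powR_ge0//.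
by case: ifP; rewrite ?powR1.
Qed.

Lemma pow_sum_dom_fun b r i : 0 < r ->
  pow_sum b (dom_fun r i) = (r `^ b + 2) / (2 + r) `^ b.
Proof.
move=> r0; rewrite /pow_sum; under eq_bigr do rewrite dom_fun_pow//.
by rewrite -mulr_suml sum_dom mulr1.
Qed.

Lemma share_dom_fun b r i l : 0 < r ->
  share b (dom_fun r i) l = (if l == i then r `^ b else 1) / (r `^ b + 2).
Proof.
move=> r0; rewrite /share dom_fun_pow// pow_sum_dom_fun//.
have h1 : 0 < (2 + r) `^ b by rewrite powR_gt0//; lra.
have h2 : 0 < r `^ b + 2 by rewrite ltr_wpDl// powR_ge0.
by field; rewrite !gt_eqF.
Qed.

Lemma urn_drift_dom_fun a b r i l : 0 < a -> 0 < r ->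
  urn_drift (urn_share a) (urn_gain a) b (dom_fun r i) l =
  (if l == i then 2 else -1) * equil_gap a b r /
    ((1 + 2 * a) * (2 + r) * (r `^ b + 2)).
Proof.
move=> a0 r0; rewrite /urn_drift /urn_prob share_dom_fun// /dom_fun.
rewrite /urn_share /urn_gain /equil_gap.
have h1 : 0 < 1 + 2 * a by lra.
have h2 : 0 < r `^ b + 2 by rewrite ltr_wpDl// powR_ge0.
have h3 : 0 < 2 + r by lra.
by case: ifP => _; field; rewrite !gt_eqF.
Qed.

(** If [a r >= 1], then [r > 1] and the two sides of the equilibrium equation have incompatible
    signs. *)
Lemma phase_dom_equil a b r : 0 < a -> a < 1 -> 0 < r -> equil_gap a b r = 0 ->
  phase_dom a r.
Proof.
move=> a0 a1 r0 /eqP; rewrite subr_eq0 => /eqP E.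
have rb : 0 < r `^ b by rewrite powR_gt0.
have ar : a * r < 1.
  rewrite ltNge; apply/negP => ar.
  have : r `^ b * (1 - a * r) <= 0 by rewrite mulr_ge0_le0 ?(ltW rb)// subr_le0.
  rewrite E; have r1 : 1 < r by nra.
  lra.
rewrite /phase_dom ar andbT -subr_gt0 -E mulr_gt0// subr_gt0//.
Qed.

Variables (p c b : R).
Hypotheses (p0 : 0 < p) (c0 : 0 < c) (pc1 : 3 * p + c = 1) (b1 : 1 < b).

Let b0 : 0 < b.
Proof. by move: b1; lra. Qed.

(** All coordinates are fixed points of the convex map taking [t] to [p + K t ^ b]. The tangent at
    the middle one, compared with the other two, would have slope both above and below 1. *)
Lemma equil_two_eq (x : 'I_3 -> R) i j k : i != j -> i != k -> j != k ->
  simplex3 x -> (forall l, urn_drift p c b x l = 0) ->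
  x i < x j -> x j < x k -> False.
Proof.
move=> ij ik jk sx hx xij xjk; have S0 := pow_sum_gt0 (ltW b0) sx.
have xE l : x l = p + c / pow_sum b x * x l `^ b.
  move: (hx l); rewrite /urn_drift /urn_prob /share => /eqP.
  by rewrite subr_eq0 => /eqP E; rewrite -[LHS]E; ring.
have K0 : 0 < c / pow_sum b x by rewrite divr_gt0.
set K := c / pow_sum b x in xE K0.
have xj0 : 0 < x j.
  by rewrite xE ltr_wpDr// mulr_ge0 ?powR_ge0// ltW.
have t1 := powR_tangent_lt b1 xj0 (sx.1 i) (negbT (lt_eqF xij)).
have t2 := powR_tangent_lt b1 xj0 (sx.1 k) (negbT (gt_eqF xjk)).
have e1 : x i - x j = K * (x i `^ b - x j `^ b) by rewrite {1}(xE i) {1}(xE j); ring.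
have e2 : x k - x j = K * (x k `^ b - x j `^ b) by rewrite {1}(xE k) {1}(xE j); ring.
set D := b * x j `^ (b - 1) in t1 t2.
have h1 : K * (D * (x i - x j)) < x i - x j by rewrite [ltRHS]e1 ltr_pM2l//; lra.
have h2 : K * (D * (x k - x j)) < x k - x j by rewrite [ltRHS]e2 ltr_pM2l//; lra.
have h3 : K * D < 1 by rewrite -(ltr_pM2r (_ : 0 < x k - x j)) ?subr_gt0// mul1r -mulrA.
have h4 : 1 < K * D by rewrite -(ltr_nM2r (_ : x i - x j < 0)) ?subr_lt0// mul1r -mulrA.
lra.
Qed.

Lemma equil_dom_fun (x : 'I_3 -> R) : simplex3 x ->
  (forall l, urn_drift p c b x l = 0) -> exists r i, 0 < r /\ x = dom_fun r i.
Proof.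
move=> sx hx; have S0 := pow_sum_gt0 (ltW b0) sx.
have xp l : 0 < x l.
  move: (hx l); rewrite /urn_drift /urn_prob => /eqP; rewrite subr_eq0 => /eqP <-.
  by rewrite ltr_wpDr// mulr_ge0 ?share_ge0// ltW.
have [i [j [k [ij ik jk xjk]]]] : exists i j k : 'I_3,
    [/\ i != j, i != k, j != k & x j = x k].
  pose u0 : 'I_3 := ord0.
  have [u1 [u2 [h01 h02 h12]]] := ord3_compl u0.
  have key := equil_two_eq.
  have [e|n01] := eqVneq (x u0) (x u1); first by exists u2, u0, u1; rewrite eq_sym h02 eq_sym h12.
  have [e|n02] := eqVneq (x u0) (x u2); first by exists u1, u0, u2; rewrite eq_sym h01.
  have [e|n12] := eqVneq (x u1) (x u2); first by exists u0, u1, u2.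
  exfalso; have h10 : u1 != u0 by rewrite eq_sym.
  have h20 : u2 != u0 by rewrite eq_sym.
  have h21 : u2 != u1 by rewrite eq_sym.
  move: n01 n02 n12; rewrite !neq_lt.
  (* Of the eight sign patterns two are cyclic and contradictory; each of the other six is a strict
     order. *)
  move=> /orP[l1|l1] /orP[l2|l2] /orP[l3|l3].
  - exact: (key _ _ _ _ h01 h02 h12 sx hx l1 l3).
  - exact: (key _ _ _ _ h02 h01 h21 sx hx l2 l3).
  - by have := lt_trans l2 (lt_trans l1 l3); have := lt_trans l1 l3 => *; lra.
  - exact: (key _ _ _ _ h20 h21 h01 sx hx l2 l1).
  - exact: (key _ _ _ _ h10 h12 h02 sx hx l1 l2).
  - lra.
  - exact: (key _ _ _ _ h12 h10 h20 sx hx l3 l2).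
  - exact: (key _ _ _ _ h21 h20 h10 sx hx l3 l1).
exists (x i / x j), i; split; first by rewrite divr_gt0.
have sE := sx.2; rewrite (sum3 _ ij ik jk) -xjk in sE.
have E : 2 + x i / x j = (x j)^-1.
  by rewrite -[RHS]mul1r -[X in _ = X / _]sE; field; rewrite gt_eqF.
apply/funext => l; rewrite /dom_fun E invrK.
have [->|->|->] := ord3_cases l ij ik jk.
- by rewrite eqxx divfK// gt_eqF.
- by rewrite eq_sym (negPf ij) mul1r.
- by rewrite eq_sym (negPf ik) mul1r xjk.
Qed.

(** The ratio of the two sides is the slope of the convex map [p + K t ^ b] at its smaller fixed
    point, which is below 1. The difference of the two minor colours therefore contracts. *)
Lemma equil_minor_stable r i j : i != j -> 1 < r ->
  (forall l, urn_drift p c b (dom_fun r i) l = 0) ->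
  c * b * share b (dom_fun r i) j < dom_fun r i j.
Proof.
move=> ij r1 hx; have r0 : 0 < r by lra.
have sx := dom_fun_simplex i r0; have S0 := pow_sum_gt0 (ltW b0) sx.
set x := dom_fun r i in hx sx S0 *.
have xE l : x l = p + c / pow_sum b x * x l `^ b.
  move: (hx l); rewrite /urn_drift /urn_prob /share => /eqP.
  by rewrite subr_eq0 => /eqP E; rewrite -[LHS]E; ring.
have K0 : 0 < c / pow_sum b x by rewrite divr_gt0.
have r2 : 0 < 2 + r by lra.
have xj : 0 < x j by rewrite /x /dom_fun eq_sym (negPf ij) divr_gt0.
have xij : x j < x i.
  by rewrite /x /dom_fun eqxx eq_sym (negPf ij) ltr_pM2r ?invr_gt0.
have t1 := powR_tangent_lt b1 xj (sx.1 i) (negbT (gt_eqF xij)).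
have e1 : x i - x j = c / pow_sum b x * (x i `^ b - x j `^ b) by rewrite {1}(xE i) {1}(xE j); ring.
have h1 : c / pow_sum b x * (b * x j `^ (b - 1) * (x i - x j)) < x i - x j.
  by rewrite [ltRHS]e1 ltr_pM2l//; lra.
have xij0 : 0 < x i - x j by lra.
have h2 : c / pow_sum b x * (b * x j `^ (b - 1)) < 1.
  by rewrite -(ltr_pM2r xij0) mul1r; move: h1; rewrite !mulrA.
rewrite /share -(mulr_powRB1 (ltW xj) b0).
have -> : c * b * (x j * x j `^ (b - 1) / pow_sum b x) =
  (c / pow_sum b x * (b * x j `^ (b - 1))) * x j by ring.
by rewrite gtr_pMl.
Qed.

(** Here [dom_fun r i j] is the larger of the two fixed points, where the slope exceeds 1: the two
    equal colours repel. *)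
Lemma equil_minor_unstable r i j : i != j -> 0 < r -> r < 1 ->
  (forall l, urn_drift p c b (dom_fun r i) l = 0) ->
  dom_fun r i j < c * b * share b (dom_fun r i) j.
Proof.
move=> ij r0 r1 hx.
have sx := dom_fun_simplex i r0; have S0 := pow_sum_gt0 (ltW b0) sx.
set x := dom_fun r i in hx sx S0 *.
have xE l : x l = p + c / pow_sum b x * x l `^ b.
  move: (hx l); rewrite /urn_drift /urn_prob /share => /eqP.
  by rewrite subr_eq0 => /eqP E; rewrite -[LHS]E; ring.
have K0 : 0 < c / pow_sum b x by rewrite divr_gt0.
have r2 : 0 < 2 + r by lra.
have xj : 0 < x j by rewrite /x /dom_fun eq_sym (negPf ij) divr_gt0.
have xij : x i < x j.
  by rewrite /x /dom_fun eqxx eq_sym (negPf ij) ltr_pM2r ?invr_gt0.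
have t1 := powR_tangent_lt b1 xj (sx.1 i) (negbT (lt_eqF xij)).
have e1 : x i - x j = c / pow_sum b x * (x i `^ b - x j `^ b) by rewrite {1}(xE i) {1}(xE j); ring.
have h1 : c / pow_sum b x * (b * x j `^ (b - 1) * (x i - x j)) < x i - x j.
  by rewrite [ltRHS]e1 ltr_pM2l//; lra.
have xij0 : x i - x j < 0 by lra.
have h2 : 1 < c / pow_sum b x * (b * x j `^ (b - 1)).
  by rewrite -(ltr_nM2r xij0) mul1r; move: h1; rewrite !mulrA.
rewrite /share -(mulr_powRB1 (ltW xj) b0).
have -> : c * b * (x j * x j `^ (b - 1) / pow_sum b x) =
  (c / pow_sum b x * (b * x j `^ (b - 1))) * x j by ring.
by rewrite ltr_pMl.
Qed.

End Equilibria.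

(** * Stable equilibria as strict local maxima of the potential *)

Section LocalMax.
Context {R : realType}.

Lemma powR_continuous (b y : R) : 0 < y -> {for y, continuous (fun t : R => t `^ b)}.
Proof.
move=> y0; apply: differentiable_continuous; apply/derivable1_diffP.
by have := is_derive1_powR b y0 => -[].
Qed.

Lemma powR_shift_cvg (b y e : R) : 0 < y ->
  (y + e * t) `^ b @[t --> (0 : R)] --> y `^ b.
Proof.
move=> y0; have h : y + e * t @[t --> (0 : R)] --> y.
  rewrite -[X in _ --> X]addr0 -[X in _ --> y + X](mulr0 e).
  by apply: cvgD; [exact: cvg_cst|apply: cvgM; [exact: cvg_cst|exact: cvg_id]].
exact: (cvg_comp _ _ h (powR_continuous y0)).
Qed.

(** Spreads a strict inequality from an equilibrium to a box around it; [t] is the radius of the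
    box. *)
Lemma cvg0_gt_segment (F : R -> R) (l : R) : F t @[t --> (0 : R)] --> l -> 0 < l ->
  exists2 e, 0 < e & forall t, 0 <= t <= e -> 0 < F t.
Proof.
move=> Fl l0; have : \forall t \near (0 : R), 0 < F t by exact: cvgr_gt Fl _ l0.
move=> /nbhs_ballP[e /= e0 he]; exists (e / 2); first by rewrite divr_gt0.
move=> t /andP[t0 te]; apply: he; rewrite -ball_normE/= sub0r normrN ger0_norm//; lra.
Qed.

(** Along [s + t], [s - t] the potential decreases in [t]. The last hypothesis is the slope
    condition of [equil_minor_stable], with the powers replaced by their extremes on a box of radius
    [rho]. *)
Lemma two_minor_lt (p c b X y rho u v : R) : 0 < p -> 0 < c -> 1 < b -> 0 < X ->
  0 < y - rho -> y - rho <= u <= y + rho -> y - rho <= v <= y + rho -> u != v ->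
  c * (b * (y + rho) `^ b - (y - rho) `^ b) < p * (X + 2 * (y - rho) `^ b) ->
  p * (ln u + ln v) + c / b * ln (X + (u `^ b + v `^ b)) <
  p * (2 * ln ((u + v) / 2)) + c / b * ln (X + 2 * ((u + v) / 2) `^ b).
Proof.
move=> p0 c0 b1 X0 yr0 + + + hc; wlog vu : u v / v < u.
  move=> hw hu hv; rewrite neq_lt => /orP[uv|vu].
    rewrite (addrC (ln u)) (addrC (u `^ b)) (addrC u); apply: hw => //.
    by rewrite gt_eqF.
  by apply: hw => //; rewrite gt_eqF.
move=> /andP[u1 u2] /andP[v1 v2] _; have b0 : 0 < b by lra.
pose s := (u + v) / 2; pose h := (u - v) / 2.
have h0 : 0 < h by rewrite /h; lra.
pose th (t : R) : R := p * (ln (s + t) + ln (s - t)) +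
  c / b * ln (X + ((s + t) `^ b + (s - t) `^ b)).
have -> : p * (ln u + ln v) + c / b * ln (X + (u `^ b + v `^ b)) = th h.
  have su : s + h = u by rewrite /s /h; field.
  have sv : s - h = v by rewrite /s /h; field.
  by rewrite /th su sv.
have -> : p * (2 * ln ((u + v) / 2)) + c / b * ln (X + 2 * ((u + v) / 2) `^ b) = th 0.
  rewrite /th addr0 subr0 -/s; congr (_ * _ + _ * ln (_ + _)); ring.
pose S t := X + ((s + t) `^ b + (s - t) `^ b).
pose dth t := p * ((s + t)^-1 - (s - t)^-1) +
  c / S t * ((s + t) `^ (b - 1) - (s - t) `^ (b - 1)).
have pos t : 0 <= t <= h -> y - rho <= s - t /\ s + t <= y + rho.
  by rewrite /s /h => /andP[t0 th_]; split; lra.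
have S0 t : 0 < S t by rewrite ltr_wpDr// addr_ge0// powR_ge0.
apply: (@derive_decr _ th dth) => //.
  move=> t tI; have [lo hi] := pos t tI; case/andP: tI => t0 tt.
  have p1 : 0 < s + t by lra.
  have p2 : 0 < s - t by lra.
  have d1 := is_deriveD (is_derive_cst s t (1 : R)) (is_derive_id t (1 : R)).
  have d2 := is_deriveB (is_derive_cst s t (1 : R)) (is_derive_id t (1 : R)).
  have l1 := @is_derive1_comp R (@ln R) _ t _ _ (is_derive1_ln p1) d1.
  have l2 := @is_derive1_comp R (@ln R) _ t _ _ (is_derive1_ln p2) d2.
  have q1 := @is_derive1_comp R (fun z : R => z `^ b) _ t _ _ (is_derive1_powR b p1) d1.
  have q2 := @is_derive1_comp R (fun z : R => z `^ b) _ t _ _ (is_derive1_powR b p2) d2.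
  have dS := is_deriveD (is_derive_cst X t (1 : R)) (is_deriveD q1 q2).
  have lS := @is_derive1_comp R (@ln R) _ t _ _ (is_derive1_ln (S0 t)) dS.
  apply: (@is_derive_eq _ _ _ _ _ _ _ _ (is_deriveD
    (is_deriveM (is_derive_cst p t (1 : R)) (is_deriveD l1 l2))
    (is_deriveM (is_derive_cst (c / b) t (1 : R)) lS))).
  rewrite /dth /GRing.scale/=; have ? := S0 t.
  by field; rewrite !gt_eqF.
move=> t /andP[t0 tt]; have [|lo hi] := pos t; first by rewrite !ltW.
rewrite /dth; set A := s + t in hi *; set B := s - t in lo *.
have B0 : 0 < B by lra.
have AB : 0 < A - B by rewrite /A /B; lra.
have A0 : 0 < A by lra.
have t1 := powR_tangent b1 (ltW A0) (ltW B0).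
have AE : A `^ b = A * A `^ (b - 1) by rewrite mulr_powRB1// ltW.
have BE : B `^ b = B * B `^ (b - 1) by rewrite mulr_powRB1// ltW.
have mono (z w : R) : 0 < z -> z <= w -> z `^ b <= w `^ b.
  move=> z0 zw; have w0 := lt_le_trans z0 zw.
  by rewrite ge0_ler_powR ?nnegrE ?(ltW z0) ?(ltW w0)// ltW// (lt_trans ltr01).
have hA : A `^ (b - 1) * B <= (y + rho) `^ b.
  apply: (@le_trans _ _ (A `^ b)); last by apply: mono => //; lra.
  by rewrite AE mulrC ler_wpM2r ?powR_ge0//; lra.
have hB : (y - rho) `^ b <= B `^ b by apply: mono.
have hA2 : (y - rho) `^ b <= A `^ b by apply: mono => //; lra.
have key : c * (b * (A `^ (b - 1) * B) - B `^ b) < p * S t.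
  have e1 : c * (b * (A `^ (b - 1) * B)) <= c * (b * (y + rho) `^ b).
    by rewrite !ler_pM2l.
  have e2 : c * (y - rho) `^ b <= c * B `^ b by rewrite ler_pM2l.
  have e3 : p * (X + 2 * (y - rho) `^ b) <= p * S t.
    by rewrite ler_pM2l// /S -/A -/B; move: hA2 hB; clear; lra.
  by move: e1 e2 e3 hc; clear; lra.
have AB0 : 0 < A * B by rewrite mulr_gt0.
rewrite -(pmulr_llt0 _ (S0 t)) -(pmulr_llt0 _ AB0).
have St := S0 t.
have -> : (p * (A^-1 - B^-1) + c / S t * (A `^ (b - 1) - B `^ (b - 1))) * S t * (A * B) =
  - (p * S t * (A - B)) + c * (A `^ b * B - B `^ b * A).
  by rewrite AE BE; field; rewrite !gt_eqF.
(* The tangent at [A] evaluated at [B], multiplied by [B]. *)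
have : c * (A `^ b * B - B `^ b * A) <= c * ((b * (A `^ (b - 1) * B) - B `^ b) * (A - B)).
  rewrite ler_pM2l//.
  by have := ler_wpM2r (ltW B0) t1; clear; lra.
have : 0 < (p * S t - c * (b * (A `^ (b - 1) * B) - B `^ b)) * (A - B).
  by rewrite mulr_gt0// subr_gt0.
by clear; lra.
Qed.

(** [urn_potential] along the points [dom_fun r i]; the normalisation [2 + r] enters with total
    coefficient [3 p + c = 1]. *)
Definition dom_potential (p c b r : R) : R :=
  p * ln r + c / b * ln (r `^ b + 2) - ln (2 + r).

Lemma is_derive_dom_potential (a b r : R) : 0 < a -> 0 < b -> 0 < r ->
  is_derive r (1 : R) (dom_potential (urn_share a) (urn_gain a) b)
    (2 * equil_gap a b r / ((1 + 2 * a) * (r * ((2 + r) * (r `^ b + 2))))).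
Proof.
move=> a0 b0 r0; have r2 : 0 < 2 + r by lra.
have rb : 0 < r `^ b + 2 by rewrite ltr_wpDl// powR_ge0.
have d1 := is_derive1_ln r0.
have dp := is_deriveD (is_derive1_powR b r0) (is_derive_cst (2 : R) r (1 : R)).
have d2 := @is_derive1_comp R (@ln R) _ r _ _ (is_derive1_ln rb) dp.
have dq := is_deriveD (is_derive_cst (2 : R) r (1 : R)) (is_derive_id r (1 : R)).
have d3 := @is_derive1_comp R (@ln R) _ r _ _ (is_derive1_ln r2) dq.
apply: (@is_derive_eq _ _ _ _ _ _ _ _ (is_deriveB
  (is_deriveD (is_deriveM (is_derive_cst (urn_share a) r (1 : R)) d1)
    (is_deriveM (is_derive_cst (urn_gain a / b) r (1 : R)) d2)) d3)).
rewrite /GRing.scale/= /urn_share /urn_gain /equil_gap.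
have a12 : 0 < 1 + 2 * a by lra.
rewrite -(mulr_powRB1 (ltW r0) b0) in rb *.
by field; rewrite !gt_eqF.
Qed.

Lemma urn_potential_ln (p c b : R) (x : 'I_3 -> R) : 0 < p ->
  (forall l, p / 2 <= x l) ->
  urn_potential p c b x = p * (\sum_l ln (x l)) + c / b * ln (pow_sum b x).
Proof.
move=> p0 hx; rewrite /urn_potential; congr (_ * _ + _); apply: eq_bigr => l _.
by rewrite ln_extE// divr_gt0.
Qed.

Lemma urn_potential_dom (p c b r : R) (i : 'I_3) : 0 < p -> 0 < b -> 0 < r ->
  3 * p + c = 1 -> (forall l, p / 2 <= dom_fun r i l) ->
  urn_potential p c b (dom_fun r i) = dom_potential p c b r.
Proof.
move=> p0 b0 r0 pc1 h; have r2 : 0 < 2 + r by lra.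
have rb : 0 < r `^ b + 2 by rewrite ltr_wpDl// powR_ge0.
rewrite urn_potential_ln// pow_sum_dom_fun// ln_div ?posrE ?powR_gt0// ln_powR.
have -> : \sum_l ln (dom_fun r i l) = \sum_(l < 3) (if l == i then ln r - ln (2 + r) else - ln (2 + r)).
  apply: eq_bigr => l _; rewrite /dom_fun; case: ifP => _.
    by rewrite ln_div ?posrE.
  by rewrite mul1r lnV ?posrE.
rewrite sum_dom /dom_potential; have -> : c = 1 - 3 * p by lra.
by field; rewrite gt_eqF.
Qed.

Lemma dom_potential_strict_max (a b r e t : R) : 0 < a -> 0 < b -> 0 < r ->
  0 < t -> `|t - r| < e -> t != r ->
  (forall t, r - e < t -> t < r -> 0 < equil_gap a b t) ->
  (forall t, r < t -> t < r + e -> equil_gap a b t < 0) ->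
  dom_potential (urn_share a) (urn_gain a) b t <
  dom_potential (urn_share a) (urn_gain a) b r.
Proof.
move=> a0 b0 r0 t0 + + hlo hhi; rewrite ltr_norml => /andP[tr1 tr2].
have a12 : 0 < 1 + 2 * a by lra.
have dpos u : 0 < u -> 0 < (1 + 2 * a) * (u * ((2 + u) * (u `^ b + 2))).
  by move=> u0; rewrite !mulr_gt0//; [lra|rewrite ltr_wpDl// powR_ge0].
rewrite neq_lt => /orP[lt|lt].
  apply: (derive_incr lt (fun u uI => is_derive_dom_potential a0 b0
    (lt_le_trans t0 (andP uI).1))) => u /andP[u1 u2].
  have u0 := lt_trans t0 u1.
  rewrite divr_gt0 ?dpos//; apply: mulr_gt0 => //.
  by apply: hlo => //; lra.
apply: (derive_decr lt (fun u uI => is_derive_dom_potential a0 b0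
  (lt_le_trans r0 (andP uI).1))) => u /andP[u1 u2].
have u0 := lt_trans r0 u1.
rewrite pmulr_llt0 ?invr_gt0 ?dpos//.
by rewrite pmulr_rlt0//; apply: hhi => //; lra.
Qed.

Lemma ratio_close (r y s x z e rho : R) : 0 < r -> 0 < y -> 0 < s -> 0 < e ->
  z = r * y -> `|x - z| <= rho -> `|s - y| <= rho -> rho <= y / 4 ->
  rho * (4 * (1 + r)) <= e * y -> `|x / s - r| < e.
Proof.
move=> r0 y0 s0 e0 zE hx sy rhoy rho4.
have -> : x / s - r = ((x - z) - r * (s - y)) / s.
  by rewrite zE; field; rewrite gt_eqF.
rewrite normrM normfV (gtr0_norm s0) ltr_pdivrMr//.
apply: (@le_lt_trans _ _ ((1 + r) * rho)).
  apply: le_trans (ler_normB _ _) _; rewrite normrM (gtr0_norm r0).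
  by have := ler_wpM2l (ltW r0) sy; lra.
have ys : y / 2 < s by move: sy; rewrite ler_norml => /andP[? ?]; lra.
have : e * (y / 2) < e * s by rewrite ltr_pM2l.
have : 0 < e * s by rewrite mulr_gt0.
lra.
Qed.

(** A nearby point is compared with the equilibrium in two moves: averaging its two minor
    coordinates ([two_minor_lt]), then sliding along [dom_fun t i], where the derivative has the
    sign of [equil_gap]. *)
Lemma urn_potential_strict_max (a b r e : R) (i : 'I_3) :
  0 < a -> a < 1 -> 1 < b -> 0 < r ->
  let p := urn_share a in let c := urn_gain a in
  (forall l, urn_drift p c b (dom_fun r i) l = 0) ->
  (forall j, i != j -> c * b * share b (dom_fun r i) j < dom_fun r i j) ->
  0 < e ->
  (forall t, r - e < t -> t < r -> 0 < equil_gap a b t) ->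
  (forall t, r < t -> t < r + e -> equil_gap a b t < 0) ->
  exists2 rho, 0 < rho & forall x, simplex3 x ->
    (forall l, `|x l - dom_fun r i l| <= rho) ->
    (forall l, p / 2 <= x l) /\
    (x <> dom_fun r i ->
     urn_potential p c b x < urn_potential p c b (dom_fun r i)).
Proof.
move=> a0 a1 b1 r0 p c hx hst e0 hlo hhi.
have b0 : 0 < b by lra.
have p0 : 0 < p by exact: urn_share_gt0.
have c0 : 0 < c by rewrite /c divr_gt0//; lra.
have pc1 : 3 * p + c = 1 by exact: urn_share_gain.
have [j [k [ij ik jk]]] := ord3_compl i.
have sz := dom_fun_simplex i r0; set z := dom_fun r i in hx hst sz *.
have S0 := pow_sum_gt0 (ltW b0) sz.
have zE l : z l = p + c * share b z l.
  by move: (hx l) => /eqP; rewrite subr_eq0 => /eqP <-.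
have zp l : p <= z l by rewrite zE lerDl mulr_ge0 ?share_ge0// ltW.
pose y := z j.
have zk : z k = y by rewrite /y /z /dom_fun !(eq_sym _ i) (negPf ij) (negPf ik).
have y0 : 0 < y by apply: lt_le_trans (zp j).
have zi0 : 0 < z i by apply: lt_le_trans (zp i).
pose F (t : R) : R := p * ((z i + (-1) * t) `^ b + 2 * (y + (-1) * t) `^ b) -
  c * (b * (y + 1 * t) `^ b - (y + (-1) * t) `^ b).
have [rho0 rho00 hF] : exists2 e, 0 < e & forall t, 0 <= t <= e -> 0 < F t.
  apply: (@cvg0_gt_segment F (p * (z i `^ b + 2 * y `^ b) - c * (b * y `^ b - y `^ b))).
    apply: cvgB; apply: cvgM; try exact: cvg_cst.
      by apply: cvgD; [exact: powR_shift_cvg|apply: cvgM; [exact: cvg_cst|exact: powR_shift_cvg]].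
    by apply: cvgB; [apply: cvgM; [exact: cvg_cst|exact: powR_shift_cvg]|exact: powR_shift_cvg].
  have SE : pow_sum b z = z i `^ b + 2 * y `^ b.
    by rewrite /pow_sum (sum3 _ ij ik jk) zk -/y; ring.
  have := hst j ij; rewrite -/y {1}/y zE => h.
  have {h} h : c * b * share b z j - c * share b z j < p by rewrite -/y in h; lra.
  have : (c * b * share b z j - c * share b z j) * pow_sum b z < p * pow_sum b z.
    by rewrite ltr_pM2r.
  have -> : (c * b * share b z j - c * share b z j) * pow_sum b z = c * (b * y `^ b - y `^ b).
    by rewrite /share -/y; field; rewrite gt_eqF.
  by rewrite SE subr_gt0.
(* The three bounds serve [two_minor_lt], coordinates at least [p / 2], and a ratio [t] within [e]
   of [r]. *)
pose rho := Num.min rho0 (Num.min (p / 4) (e * y / (4 * (1 + r)))).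
have r1 : 0 < 4 * (1 + r) by lra.
have rhop : 0 < rho.
  rewrite lt_min rho00/= lt_min; apply/andP; split; first lra.
  by apply: divr_gt0 => //; exact: mulr_gt0.
have [rh1 rh2 rh3] : [/\ rho <= rho0, rho <= p / 4 & rho <= e * y / (4 * (1 + r))].
  by rewrite /rho !ge_min !lexx !orbT.
exists rho => // x sx hbox.
have xb l : z l - rho <= x l <= z l + rho.
  by have := hbox l; rewrite ler_norml => /andP[]; clear => ? ?; apply/andP; split; lra.
have xp l : p / 2 <= x l by have := xb l; have := zp l => ? /andP[]; lra.
split=> // xz.
pose s := (x j + x k) / 2.
have xj0 : 0 < x j by have := xp j; lra.
have xk0 : 0 < x k by have := xp k; lra.
have xi0 : 0 < x i by have := xp i; lra.
have s0 : 0 < s by rewrite /s; lra.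
have xsum : x i + x j + x k = 1 by rewrite -sx.2 (sum3 _ ij ik jk).
pose t := x i / s.
have t0 : 0 < t by rewrite divr_gt0.
have t2 : 2 + t = s^-1.
  have h : x i + 2 * s = 1 by rewrite /s; lra.
  by rewrite -[RHS]mul1r -[X in _ = X / _]h /t; field; rewrite gt_eqF.
have domE l : dom_fun t i l = if l == i then x i else s.
  by rewrite /dom_fun t2 invrK; case: ifP => _; rewrite ?mul1r// /t divfK// gt_eqF.
have sp : p / 2 <= s by have := xp j; have := xp k; rewrite /s; clear; lra.
have domp l : p / 2 <= dom_fun t i l by rewrite domE; case: ifP.
have step1 : x j != x k -> urn_potential p c b x < urn_potential p c b (dom_fun t i).
  move=> xjk; rewrite !urn_potential_ln// /pow_sum !(sum3 _ ij ik jk) !domE eqxx.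
  rewrite !(eq_sym _ i) (negPf ij) (negPf ik).
  have X0 : 0 < x i `^ b by rewrite powR_gt0.
  have := @two_minor_lt p c b (x i `^ b) y rho (x j) (x k) p0 c0 b1 X0.
  rewrite -/s; have -> : 0 < y - rho by have := zp j; rewrite -/y; move: rh2 p0; clear; lra.
  move=> /(_ isT (xb j)); rewrite -{1}zk -{1}zk => /(_ (xb k) xjk).
  have -> : c * (b * (y + rho) `^ b - (y - rho) `^ b) < p * (x i `^ b + 2 * (y - rho) `^ b).
    have := hF rho; rewrite rh1 (ltW rhop) => /(_ isT); rewrite /F mul1r !mulN1r.
    have : (z i - rho) `^ b <= x i `^ b.
      have zr : 0 <= z i - rho by have := zp i; move: rh2 p0; clear; lra.
      by have /andP[h1 _] := xb i; rewrite ge0_ler_powR ?nnegrE ?(ltW xi0)// ltW.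
    by move=> h; have := ler_wpM2l (ltW p0) h; clear; lra.
  have -> : x i `^ b + x j `^ b + x k `^ b = x i `^ b + (x j `^ b + x k `^ b) by rewrite addrA.
  have -> : x i `^ b + s `^ b + s `^ b = x i `^ b + 2 * s `^ b by ring.
  by move=> /(_ isT); clear; lra.
have zdom : urn_potential p c b z = dom_potential p c b r.
  by apply: urn_potential_dom => // l; apply: le_trans (zp l); move: p0; clear; lra.
have tdom : urn_potential p c b (dom_fun t i) = dom_potential p c b t.
  exact: urn_potential_dom.
have tr : `|t - r| < e.
  have sy : `|s - y| <= rho.
    have := xb j; have := xb k; rewrite zk -/y => /andP[+ +] /andP[+ +].
    by rewrite ler_norml /s; clear => *; apply/andP; split; lra.
  have rE : z i = r * y.
    by rewrite /y /z /dom_fun eqxx eq_sym (negPf ij) mul1r.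
  have rho4 : rho * (4 * (1 + r)) <= e * y by rewrite -ler_pdivlMr.
  have rhoy : rho <= y / 4 by have := zp j; rewrite -/y; move: rh2; clear; lra.
  exact: (ratio_close r0 y0 s0 e0 rE (hbox i) sy rhoy rho4).
have step2 : t != r -> dom_potential p c b t < dom_potential p c b r.
  by move=> trn; apply: (dom_potential_strict_max a0 b0 r0 t0 tr trn hlo hhi).
have [xjk|xjk] := eqVneq (x j) (x k); last first.
  apply: lt_le_trans (step1 xjk) _; rewrite zdom tdom.
  by have [->|/step2/ltW//] := eqVneq t r.
have xE : x = dom_fun t i.
  apply/funext => l; rewrite domE.
  have sj : s = x j by rewrite /s -xjk; field.
  have [->|->|->] := ord3_cases l ij ik jk; first by rewrite eqxx.
    by rewrite eq_sym (negPf ij).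
  by rewrite eq_sym (negPf ik) sj.
rewrite xE tdom zdom; apply: step2; apply: contra_notN xz => /eqP tE.
by rewrite xE tE.
Qed.

End LocalMax.

(** * Non-convergence to the unstable equilibria *)

Section Repulsion.
Context {R : realType}.

(* With [B = K + D^2 / t], where [D] is a difference of two ball counts among
   [t] balls, the term [C / B] compensates the diffusive regime [D^2 ~ t], where
   [- ln B + ln t] alone would not decrease. *)
Definition repel_pot (K C t D : R) : R :=
  C / (K + D ^+ 2 / t) - ln (K + D ^+ 2 / t) + ln t.

(** [C / B] and [- ln B] expanded to second order at [B]; the floor [K] controls both remainders. *)
Lemma inv_ln_taylor (K C B B' : R) : 0 < K -> 0 <= C -> K <= B -> K <= B' ->
  C / B' - ln B' <= C / B - ln B +
    (C / B ^+ 2 + B^-1) * (- (B' - B) + (B' - B) ^+ 2 / K).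
Proof.
move=> K0 C0 KB KB'; have B0 := lt_le_trans K0 KB; have B'0 := lt_le_trans K0 KB'.
set dl := B' - B.
have inv_le : B'^-1 <= B^-1 - dl / B ^+ 2 + dl ^+ 2 / K / B ^+ 2.
  have -> : B'^-1 = B^-1 - dl / B ^+ 2 + dl ^+ 2 / B' / B ^+ 2.
    by rewrite /dl; field; rewrite !gt_eqF.
  rewrite lerD2l ler_wpM2r ?invr_ge0 ?sqr_ge0// ler_wpM2l ?sqr_ge0//.
  by rewrite lef_pV2 ?posrE.
have ln_le : ln B - ln B' <= - (dl / B) + dl ^+ 2 / K / B.
  rewrite -ln_div ?posrE//; apply: le_trans (ln_leB1 (divr_gt0 B0 B'0)) _.
  have -> : B / B' - 1 = - (dl / B) + dl ^+ 2 / B' / B.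
    by rewrite /dl; field; rewrite !gt_eqF.
  rewrite lerD2l ler_wpM2r ?invr_ge0 ?(ltW B0)// ler_wpM2l ?sqr_ge0//.
  by rewrite lef_pV2 ?posrE.
have := ler_wpM2l C0 inv_le.
have -> : (C / B ^+ 2 + B^-1) * (- dl + dl ^+ 2 / K) =
  C * (- (dl / B ^+ 2) + dl ^+ 2 / K / B ^+ 2) + (- (dl / B) + dl ^+ 2 / K / B) by ring.
move: ln_le; move: (dl ^+ 2 / K / B) (dl / B) => u v h1.
rewrite !mulrDr; lra.
Qed.

(** The two sides differ by a square plus nonnegative terms, and [C] is chosen to complete that
    square. For small [Z] the term in [C] provides the gain, for large [Z] the logarithm. *)
Lemma repel_gain (kap q K C Z : R) : 0 < kap -> 0 < q -> 0 < K -> 0 <= Z ->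
  C = 2 * K ^+ 2 * (1 + kap / 2) ^+ 2 / (kap * q) ->
  1 + kap / 4 <= (C / (K + Z) ^+ 2 + (K + Z)^-1) * (q / 2 + (1 + kap / 2) * Z).
Proof.
move=> k0 q0 K0 Z0 CE; have B0 : 0 < K + Z by lra.
have al : 0 < 1 + kap / 2 by lra.
have C0 : 0 <= C by rewrite CE divr_ge0 ?mulr_ge0 ?sqr_ge0 ?ltW.
have -> : (C / (K + Z) ^+ 2 + (K + Z)^-1) * (q / 2 + (1 + kap / 2) * Z) =
  1 + kap / 4 + kap^-1 * (kap / 2 - (1 + kap / 2) * (K / (K + Z))) ^+ 2 +
  (C / (K + Z) ^+ 2 * ((1 + kap / 2) * Z) + (K + Z)^-1 * (q / 2)).
  by rewrite CE; field; rewrite !gt_eqF.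
rewrite -addrA lerDl addr_ge0//; first by rewrite mulr_ge0 ?invr_ge0 ?sqr_ge0// ltW.
apply: addr_ge0; apply: mulr_ge0.
- by rewrite divr_ge0 ?sqr_ge0.
- by rewrite mulr_ge0 ?(ltW al).
- by rewrite invr_ge0 ltW.
- by rewrite divr_ge0 ?(ltW q0).
Qed.

Lemma sqr_increment_le (D xi Z t : R) : 0 <= t -> 0 <= Z -> Z <= t ->
  D ^+ 2 = t * Z -> xi ^+ 2 <= 1 ->
  (2 * D * xi + xi ^+ 2 - Z) ^+ 2 <= 12 * t * Z + 4.
Proof.
move=> t0 Z0 Zt ZE xi1; have xi0 : 0 <= xi ^+ 2 by exact: sqr_ge0.
have tZ : 0 <= t * Z by rewrite mulr_ge0.
have h1 : 0 <= (2 * D * xi - (xi ^+ 2 - Z)) ^+ 2 by exact: sqr_ge0.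
have h2 : (D * xi) ^+ 2 <= t * Z by rewrite exprMn ZE ler_piMr.
have h3 : Z ^+ 2 <= t * Z by rewrite expr2 ler_wpM2r.
have h4 : xi ^+ 2 * xi ^+ 2 <= 1 by rewrite mulr_ile1.
have h5 : 0 <= Z * xi ^+ 2 by rewrite mulr_ge0.
have -> : (2 * D * xi + xi ^+ 2 - Z) ^+ 2 = 8 * (D * xi) ^+ 2 +
  2 * (xi ^+ 2 * xi ^+ 2) - 4 * (Z * xi ^+ 2) + 2 * Z ^+ 2 -
  (2 * D * xi - (xi ^+ 2 - Z)) ^+ 2 by ring.
lra.
Qed.

(** A new ball raises [ln t] by at most [1 / t], while the mean growth of [D ^ 2 / t] lowers the
    rest by at least [(1 + kap / 4) / t]. With [K = 12 / kap] the surplus [kap] of the drift absorbs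
    the second-order error once [t] is large. *)
Lemma repel_pot_step (kap q K C t D w1 w2 w3 : R) : 0 < kap -> 0 < q ->
  K = 12 / kap -> C = 2 * K ^+ 2 * (1 + kap / 2) ^+ 2 / (kap * q) ->
  4 <= t -> 2 * (1 + 2 * kap) <= kap * t -> 2 * kap <= q * t ->
  D ^+ 2 <= t ^+ 2 -> 0 <= w1 -> 0 <= w2 -> 0 <= w3 -> w1 + w2 + w3 = 1 ->
  (1 + kap) * D ^+ 2 / t <= D * (w1 - w2) -> q <= w1 + w2 ->
  w1 * repel_pot K C (t + 1) (D + 1) + w2 * repel_pot K C (t + 1) (D - 1) +
    w3 * repel_pot K C (t + 1) D <= repel_pot K C t D - kap / 4 / t.
Proof.
move=> k0 q0 KE CE t4 tk tq Dt w10 w20 w30 w1E drift wq.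
have t0 : 0 < t by lra.
have K0 : 0 < K by rewrite KE divr_gt0.
have C0 : 0 <= C by rewrite CE divr_ge0 ?mulr_ge0 ?sqr_ge0 ?addr_ge0 ?divr_ge0 ?ltW.
pose Z := D ^+ 2 / t.
have Z0 : 0 <= Z by rewrite divr_ge0 ?sqr_ge0 ?ltW.
have ZE : D ^+ 2 = t * Z by rewrite /Z mulrC divfK// gt_eqF.
have Zt : Z <= t by rewrite /Z ler_pdivrMr// -expr2.
pose G := C / (K + Z) ^+ 2 + (K + Z)^-1.
have G0 : 0 <= G by rewrite addr_ge0 ?divr_ge0 ?invr_ge0 ?sqr_ge0// addr_ge0// ltW.
pose dl (xi : R) := (2 * D * xi + xi ^+ 2 - Z) / (t + 1).
have pw xi : xi ^+ 2 <= 1 -> repel_pot K C (t + 1) (D + xi) <=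
    repel_pot K C t D + t^-1 + G * (- dl xi + (12 * t * Z + 4) / (K * (t + 1) ^+ 2)).
  move=> xi1.
  have xi0 : 0 <= xi ^+ 2 by exact: sqr_ge0.
  have BE : K + (D + xi) ^+ 2 / (t + 1) - (K + Z) = dl xi.
    by rewrite /dl /Z; field; rewrite !gt_eqF//; lra.
  have B'K : K <= K + (D + xi) ^+ 2 / (t + 1).
    by rewrite lerDl divr_ge0 ?sqr_ge0//; lra.
  have BK : K <= K + Z by lra.
  have := inv_ln_taylor K0 C0 BK B'K; rewrite BE -/G => h.
  have lt1 : ln (t + 1) - ln t <= t^-1.
    rewrite -ln_div ?posrE//; last lra.
    have -> : (t + 1) / t = 1 + t^-1 by field; rewrite gt_eqF.
    by apply: le_ln1Dx; apply: lt_trans (_ : 0 < _); rewrite ?invr_gt0//; lra.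
  have d2 : dl xi ^+ 2 / K <= (12 * t * Z + 4) / (K * (t + 1) ^+ 2).
    have -> : dl xi ^+ 2 / K = (2 * D * xi + xi ^+ 2 - Z) ^+ 2 / (K * (t + 1) ^+ 2).
      by rewrite /dl; field; rewrite !gt_eqF//; lra.
    apply: ler_wpM2r; first by rewrite invr_ge0 mulr_ge0 ?sqr_ge0 ?(ltW K0).
    exact: (@sqr_increment_le D xi Z t (ltW t0)).
  have := ler_wpM2l G0 d2.
  rewrite /repel_pot -/Z; move: h lt1; rewrite mulrDr; lra.
set E := (12 * t * Z + 4) / (K * (t + 1) ^+ 2) in pw.
have p1 : repel_pot K C (t + 1) (D + 1) <= repel_pot K C t D + t^-1 + G * (- dl 1 + E).
  by apply: pw; rewrite expr1n.
have p2 : repel_pot K C (t + 1) (D - 1) <= repel_pot K C t D + t^-1 + G * (- dl (-1) + E).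
  by apply: pw; rewrite sqrrN expr1n.
have p3 : repel_pot K C (t + 1) D <= repel_pot K C t D + t^-1 + G * (- dl 0 + E).
  by have := pw 0; rewrite addr0; apply; rewrite expr0n.
pose m := w1 * dl 1 + w2 * dl (-1) + w3 * dl 0.
apply: (@le_trans _ _ (repel_pot K C t D + t^-1 + G * (- m + E))).
  have -> : repel_pot K C t D + t^-1 + G * (- m + E) =
      w1 * (repel_pot K C t D + t^-1 + G * (- dl 1 + E)) +
      w2 * (repel_pot K C t D + t^-1 + G * (- dl (-1) + E)) +
      w3 * (repel_pot K C t D + t^-1 + G * (- dl 0 + E)).
    have w3E : w3 = 1 - w1 - w2 by rewrite -w1E; ring.
    by rewrite /m w3E; ring.
  by apply: lerD; [apply: lerD|]; rewrite ler_wpM2l.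
have i0 : 0 < t^-1 by rewrite invr_gt0.
(* The term [q] is the variance of the step; it provides the growth while [D] is near 0. *)
have mE : ((1 + 2 * kap) * Z + q) / (t + 1) <= m.
  have -> : m = (2 * (D * (w1 - w2)) + (w1 + w2) - Z) / (t + 1).
    rewrite /m /dl; have -> : w3 = 1 - w1 - w2 by rewrite -w1E; ring.
    by field; rewrite gt_eqF//; lra.
  rewrite ler_wpM2r ?invr_ge0//; first lra.
  by move: drift; rewrite -mulrA -/Z; lra.
have EE : E <= kap * Z * t^-1 + kap / 3 * t^-1 ^+ 2.
  have -> : kap * Z * t^-1 + kap / 3 * t^-1 ^+ 2 = (12 * t * Z + 4) / (K * t ^+ 2).
    by rewrite KE; field; rewrite !gt_eqF.
  apply: ler_wpM2l; first by rewrite addr_ge0// mulr_ge0// mulr_ge0// ltW.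
  have t10 : 0 < t + 1 by move: t0; clear; lra.
  have K1 : 0 < K * t ^+ 2 by rewrite mulr_gt0// exprn_gt0.
  have K2 : 0 < K * (t + 1) ^+ 2 by rewrite mulr_gt0// exprn_gt0.
  rewrite lef_pV2 ?posrE// ler_pM2l// lerXn2r ?nnegrE ?(ltW t0) ?(ltW t10)//.
  by rewrite lerDl.
have iE : t^-1 * (1 - t^-1) <= (t + 1)^-1.
  have -> : t^-1 * (1 - t^-1) = (t + 1)^-1 * (1 - t^-1 ^+ 2).
    by field; rewrite !gt_eqF//; lra.
  rewrite ler_piMr ?invr_ge0//; first lra.
  by rewrite gerBl sqr_ge0.
have Y0 : 0 <= (1 + 2 * kap) * Z + q.
  apply: addr_ge0; last exact: ltW.
  by apply: mulr_ge0 => //; move: k0; clear; lra.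
have mE2 := ler_wpM2l Y0 iE.
have it : t^-1 * t = 1 by rewrite mulVf// gt_eqF.
have i4 : t^-1 <= 1 / 4 by rewrite -(ler_pM2r t0) it; lra.
have ik : 2 * (1 + 2 * kap) * t^-1 <= kap.
  by rewrite ler_pdivrMr.
have iq : 2 * kap * t^-1 <= q by rewrite ler_pdivrMr.
have key : - m + E <= - (t^-1 * (q / 2 + (1 + kap / 2) * Z)).
  have b1 : 0 <= t^-1 * (Z * (kap - 2 * (1 + 2 * kap) * t^-1)).
    by rewrite mulr_ge0 ?(ltW i0)// mulr_ge0// subr_ge0.
  have b2 : 0 <= t^-1 * (q - 2 * kap * t^-1) by rewrite mulr_ge0 ?(ltW i0)// subr_ge0.
  have b3 : 0 <= t^-1 * (q * (1 / 4 - t^-1)).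
    by rewrite mulr_ge0 ?(ltW i0)// mulr_ge0 ?(ltW q0)// subr_ge0.
  have b4 : 0 < t^-1 * q by rewrite mulr_gt0.
  move: mE mE2 EE b1 b2 b3 b4; clear; lra.
have gain := repel_gain k0 q0 K0 Z0 CE; rewrite -/G in gain.
have g1 := ler_wpM2l G0 key.
have g2 := ler_wpM2l (ltW i0) gain.
move: g1 g2; clear; lra.
Qed.

End Repulsion.

Section Boxes.
Context {R : realType}.
Implicit Types (x z : 'I_3 -> R).

Definition near_states (x0 : 'cV[nat]_3) z (rho : R) (n : nat) : set 'cV[nat]_3 :=
  [set s | level x0 n s /\ forall l, `|state_prop s l - z l| <= rho].

Lemma near_states_level (x0 : 'cV[nat]_3) z rho n s : near_states x0 z rho n s -> level x0 n s.
Proof. by case. Qed.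

Lemma box_bounds x z (rho : R) l : (forall l, `|x l - z l| <= rho) ->
  z l - rho <= x l <= z l + rho.
Proof. by move=> /(_ l); rewrite ler_norml => /andP[? ?]; apply/andP; split; lra. Qed.

Lemma pow_sum_box (b : R) x z (rho : R) : 0 <= b -> (forall l, 0 <= x l) ->
  (forall l, `|x l - z l| <= rho) -> pow_sum b x <= \sum_l (z l + rho) `^ b.
Proof.
move=> b0 xp hx; apply: ler_sum => l _; have /andP[h1 h2] := box_bounds l hx.
by rewrite ge0_ler_powR ?nnegrE// (le_trans (xp l)).
Qed.

(** The slope of [urn_prob] at the common value exceeds 1, and [kap] is half the excess. In a small
    box the tangent at the smaller of the two coordinates retains slope [1 + kap]. *)
Lemma unstable_pair_local (p c b : R) z (j k : 'I_3) : 0 < c -> 1 < b ->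
  (forall l, 0 < z l) -> z j = z k -> z j < c * b * share b z j ->
  exists kap rho, [/\ 0 < kap, 0 < rho & forall x, simplex3 x ->
    (forall l, `|x l - z l| <= rho) ->
    (1 + kap) * (x j - x k) ^+ 2 <=
      (x j - x k) * (urn_prob p c b x j - urn_prob p c b x k)].
Proof.
move=> c0 b1 z0 zjk hz; have b0 : 0 < b by lra.
have S0 : 0 < pow_sum b z.
  by rewrite /pow_sum (bigD1 j)//= ltr_wpDr ?powR_gt0 ?sumr_ge0// => l _; exact: powR_ge0.
set y := z j in hz; have y0 : 0 < y by exact: z0.
have hz2 : pow_sum b z < c * b * y `^ (b - 1).
  have : y * pow_sum b z < y * (c * b * y `^ (b - 1)).
    have -> : y * (c * b * y `^ (b - 1)) = c * b * y `^ b.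
      by rewrite -(mulr_powRB1 (ltW y0) b0); ring.
    by rewrite mulrC -ltr_pdivlMl// mulrC; move: hz; rewrite /share -/y !mulrA.
  by rewrite ltr_pM2l.
pose kap := (c * b * y `^ (b - 1) / pow_sum b z - 1) / 2.
have k0 : 0 < kap by rewrite divr_gt0// subr_gt0 ltr_pdivlMr// mul1r.
pose F (t : R) : R := c * b * (y + (-1) * t) `^ (b - 1) -
  (1 + kap) * \sum_l (z l + 1 * t) `^ b.
have [rho0 rho00 hF] : exists2 e, 0 < e & forall t, 0 <= t <= e -> 0 < F t.
  apply: (@cvg0_gt_segment R F (c * b * y `^ (b - 1) - (1 + kap) * pow_sum b z)).
    apply: cvgB; apply: cvgM; try exact: cvg_cst; first exact: powR_shift_cvg.
    by apply: cvg_big => [|l _]; [exact: add_continuous|exact: powR_shift_cvg].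
  have -> : c * b * y `^ (b - 1) - (1 + kap) * pow_sum b z =
      (c * b * y `^ (b - 1) - pow_sum b z) / 2.
    by rewrite /kap; field; rewrite gt_eqF.
  by rewrite divr_gt0// subr_gt0.
pose rho := Num.min rho0 (y / 2).
have rhop : 0 < rho by rewrite lt_min rho00 divr_gt0.
have [rh1 rh2] : rho <= rho0 /\ rho <= y / 2 by rewrite /rho !ge_min !lexx orbT.
exists kap, rho; split=> // x sx hbox.
have Sx := pow_sum_gt0 (ltW b0) sx.
have Sle := pow_sum_box (ltW b0) sx.1 hbox.
have hF1 : (1 + kap) * pow_sum b x <= c * b * (y - rho) `^ (b - 1).
  have := hF rho; rewrite rh1 (ltW rhop) => /(_ isT).
  rewrite /F mulN1r mul1r subr_gt0 => /ltW; apply: le_trans.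
  by rewrite ler_wpM2l// addr_ge0// ltW.
have key u v : (u = j /\ v = k) \/ (u = k /\ v = j) -> x v <= x u ->
   (1 + kap) * (x u - x v) <= urn_prob p c b x u - urn_prob p c b x v.
  move=> uv vu; have zv : z v = y by case: uv => -[_ ->].
  have yv : y - rho <= x v by have /andP[] := box_bounds v hbox; rewrite zv.
  have yr : 0 < y - rho by move: rh2 y0; clear; lra.
  have tg := powR_tangent b1 (sx.1 v) (sx.1 u).
  have hp : (y - rho) `^ (b - 1) <= x v `^ (b - 1).
    rewrite ge0_ler_powR ?nnegrE ?(ltW yr)//; last exact: sx.1.
    by move: b1; clear; lra.
  have -> : urn_prob p c b x u - urn_prob p c b x v = c * (x u `^ b - x v `^ b) / pow_sum b x.
    by rewrite /urn_prob /share; ring.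
  rewrite ler_pdivlMr// mulrAC.
  have d0 : 0 <= x u - x v by rewrite subr_ge0.
  have h1 := ler_wpM2r d0 hF1.
  have h2 : c * b * (y - rho) `^ (b - 1) * (x u - x v) <= c * b * x v `^ (b - 1) * (x u - x v).
    by rewrite ler_wpM2r// ler_wpM2l// mulr_ge0// ltW.
  have h3 : c * (b * x v `^ (b - 1) * (x u - x v)) <= c * (x u `^ b - x v `^ b).
    by rewrite ler_wpM2l ?(ltW c0)//; move: tg; clear; lra.
  by move: h1 h2 h3; clear; lra.
have [kj|jk] := leP (x k) (x j).
  have := key j k (or_introl (conj erefl erefl)) kj.
  by rewrite -(subr_ge0 (x k)) in kj => h; have := ler_wpM2l kj h; rewrite expr2; clear; lra.
have := key k j (or_intror (conj erefl erefl)) (ltW jk).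
rewrite -subr_gt0 in jk => h; have := ler_wpM2l (ltW jk) h; rewrite !expr2; clear; lra.
Qed.

End Boxes.

Section UnstablePair.
Context {R : realType} {d : measure_display} {T : measurableType d}.
Variables (a b : R) (P : probability T R) (x0 : 'cV[nat]_3).
Variable x : nat -> T -> 'cV[nat]_3.
Hypothesis a0 : 0 < a.
Hypothesis a1 : a < 1.
Hypothesis b1 : 1 < b.
Hypothesis hx : urn_process (sym_mx a) b x0 P x.

Let p := urn_share a.
Let c := urn_gain a.

Let b0 : 0 < b. Proof. by move: b1; lra. Qed.
Let p0 : 0 < p. Proof. exact: urn_share_gt0. Qed.
Let c0 : 0 < c. Proof. by rewrite /c divr_gt0//; move: a0 a1; lra. Qed.
Let pc1 : 3 * p + c = 1. Proof. exact: urn_share_gain. Qed.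

Lemma urn_prob_ge_share (y : 'I_3 -> R) i : p <= urn_prob p c b y i.
Proof. by rewrite lerDl mulr_ge0 ?share_ge0// ltW. Qed.

(** A path converging to [z] would lie in the box from some time on; these countably many events are
    null. *)
Lemma no_limit_of_escape (z : 'I_3 -> R) (rho : R) N0 : 0 < rho ->
  (forall N, (N0 <= N)%N ->
    P [set w | forall k, near_states x0 z rho (N + k) (x (N + k)%N w)] = 0%E) ->
  {ae P, forall w, ~ (forall l, state_prop (x n w) l @[n --> \oo] --> z l)}.
Proof.
move=> rho0 hN.
have h : {ae P, forall w, forall m, ~ (forall k, near_states x0 z rho (N0 + m + k) (x (N0 + m + k)%N w))}.
  apply: ae_foralln => m; have h0 := hN (N0 + m)%N (leq_addr _ _).
  exists [set w | forall k, near_states x0 z rho (N0 + m + k) (x (N0 + m + k)%N w)]; split=> //.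
    by apply: (measurable_stay_forever hx).
  by move=> w /= /contrapT.
apply: filterS2 (urn_path_ae a0 b0 hx) h => w path h cv.
have : \forall n \near \oo, forall l, `|state_prop (x n w) l - z l| <= rho.
  apply: filter_forall => l; have /cvgrPdist_le/(_ _ rho0) := cv l.
  by apply: filterS => n; rewrite distrC.
move=> [m _ hm]; apply: (h m) => k; split; first by case: (path (N0 + m + k)%N).
by move=> l; apply: hm => /=; rewrite -addnA addnCA leq_addr.
Qed.

(** [repel_pot] of the difference of the counts of [j] and [k] is fed to [stay_null]. It is bounded
    below because [D ^ 2 <= t ^ 2] gives [K + D ^ 2 / t <= (K + 1) t]. *)
Lemma unstable_pair_no_limit (z : 'I_3 -> R) (j k : 'I_3) : j != k ->
  (forall l, 0 < z l) -> z j = z k -> z j < c * b * share b z j ->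
  {ae P, forall w, ~ (forall l, state_prop (x n w) l @[n --> \oo] --> z l)}.
Proof.
move=> jk z0 zjk hz.
have [kap [rho [k0 rho0 hloc]]] := unstable_pair_local p c0 b1 z0 zjk hz.
pose K := 12 / kap; pose C := 2 * K ^+ 2 * (1 + kap / 2) ^+ 2 / (kap * p).
have K0 : 0 < K by rewrite divr_gt0.
have C0 : 0 <= C.
  rewrite /C divr_ge0//; last by rewrite mulr_ge0// ltW.
  by apply: mulr_ge0; [apply: mulr_ge0 => //|]; exact: sqr_ge0.
(* Beyond this number of balls the three thresholds of [repel_pot_step] hold, with [q = p]. *)
pose T0 := 4 + 2 * (1 + 2 * kap) / kap + 2 * kap / p.
have tail t : T0 <= t -> [/\ 4 <= t, 2 * (1 + 2 * kap) <= kap * t & 2 * kap <= p * t].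
  have q1 : 0 < 2 * (1 + 2 * kap) / kap by rewrite divr_gt0//; move: k0; lra.
  have q2 : 0 < 2 * kap / p by rewrite divr_gt0// mulr_gt0.
  move=> h; rewrite ![_ * t]mulrC -!ler_pdivrMr//.
  by split; move: h q1 q2; rewrite /T0; lra.
have [i [ij ik]] : exists i, i != j /\ i != k.
  have [u [v [ju jv uv]]] := ord3_compl j.
  have [ku|ku] := eqVneq k u; first by exists v; rewrite ku !(eq_sym v).
  have [kv|kv] := eqVneq k v; first by exists u; rewrite kv (eq_sym u j).
  by exists u; rewrite (eq_sym u j) (eq_sym u k).
pose D (s : 'cV[nat]_3) : R := (s j ord0)%:R - (s k ord0)%:R.
pose W (m : nat) (s : 'cV[nat]_3) := repel_pot K C (ball_count s)%:R (D s).
have Dle s : D s ^+ 2 <= ((ball_count s)%:R : R) ^+ 2.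
  rewrite -[leLHS]ger0_norm ?sqr_ge0// normrX lerXn2r ?nnegrE//.
  have hl (l : 'I_3) : (s l ord0)%:R <= (ball_count s)%:R :> R.
    by rewrite ler_nat /ball_count (bigD1 l)//= leq_addr.
  rewrite ler_norml /D; have := hl j; have := hl k.
  have : 0 <= (s j ord0)%:R :> R by [].
  have : 0 <= (s k ord0)%:R :> R by [].
  move: ((s j ord0)%:R : R) ((s k ord0)%:R : R) ((ball_count s)%:R : R) => u v t.
  by lra.
apply: (@no_limit_of_escape z rho (Num.truncn T0).+1) => // N hN.
apply: (@stay_null _ _ _ _ _ _ _ _ a0 b0 hx _ (@near_states_level _ _ _ _) N W (ln (K + 1)) (kap / 4)).
- by rewrite divr_gt0.
- move=> m s /(level_pos hx) s0; rewrite /W /repel_pot.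
  set t : R := (ball_count s)%:R; have t1 : 1 <= t by rewrite ler1n.
  have t0 : 0 < t by move: t1; lra.
  have Dt0 : 0 <= D s ^+ 2 / t by rewrite divr_ge0 ?sqr_ge0 ?ltW.
  have Dt : D s ^+ 2 / t <= t by rewrite ler_pdivrMr// -expr2 Dle.
  have B0 : 0 < K + D s ^+ 2 / t by rewrite ltr_wpDr.
  have hl : ln (K + D s ^+ 2 / t) <= ln (K + 1) + ln t.
    have K1 : 0 < K + 1 by rewrite addr_gt0.
    rewrite -lnM ?posrE// ler_ln ?posrE ?mulr_gt0//.
    have : K <= K * t by rewrite ler_peMr// ltW.
    by move: Dt; lra.
  have : 0 <= C / (K + D s ^+ 2 / t) by rewrite divr_ge0// ltW.
  by move: hl; lra.
- move=> m s [ls hbox]; have s0 := level_pos hx ls.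
  rewrite /step_mean (sum3 _ jk (i := j) (j := k) (k := i)); last 2 first.
  + by rewrite eq_sym.
  + by rewrite eq_sym.
  set t : R := (ball_count s)%:R.
  have DE l : D (add_ball s l) = D s + (j == l)%:R - (k == l)%:R.
    by rewrite /D !mxE !eqxx !andbT !natrD; ring.
  rewrite /W !ball_count_add_ball -natr1 -/t !DE !eqxx (negPf jk) eq_sym (negPf jk).
  rewrite !(eq_sym _ i) (negPf ij) (negPf ik) !subr0 !addr0.
  have tT : T0 <= t.
    apply: le_trans (ltW (truncnS_gt _)) _; rewrite ler_nat; move: ls; rewrite /level/= => ->.
    by apply: leq_trans hN _; rewrite -addnA leq_addr.
  have [t4 tk tq] := tail t tT.
  have t0 : 0 < t by move: t4; lra.
  have sx := simplex3_state_prop (R := R) s0.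
  have st := @repel_pot_step R kap p K C t (D s) (urn_pr a b s j) (urn_pr a b s k)
    (urn_pr a b s i) k0 p0 erefl erefl t4 tk tq (Dle s)
    (urn_pr_ge0 a0 b0 j s0) (urn_pr_ge0 a0 b0 k s0) (urn_pr_ge0 a0 b0 i s0).
  apply: le_trans (st _ _ _) _.
  + have := urn_pr_sum1 a0 b0 s0; rewrite (sum3 _ (i := j) (j := k) (k := i))//.
      by rewrite eq_sym.
    by rewrite eq_sym.
  + rewrite !(urn_prE a0 b0)//.
    have DP : D s = t * (state_prop s j - state_prop s k).
      by rewrite /D /state_prop -/t; field; rewrite gt_eqF.
    have -> : (1 + kap) * D s ^+ 2 / t =
        t * ((1 + kap) * (state_prop s j - state_prop s k) ^+ 2).
      by rewrite DP; field; rewrite gt_eqF.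
    by rewrite DP -mulrA ler_wpM2l ?(ltW t0)//; exact: hloc.
  + rewrite !(urn_prE a0 b0)//; apply: ler_wpDr; last exact: urn_prob_ge_share.
    by apply: le_trans (urn_prob_ge_share _ k); exact: ltW.
  rewrite lerD2l lerN2 ler_wpM2l//; first by rewrite divr_ge0 ?ltW.
  rewrite lef_pV2 ?posrE ?ltr0n// /t; move: ls; rewrite /level/= => ->.
  by rewrite ler_nat addnAC.
Qed.

End UnstablePair.

(** * Comparison of two ordered urns near the saddle *)

Section SaddleLocal.
Context {R : realType}.

(** The inequality on [pow_sum b z] says that moving mass from the minor colours to [i] raises the
    probability of [i] with slope above 1; as [z j = z k], it does not matter from which of them.
    The estimate is for finite displacements, since the coupling compares two states at positive
    distance. *)
Lemma saddle_local (p c b : R) (z : 'I_3 -> R) (i j k : 'I_3) :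
  i != j -> i != k -> j != k -> 0 < c -> 1 < b ->
  0 < z j -> z j = z k -> z j < z i ->
  pow_sum b z ^+ 2 < c * b * (2 * z i `^ (b - 1) * z j `^ b + z i `^ b * z j `^ (b - 1)) ->
  exists lam rho, [/\ 0 < lam, 0 < rho & forall x x', simplex3 x -> simplex3 x' ->
    (forall l, `|x l - z l| <= rho) -> (forall l, `|x' l - z l| <= rho) ->
    x i <= x' i -> x' j <= x j -> x' k <= x k ->
    [/\ (1 + lam) * (x' i - x i) <= urn_prob p c b x' i - urn_prob p c b x i,
      urn_prob p c b x' j <= urn_prob p c b x j &
      urn_prob p c b x' k <= urn_prob p c b x k]].
Proof.
move=> ij ik jk c0 b1; set y := z j; set q := z i => y0 yk yq hz.
have b0 : 0 < b by lra.
have q0 : 0 < q by exact: lt_trans yq.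
have z0 l : 0 < z l by case: (ord3_cases l ij ik jk) => ->; rewrite -?yk.
have S0 : 0 < pow_sum b z.
  by rewrite /pow_sum (bigD1 j)//= ltr_wpDr ?powR_gt0 ?sumr_ge0// => l _; exact: powR_ge0.
pose H (t : R) : R := 2 * (q + (-1) * t) `^ (b - 1) * (y + (-1) * t) `^ b +
    (q + (-1) * t) `^ b * (y + (-1) * t) `^ (b - 1).
pose U (t : R) : R := \sum_l (z l + 1 * t) `^ b.
set H0 := (X in _ < c * b * X) in hz.
pose lam := (c * b * H0 / pow_sum b z ^+ 2 - 1) / 2.
have SS0 : 0 < pow_sum b z ^+ 2 by rewrite exprn_gt0.
have l0 : 0 < lam by rewrite divr_gt0// subr_gt0 ltr_pdivlMr// mul1r.
pose F (t : R) : R := c * b * H t - (1 + lam) * (U t * U t).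
have cvU : U t @[t --> 0] --> pow_sum b z.
  by apply: cvg_big => [|l _]; [exact: add_continuous|exact: powR_shift_cvg].
have [rho0 rho00 hF] : exists2 e, 0 < e & forall t, 0 <= t <= e -> 0 < F t.
  apply: (@cvg0_gt_segment R F (c * b * H0 - (1 + lam) * (pow_sum b z * pow_sum b z))).
    apply: cvgB; apply: cvgM; try exact: cvg_cst; last by apply: cvgM.
    apply: cvgD; apply: cvgM; try exact: powR_shift_cvg.
    by apply: cvgM; [exact: cvg_cst|exact: powR_shift_cvg].
  have -> : c * b * H0 - (1 + lam) * (pow_sum b z * pow_sum b z) =
      (c * b * H0 - pow_sum b z ^+ 2) / 2.
    by rewrite /lam; field; rewrite gt_eqF.
  by rewrite divr_gt0// subr_gt0.
pose rho := Num.min rho0 (Num.min (y / 2) ((q - y) / 2)).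
have rhop : 0 < rho by rewrite !lt_min rho00 !divr_gt0// subr_gt0.
have [rh1 rh2 rh3] : [/\ rho <= rho0, rho <= y / 2 & rho <= (q - y) / 2].
  by rewrite /rho !ge_min !lexx !orbT.
exists lam, rho; split=> // x x' sx sx' hb hb' xi xj xk.
have SE v : pow_sum b v = v i `^ b + v j `^ b + v k `^ b by exact: sum3.
have Sx := pow_sum_gt0 (ltW b0) sx; have Sx' := pow_sum_gt0 (ltW b0) sx'.
have yr : 0 < y - rho by move: rh2 y0; clear; lra.
have qr : 0 < q - rho by move: yr yq; clear; lra.
have bj : y - rho <= x j <= y + rho by exact: (box_bounds j hb).
have bk : y - rho <= x k <= y + rho by rewrite yk; exact: (box_bounds k hb).
have bj' : y - rho <= x' j <= y + rho by exact: (box_bounds j hb').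
have bk' : y - rho <= x' k <= y + rho by rewrite yk; exact: (box_bounds k hb').
have bi : q - rho <= x i <= q + rho by exact: (box_bounds i hb).
have sumx : x i + x j + x k = x' i + x' j + x' k.
  by rewrite -!(sum3 _ ij ik jk) sx.2 sx'.2.
have b10 : 0 <= b - 1 by rewrite subr_ge0 ltW.
have mono e u v : 0 <= e -> 0 <= u -> u <= v -> u `^ e <= v `^ e :> R.
  by move=> e0 u0 uv; rewrite ge0_ler_powR ?nnegrE// (le_trans u0).
have tA := powR_tangent b1 (sx.1 i) (sx'.1 i).
have tj := powR_tangent b1 (sx'.1 j) (sx.1 j).
have tk := powR_tangent b1 (sx'.1 k) (sx.1 k).
have tj' := powR_tangent b1 (sx.1 j) (sx'.1 j).
have tk' := powR_tangent b1 (sx.1 k) (sx'.1 k).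
have dj0 : 0 <= x j - x' j by rewrite subr_ge0.
have dk0 : 0 <= x k - x' k by rewrite subr_ge0.
have di0 : 0 <= x' i - x i by rewrite subr_ge0.
(* Mass moves to the coordinate where [t ^ b] has the larger derivative, so the power sum grows; the
   minor shares then fall. *)
have SS : pow_sum b x <= pow_sum b x'.
  have hj : x j `^ (b - 1) <= x i `^ (b - 1).
    by apply: mono => //; [exact: sx.1|move: bj bi rh3; clear; lra].
  have hk : x k `^ (b - 1) <= x i `^ (b - 1).
    by apply: mono => //; [exact: sx.1|move: bk bi rh3; clear; lra].
  rewrite !SE.
  have e1 := ler_wpM2r dj0 hj; have e2 := ler_wpM2r dk0 hk.
  have e3 : x' i - x i = (x j - x' j) + (x k - x' k) by move: sumx; clear; lra.
  have e4 : b * (x j `^ (b - 1) * (x j - x' j) + x k `^ (b - 1) * (x k - x' k)) <=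
      b * (x i `^ (b - 1) * (x' i - x i)).
    by rewrite ler_wpM2l ?(ltW b0)// e3 [leRHS]mulrDr; exact: lerD.
  by move: tA tj' tk' e4; clear; lra.
have minor l : x' l <= x l -> urn_prob p c b x' l <= urn_prob p c b x l.
  move=> xl; rewrite lerD2l ler_wpM2l ?(ltW c0)//.
  rewrite /share ler_pdivrMr// mulrAC ler_pdivlMr//.
  apply: ler_pM; rewrite ?powR_ge0 ?(ltW Sx)//.
  by apply: mono => //; [exact: ltW|exact: sx'.1].
split; [|exact: minor|exact: minor].
have Ux v : simplex3 v -> (forall l, `|v l - z l| <= rho) -> pow_sum b v <= U rho.
  move=> sv hv; rewrite /U; under eq_bigr do rewrite mul1r.
  exact: pow_sum_box (ltW b0) sv.1 hv.
have U0 : 0 < U rho by apply: lt_le_trans (Ux _ sx hb).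
have hFr : (1 + lam) * (U rho * U rho) <= c * b * H rho.
  by have := hF rho; rewrite rh1 (ltW rhop) => /(_ isT); rewrite subr_gt0 => /ltW.
(* The share of [i] has the form [A / (A + M)]; the growth of [A] and the fall of [M] are bounded
   separately by tangents. *)
have -> : urn_prob p c b x' i - urn_prob p c b x i =
    c * ((x' i `^ b - x i `^ b) * (x j `^ b + x k `^ b) +
      x i `^ b * (x j `^ b - x' j `^ b + (x k `^ b - x' k `^ b))) /
      (pow_sum b x * pow_sum b x').
  rewrite /urn_prob /share; move: Sx Sx'; rewrite !SE => Sx Sx'.
  by field; rewrite !gt_eqF.
rewrite ler_pdivlMr ?mulr_gt0//.
have hSS : pow_sum b x * pow_sum b x' <= U rho * U rho.
  by apply: ler_pM; rewrite ?(ltW Sx) ?(ltW Sx') ?Ux.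
have l10 : 0 <= (1 + lam) * (x' i - x i) by rewrite mulr_ge0// addr_ge0// ltW.
apply: (le_trans (ler_wpM2l l10 hSS)).
have : (x' i - x i) * ((1 + lam) * (U rho * U rho)) <= (x' i - x i) * (c * b * H rho).
  by rewrite ler_wpM2l.
have -> : (1 + lam) * (x' i - x i) * (U rho * U rho) = (x' i - x i) * ((1 + lam) * (U rho * U rho)).
  by ring.
move=> /le_trans; apply.
have -> : (x' i - x i) * (c * b * H rho) = c * (b * (x' i - x i) * H rho) by ring.
rewrite ler_wpM2l ?(ltW c0)// /H !mulN1r mulrDr.
have e1 : b * (x' i - x i) * (q - rho) `^ (b - 1) <= x' i `^ b - x i `^ b.
  have : (q - rho) `^ (b - 1) <= x i `^ (b - 1).
    by apply: mono => //; [exact: ltW|case/andP: bi].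
  move=> /(ler_wpM2l (mulr_ge0 (ltW b0) di0)).
  by move: tA; clear; lra.
have e2 : 2 * (y - rho) `^ b <= x j `^ b + x k `^ b.
  have h1 : (y - rho) `^ b <= x j `^ b.
    by apply: mono; [exact: ltW|exact: ltW|case/andP: bj].
  have h2 : (y - rho) `^ b <= x k `^ b.
    by apply: mono; [exact: ltW|exact: ltW|case/andP: bk].
  by move: h1 h2; clear; lra.
have e3 : (q - rho) `^ b <= x i `^ b.
  by apply: mono; [exact: ltW|exact: ltW|case/andP: bi].
have e4 : b * (x' i - x i) * (y - rho) `^ (b - 1) <=
    x j `^ b - x' j `^ b + (x k `^ b - x' k `^ b).
  have h1 : (y - rho) `^ (b - 1) <= x' j `^ (b - 1).
    by apply: mono => //; [exact: ltW|case/andP: bj'].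
  have h2 : (y - rho) `^ (b - 1) <= x' k `^ (b - 1).
    by apply: mono => //; [exact: ltW|case/andP: bk'].
  have {}h1 := ler_wpM2l (mulr_ge0 (ltW b0) dj0) h1.
  have {}h2 := ler_wpM2l (mulr_ge0 (ltW b0) dk0) h2.
  have -> : x' i - x i = (x j - x' j) + (x k - x' k) by move: sumx; clear; lra.
  by move: tj tk h1 h2; clear; lra.
apply: lerD.
  have -> : b * (x' i - x i) * (2 * (q - rho) `^ (b - 1) * (y - rho) `^ b) =
    (b * (x' i - x i) * (q - rho) `^ (b - 1)) * (2 * (y - rho) `^ b) by ring.
  by apply: ler_pM => //; rewrite !mulr_ge0 ?powR_ge0// ltW.
have -> : b * (x' i - x i) * ((q - rho) `^ b * (y - rho) `^ (b - 1)) =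
  (q - rho) `^ b * (b * (x' i - x i) * (y - rho) `^ (b - 1)) by ring.
by apply: ler_pM => //; rewrite ?mulr_ge0 ?powR_ge0// ltW.
Qed.

(** With probability [h] the gap [e] grows by 1. The correction [1 / e] makes the corresponding
    fall, [ln (e + 1) - ln e + 1 / e - 1 / (e + 1)], at least [1 / e]; so the mean fall is at least
    [h / e - 1 / t >= lam / t]. *)
Lemma coupling_pot_step (lam t e h : R) : 0 < lam -> 1 <= e -> 1 <= t ->
  (1 + lam) * e / t <= h -> h <= 1 ->
  lam / (t + 1) + (1 - h) * (ln (t + 1) - ln e + e^-1) +
    h * (ln (t + 1) - ln (e + 1) + (e + 1)^-1) <= ln t - ln e + e^-1.
Proof.
move=> l0 e1 t1 hh h1.
have e0 : 0 < e by lra. have t0 : 0 < t by lra.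
have h0 : 0 <= h by apply: le_trans hh; rewrite divr_ge0 ?mulr_ge0 ?(ltW e0) ?(ltW t0)//; lra.
have L1 : ln (t + 1) - ln t <= t^-1.
  have tt : 0 < 1 + t^-1 by rewrite addr_gt0 ?invr_gt0.
  have -> : ln (t + 1) - ln t = ln (1 + t^-1).
    rewrite -ln_div ?posrE//; last by rewrite addr_gt0.
    by congr ln; field; rewrite gt_eqF.
  by have := ln_leB1 tt; lra.
have L2 : (e + 1)^-1 <= ln (e + 1) - ln e.
  have ee : 0 < e + 1 by lra.
  have := ln_geB1V (divr_gt0 ee e0); rewrite ln_div ?posrE// invf_div => h2.
  apply: le_trans h2; rewrite le_eqVlt; apply/orP; left; apply/eqP.
  by field; rewrite gt_eqF.
have L3 : lam / (t + 1) <= lam / t.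
  by rewrite ler_wpM2l ?(ltW l0)// lef_pV2 ?posrE; lra.
have L4 : (1 + lam) / t <= h * e^-1.
  rewrite ler_pdivlMr//; apply: le_trans hh.
  by rewrite le_eqVlt mulrAC eqxx.
have L5 : h * e^-1 <= h * (ln (e + 1) - ln e + e^-1 - (e + 1)^-1).
  by rewrite ler_wpM2l//; lra.
have L6 : (1 + lam) / t = t^-1 + lam / t by rewrite mulrDl mul1r.
rewrite -subr_ge0; move: L1 L3 L4 L5; rewrite L6.
move: (ln (t + 1)) (ln t) (ln (e + 1)) (ln e) (e^-1) ((e + 1)^-1) (lam / (t + 1)) (lam / t) (t^-1).
by clear; move=> *; nra.
Qed.

(** The joint law of the two draws has weights [qi], [qj'], [qk'] on equal colours, [qj - qj'] on
    [(j, i)] and [qk - qk'] on [(k, i)]. The gap grows in the last two cases, whose total weight is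
    [qi' - qi]. *)
Lemma coupling_mean (qi qj qk qi' qj' qk' Ai Aj Ak Bi Bj Bk tau u v : R) :
  0 <= qi -> 0 <= qj' -> 0 <= qk' -> qj' <= qj -> qk' <= qk ->
  qi + qj + qk = 1 -> qi' + qj' + qk' = 1 ->
  tau * (Ai + Bi - 1) <= u -> tau * (Aj + Bj - 1) <= u -> tau * (Ak + Bk - 1) <= u ->
  tau * (Aj + Bi - 1) <= v -> tau * (Ak + Bi - 1) <= v ->
  tau * (qi * Ai + qj * Aj + qk * Ak + (qi' * Bi + qj' * Bj + qk' * Bk) - 1) <=
  (1 - (qi' - qi)) * u + (qi' - qi) * v.
Proof.
move=> i0 j0 k0 jj kk s1 s1' wi wj wk wji wki.
have -> : qi' = 1 - qj' - qk' by rewrite -s1'; ring.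
have qiE : qi = 1 - qj - qk by rewrite -s1; ring.
rewrite -subr_ge0 in jj; rewrite -subr_ge0 in kk.
have w1 := ler_wpM2l i0 wi; have w2 := ler_wpM2l j0 wj; have w3 := ler_wpM2l k0 wk.
have w4 := ler_wpM2l jj wji; have w5 := ler_wpM2l kk wki.
apply: (@le_trans _ _ (qi * u + qj' * u + qk' * u + (qj - qj') * v + (qk - qk') * v)); last first.
  by rewrite qiE le_eqVlt; apply/orP; left; apply/eqP; ring.
apply: le_trans (lerD (lerD (lerD (lerD w1 w2) w3) w4) w5).
by rewrite qiE le_eqVlt; apply/orP; left; apply/eqP; ring.
Qed.

End SaddleLocal.

Section SaddleEscape.
Context {R : realType} {d : measure_display} {T : measurableType d}.
Variables (a b : R) (P : probability T R) (x0 : 'cV[nat]_3).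
Variable x : nat -> T -> 'cV[nat]_3.
Hypothesis a0 : 0 < a.
Hypothesis a1 : a < 1.
Hypothesis b1 : 1 < b.
Hypothesis hx : urn_process (sym_mx a) b x0 P x.
Variables (z : 'I_3 -> R) (rho lam : R) (i j k : 'I_3).
Hypothesis ij : i != j.
Hypothesis ik : i != k.
Hypothesis jk : j != k.
Hypothesis lam0 : 0 < lam.

Let p := urn_share a.
Let c := urn_gain a.
Let n0 := ball_count x0.
Let pr := urn_pr a b.
Let U := near_states x0 z rho.

Hypothesis hloc : forall y y', simplex3 y -> simplex3 y' ->
    (forall l, `|y l - z l| <= rho) -> (forall l, `|y' l - z l| <= rho) ->
    y i <= y' i -> y' j <= y j -> y' k <= y k ->
    [/\ (1 + lam) * (y' i - y i) <= urn_prob p c b y' i - urn_prob p c b y i,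
      urn_prob p c b y' j <= urn_prob p c b y j &
      urn_prob p c b y' k <= urn_prob p c b y k].

Let b0 : 0 < b. Proof. by move: b1; lra. Qed.
Let p0 : 0 < p. Proof. exact: urn_share_gt0. Qed.
Let c0 : 0 < c. Proof. by rewrite /c divr_gt0//; move: a0 a1; lra. Qed.
Let pc1 : 3 * p + c = 1. Proof. exact: urn_share_gain. Qed.

Let sv := survive a b U.

Let add_ball_at (s : 'cV[nat]_3) u l : add_ball s u l ord0 = (s l ord0 + (l == u))%N.
Proof. by rewrite !mxE eqxx andbT; case: (l == u). Qed.

Let gap (s s' : 'cV[nat]_3) : R := (s' i ord0)%:R - (s i ord0)%:R.

Let pot (n : nat) (D : R) : R := ln (n + n0)%:R - ln D + D^-1.

Let pot_ge0 n (s s' : 'cV[nat]_3) : level x0 n s' -> (s i ord0 < s' i ord0)%N -> 0 <= pot n (gap s s').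
Proof.
move=> ls' si; have g0 : 0 < gap s s' by rewrite subr_gt0 ltr_nat.
have : gap s s' <= (n + n0)%:R.
  rewrite -[(n + n0)%N]/(n + ball_count x0)%N -ls'.
  have h : (s' i ord0)%:R <= (ball_count s')%:R :> R.
    by rewrite ler_nat /ball_count (bigD1 i)//= leq_addr.
  by apply: le_trans h; rewrite gerBl.
move=> gn; have : ln (gap s s') <= ln (n + n0)%:R.
  by rewrite ler_ln ?posrE// (lt_le_trans g0).
have : 0 < (gap s s')^-1 by rewrite invr_gt0.
by rewrite /pot; lra.
Qed.

Let rates n s s' : level x0 n s -> level x0 n s' -> U n s -> U n s' ->
  (s i ord0 < s' i ord0)%N -> (s' j ord0 <= s j ord0)%N -> (s' k ord0 <= s k ord0)%N ->
  [/\ (1 + lam) * gap s s' / (n + n0)%:R <= pr s' i - pr s i,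
    pr s' j <= pr s j & pr s' k <= pr s k].
Proof.
move=> ls ls' [_ hU] [_ hU'] si sj sk.
have s0 := level_pos hx ls; have s0' := level_pos hx ls'.
have le_prop u v l : level x0 n u -> level x0 n v -> (u l ord0 <= v l ord0)%N ->
    state_prop u l <= state_prop v l :> R.
  by move=> lu lv uv; rewrite /state_prop lu lv ler_wpM2r ?invr_ge0// ler_nat.
have [h1 h2 h3] := hloc (simplex3_state_prop s0) (simplex3_state_prop s0') hU hU'
  (le_prop _ _ _ ls ls' (ltnW si)) (le_prop _ _ _ ls' ls sj) (le_prop _ _ _ ls' ls sk).
rewrite /pr !(urn_prE a0 b0)//; split=> //.
apply: le_trans h1; rewrite /state_prop ls ls' -mulrBl mulrA.
by rewrite le_eqVlt eqxx.
Qed.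

(* The two chains are coupled so that they draw the same colour, except that
   the upper one draws [i] when the lower one draws a minor colour in excess. *)
Lemma coupled_survive m n (s s' : 'cV[nat]_3) : level x0 n s -> level x0 n s' ->
  (s i ord0 < s' i ord0)%N -> (s' j ord0 <= s j ord0)%N -> (s' k ord0 <= s k ord0)%N ->
  lam * (\sum_(l < m) (n + n0 + l).+1%:R^-1) * (sv m n s + sv m n s' - 1) <=
    pot n (gap s s').
Proof.
elim: m n s s' => [|m IH] n s s' ls ls' si sj sk.
  by rewrite big_ord0 mulr0 mul0r; exact: pot_ge0.
have s0 := level_pos hx ls; have s0' := level_pos hx ls'.
pose Tm : R := \sum_(l < m.+1) (n + n0 + l).+1%:R^-1.
have T0 : 0 <= Tm by rewrite sumr_ge0.
have pr1 := urn_pr_sum1 a0 b0 s0; have pr1' := urn_pr_sum1 a0 b0 s0'.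
rewrite -/pr (sum3 _ ij ik jk) in pr1; rewrite -/pr (sum3 _ ij ik jk) in pr1'.
(* A start outside [U] has survival 0, so the left side is at most 0. *)
have out (u v : R) : u <= 1 -> v = 0 -> lam * Tm * (u + v - 1) <= pot n (gap s s').
  move=> u1 ->; apply: le_trans (pot_ge0 ls' si).
  by rewrite mulr_ge0_le0 ?mulr_ge0 ?(ltW lam0)//; lra.
have le1 u : sv m.+1 n u <= 1 by exact: (survive_le1 a0 b0 hx (@near_states_level _ _ _ _)).
have [sU|sU] := boolP (s \in U n); last first.
  by rewrite addrC [sv _ _ s + _]addrC addrC; apply: out => //; rewrite /sv/= (negPf sU).
have [sU'|sU'] := boolP (s' \in U n); last first.
  by apply: out => //; rewrite /sv/= (negPf sU').
have [r1 r2 r3] := rates ls ls' (set_mem sU) (set_mem sU') si sj sk.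
have q0 l : 0 <= pr s l by exact: urn_pr_ge0.
have q0' l : 0 <= pr s' l by exact: urn_pr_ge0.
pose A l := sv m n.+1 (add_ball s l); pose B l := sv m n.+1 (add_ball s' l).
(* A lower bound for the probability that both copies survive, whatever their joint law. *)
pose E := sv m.+1 n s + sv m.+1 n s' - 1.
have E1 : E <= 1 by rewrite /E lerBlDr; apply: lerD; exact: le1.
have EE : E = (pr s i * A i + pr s j * A j + pr s k * A k) +
    (pr s' i * B i + pr s' j * B j + pr s' k * B k) - 1.
  by rewrite /E /sv /= sU sU' !(sum3 _ ij ik jk).
pose tau : R := lam * \sum_(l < m) (n.+1 + n0 + l).+1%:R^-1.
have TmE : lam * Tm = lam / ((n + n0)%:R + 1) + tau.
  rewrite /Tm big_ord_recl mulrDr addn0 natr1; congr (_ + lam * _).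
  by apply: eq_bigr => l _; rewrite /= !addSn addnS.
have step u v : (add_ball s u i ord0 < add_ball s' v i ord0)%N ->
    (add_ball s' v j ord0 <= add_ball s u j ord0)%N ->
    (add_ball s' v k ord0 <= add_ball s u k ord0)%N ->
    tau * (A u + B v - 1) <= pot n.+1 (gap (add_ball s u) (add_ball s' v)).
  by move=> h1 h2 h3; apply: IH => //; exact: level_add_ball.
have gapE u v : gap (add_ball s u) (add_ball s' v) = gap s s' + (i == v)%:R - (i == u)%:R.
  by rewrite /gap !add_ball_at !natrD; ring.
have nE := (negPf ij, negPf ik, negPf jk, eq_sym j i, eq_sym k i, eq_sym k j, eqxx).
have Wii : tau * (A i + B i - 1) <= pot n.+1 (gap s s').
  have := step i i; rewrite gapE !add_ball_at !nE addrK !addn0 ltn_add2r; exact.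
have Wjj : tau * (A j + B j - 1) <= pot n.+1 (gap s s').
  have := step j j; rewrite gapE !add_ball_at !nE addr0 subr0 !addn0 leq_add2r; exact.
have Wkk : tau * (A k + B k - 1) <= pot n.+1 (gap s s').
  have := step k k; rewrite gapE !add_ball_at !nE addr0 subr0 !addn0 leq_add2r; exact.
have Wji : tau * (A j + B i - 1) <= pot n.+1 (gap s s' + 1).
  have := step j i; rewrite gapE !add_ball_at !nE subr0 !addn0; apply=> //.
    by rewrite ltn_addr.
  by rewrite (leq_trans sj) ?leq_addr.
have Wki : tau * (A k + B i - 1) <= pot n.+1 (gap s s' + 1).
  have := step k i; rewrite gapE !add_ball_at !nE subr0 !addn0; apply=> //.
    by rewrite ltn_addr.
  by rewrite (leq_trans sk) ?leq_addr.
have g1 : 1 <= gap s s' by rewrite lerBrDr nat1r ler_nat.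
have t1 : 1 <= (n + n0)%:R :> R by rewrite ler1n addn_gt0 [(0 < n0)%N](level_pos hx (n := 0)) ?orbT.
set h := pr s' i - pr s i in r1.
have h1 : h <= 1.
  have qi1 : pr s' i <= 1 by rewrite -pr1' -addrA lerDl addr_ge0.
  by rewrite lerBlDr; apply: le_trans qi1 _; rewrite lerDl.
have := coupling_pot_step lam0 g1 t1 r1 h1.
rewrite -/(pot n (gap s s')); apply: le_trans.
rewrite -/Tm -/E TmE mulrDl.
have l1 : lam / ((n + n0)%:R + 1) * E <= lam / ((n + n0)%:R + 1).
  by rewrite ler_piMr// divr_ge0 ?(ltW lam0)// addr_ge0.
have potE D : ln ((n + n0)%:R + 1) - ln D + D^-1 = pot n.+1 D by rewrite /pot addSn natr1.
rewrite !potE -addrA; apply: lerD => //.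
rewrite EE; exact: (coupling_mean _ _ _ r2 r3 pr1 pr1').
Qed.

(** Drawing [j] or [i] from the same state gives ordered successors with gap 1. By [coupled_survive]
    their survival probabilities over a long horizon sum to at most 3/2. Both draws have probability
    at least [p], so at least [p / 2] is lost. *)
Lemma saddle_escape N : P [set w | forall m, U (N + m)%N (x (N + m)%N w)] = 0%E.
Proof.
have p1 : p < 1 by move: c0 p0 pc1; lra.
apply: (escape_null a0 b0 hx (@near_states_level _ _ _ _) (theta := 1 - p / 2)).
  by apply/andP; move: p1 p0; lra.
move=> m; set n := (N + m)%N.
(* The initial value for gap 1 is [ln t + 1]; twice that over [lam] bounds the excess of the two
   survivals over 1 by 1/2. *)
have [v hv] := sum_inv_unbounded (R := R) (n.+1 + n0) (2 * (ln (n.+1 + n0)%:R + 1) / lam).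
exists v.+1 => s Us; have ls := near_states_level Us; have s0 := level_pos hx ls.
have cs := @coupled_survive v n.+1 (add_ball s j) (add_ball s i)
  (level_add_ball _ ls) (level_add_ball _ ls).
rewrite !add_ball_at !eqxx (negPf ij) (eq_sym j) (negPf ij) !(eq_sym k) (negPf ik) (negPf jk) in cs.
have {}cs := cs (ltac:(by rewrite addn0 addn1)) (ltac:(by rewrite addn0 leq_addr)) (leqnn _).
have g1 : gap (add_ball s j) (add_ball s i) = 1.
  by rewrite /gap !add_ball_at eqxx (negPf ij) natrD addn0 addrC addKr.
rewrite g1 /pot ln1 subr0 invr1 in cs.
have l0 : 0 <= ln (n.+1 + n0)%:R :> R by rewrite ln_ge0// ler1n addSn.
rewrite ler_pdivrMr// in hv.
have S2 : sv v n.+1 (add_ball s i) + sv v n.+1 (add_ball s j) <= 3 / 2.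
  rewrite leNgt; apply/negP => h.
  set t := ln _ in cs hv l0; set S := \sum_(l < v) _ in cs hv.
  have S0 : 0 < S.
    rewrite -(pmulr_lgt0 _ lam0); apply: lt_le_trans hv; lra.
  have h2 : 1 / 2 < sv v n.+1 (add_ball s j) + sv v n.+1 (add_ball s i) - 1 by move: h; lra.
  have : lam * S * (1 / 2) < lam * S * (sv v n.+1 (add_ball s j) + sv v n.+1 (add_ball s i) - 1).
    by rewrite ltr_pM2l// mulr_gt0.
  by move: cs hv; lra.
have le1 l : sv v n.+1 (add_ball s l) <= 1 by exact: (survive_le1 a0 b0 hx (@near_states_level _ _ _ _)).
rewrite -/sv /sv /= mem_set//.
have hp l : p * (1 - sv v n.+1 (add_ball s l)) <= pr s l * (1 - sv v n.+1 (add_ball s l)).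
  rewrite ler_wpM2r ?subr_ge0// /pr (urn_prE a0 b0)//.
  by rewrite lerDl mulr_ge0 ?share_ge0// ltW.
have := urn_pr_sum1 a0 b0 s0; rewrite -/pr !(sum3 _ ij ik jk) -/sv => pr1.
have := hp i; have := hp j; have hk := hp k; have := le1 k.
have : 0 <= p * (1 - sv v n.+1 (add_ball s k)) by rewrite mulr_ge0 ?(ltW p0)// subr_ge0.
move: (ler_wpM2l (ltW p0) S2) hk pr1; lra.
Qed.

End SaddleEscape.

Section NoLimit.
Context {R : realType} {d : measure_display} {T : measurableType d}.
Variables (a b : R) (P : probability T R) (x0 : 'cV[nat]_3).
Variable x : nat -> T -> 'cV[nat]_3.
Hypothesis a0 : 0 < a.
Hypothesis a1 : a < 1.
Hypothesis b1 : 1 < b.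
Hypothesis hx : urn_process (sym_mx a) b x0 P x.

Let p := urn_share a.
Let c := urn_gain a.

Let b0 : 0 < b. Proof. by move: b1; lra. Qed.
Let p0 : 0 < p. Proof. exact: urn_share_gt0. Qed.
Let c0 : 0 < c. Proof. by rewrite /c divr_gt0//; move: a0 a1; lra. Qed.
Let pc1 : 3 * p + c = 1. Proof. exact: urn_share_gain. Qed.

Let dom_fun_gt0 (r : R) (i l : 'I_3) : 0 < r -> 0 < dom_fun r i l.
Proof. by move=> r0; rewrite divr_gt0 ?addr_gt0//; case: ifP. Qed.

(** At equal coordinates the slope of [urn_prob] is [c * b], which exceeds 1 exactly above the
    threshold. *)
Lemma barycenter_no_limit (i : 'I_3) : (1 + 2 * a) / (1 - a) < b ->
  {ae P, forall w, ~ (forall l, state_prop (x n w) l @[n --> \oo] --> dom_fun (1 : R) i l)}.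
Proof.
move=> hb; have [j [k [ij ik jk]]] := ord3_compl i.
apply: (unstable_pair_no_limit a0 a1 b1 hx jk) => [l||].
- exact: dom_fun_gt0.
- by rewrite /dom_fun !if_same.
rewrite share_dom_fun// powR1 !if_same /dom_fun !if_same (_ : 1 + 2 = 2 + 1); last by rewrite addrC.
rewrite mul1r ltr_pMl ?invr_gt0 ?addr_gt0// /urn_gain.
have h1 : 0 < 1 - a by move: a1; lra.
have h2 : 0 < 1 + 2 * a by move: a0; lra.
by rewrite mulrAC ltr_pdivlMr// mul1r [ltRHS]mulrC -ltr_pdivrMr.
Qed.

Lemma minor_no_limit r (i : 'I_3) : 0 < r -> r < 1 -> equil_gap a b r = 0 ->
  {ae P, forall w, ~ (forall l, state_prop (x n w) l @[n --> \oo] --> dom_fun r i l)}.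
Proof.
move=> r0 r1 gap0; have [j [k [ij ik jk]]] := ord3_compl i.
apply: (unstable_pair_no_limit a0 a1 b1 hx jk) => [l||].
- exact: dom_fun_gt0.
- by rewrite /dom_fun eq_sym (negPf ij) eq_sym (negPf ik).
apply: equil_minor_unstable => // l.
have := @urn_drift_dom_fun R a b r i l a0 r0; rewrite gap0 mulr0 mul0r; exact.
Qed.

(** The slope condition of [saddle_local] turns into [phase_quad > 0] once [r ^ b] is eliminated
    through the equilibrium equation. *)
Lemma saddle_no_limit r (i : 'I_3) : 1 < r -> equil_gap a b r = 0 -> 0 < phase_quad a b r ->
  {ae P, forall w, ~ (forall l, state_prop (x n w) l @[n --> \oo] --> dom_fun r i l)}.
Proof.
move=> r1 gap0 hq; have [j [k [ij ik jk]]] := ord3_compl i.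
have r0 : 0 < r by move: r1; lra.
have r2 : 0 < 2 + r by move: r1; lra.
have rb : 0 < r `^ b + 2 by rewrite ltr_wpDl// powR_ge0.
have dr := phase_dom_equil a0 a1 r0 gap0.
have zi : dom_fun r i i = r / (2 + r) by rewrite /dom_fun eqxx.
have zj : dom_fun r i j = (2 + r)^-1 by rewrite /dom_fun eq_sym (negPf ij) mul1r.
have zk : dom_fun r i k = (2 + r)^-1 by rewrite /dom_fun eq_sym (negPf ik) mul1r.
have [||||lam [rho [l0 rho0 hloc]]] := @saddle_local R p c b (dom_fun r i) i j k ij ik jk c0 b1.
- exact: dom_fun_gt0.
- by rewrite zj zk.
- by rewrite zi zj ltr_pMl ?invr_gt0.
- set y := (2 + r)^-1 in zi zj *; have y0 : 0 < y by rewrite invr_gt0.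
  have yb : 0 < y `^ b by rewrite powR_gt0.
  have e1 : y `^ (b - 1) = y `^ b / y.
    by rewrite -(mulr_powRB1 (ltW y0) b0) mulrC mulKf// gt_eqF.
  have e2 : r `^ (b - 1) = r `^ b / r.
    by rewrite -(mulr_powRB1 (ltW r0) b0) mulrC mulKf// gt_eqF.
  rewrite pow_sum_dom_fun// zi zj !powRM ?(ltW r0) ?(ltW y0)// e1 e2.
  have e0 : (2 + r) `^ b = (y `^ b)^-1.
    apply: (@mulIf _ (y `^ b)); first by rewrite gt_eqF.
    by rewrite mulVf ?gt_eqF// -powRM ?(ltW r2) ?(ltW y0)// divff ?gt_eqF// powR1.
  rewrite e0 invrK; set q := r `^ b in gap0 rb *; set u := y `^ b in yb *.
  have -> : c * b * (2 * (q / r * (u / y)) * u + q * u * (u / y)) =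
      u ^+ 2 * (c * b * q * (2 + r) ^+ 2 / r).
    by rewrite /y; field; rewrite !gt_eqF.
  rewrite exprMn mulrC ltr_pM2l ?exprn_gt0//.
  case/andP: dr => dr1 dr2; have d0 : 0 < 1 - a * r by rewrite subr_gt0.
  have qE : q = ((1 + a) * r - 2 * a) / (1 - a * r).
    by move/eqP: gap0; rewrite subr_eq0 => /eqP <-; rewrite mulfK// gt_eqF.
  have h1 : 0 < 1 - a by move: a1; lra.
  have h2 : 0 < 1 + 2 * a by move: a0; lra.
  rewrite ltr_pdivlMr// qE -subr_gt0.
  have -> : c * b * (((1 + a) * r - 2 * a) / (1 - a * r)) * (2 + r) ^+ 2 -
      (((1 + a) * r - 2 * a) / (1 - a * r) + 2) ^+ 2 * r =
      phase_quad a b r * ((1 - a) * (2 + r) ^+ 2 / ((1 + 2 * a) * (1 - a * r) ^+ 2)).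
    by rewrite /c /urn_gain /phase_quad; field; rewrite !gt_eqF.
  by rewrite mulr_gt0// divr_gt0 ?mulr_gt0 ?exprn_gt0.
apply: (@no_limit_of_escape _ _ _ _ _ _ _ _ a0 b1 hx (dom_fun r i) rho 0 rho0) => N _.
exact: (saddle_escape a0 a1 b1 hx ij ik jk l0 hloc N).
Qed.

End NoLimit.

(** * Almost sure convergence *)

Section Topology.
Context {R : realType}.
Implicit Types (y z : 'I_3 -> R).

Definition dist1 y z : R := \sum_l `|y l - z l|.

Lemma dist1_ge0 y z : 0 <= dist1 y z.
Proof. exact: sumr_ge0. Qed.

Lemma dist1C y z : dist1 y z = dist1 z y.
Proof. by apply: eq_bigr => l _; rewrite distrC. Qed.

Lemma dist1_triangle z x y : dist1 x y <= dist1 x z + dist1 z y.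
Proof.
rewrite -big_split/=; apply: ler_sum => l _.
by rewrite -[x l - y l](subrKA (z l)) ler_normD.
Qed.

Lemma dist1_le y z e : (forall l, `|y l - z l| <= e) -> dist1 y z <= 3 * e.
Proof.
move=> h; have -> : 3 * e = \sum_(l < 3) e by rewrite sumr_const card_ord mulr_natl.
exact: ler_sum.
Qed.

Lemma dist1_coord y z l : `|y l - z l| <= dist1 y z.
Proof. by rewrite /dist1 (bigD1 l)//= lerDl sumr_ge0. Qed.

Lemma dist1_eq0 y z : dist1 y z = 0 -> y = z.
Proof.
move=> h; apply/funext => l; apply/eqP; rewrite -subr_eq0 -normr_le0 -h.
exact: dist1_coord.
Qed.

Lemma sum_continuous (g : 'I_3 -> 'rV[R]_3 -> R) v : (forall l, {for v, continuous (g l)}) ->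
  {for v, continuous (fun v => \sum_l g l v)}.
Proof.
move=> h; exact: (@cvg_big R 'I_3 +%R 0 xpredT (@add_continuous R) 'rV[R]_3 (nbhs v) _
  g _ (nbhs_filter v) (fun l _ => h l)).
Qed.

Lemma dist1_continuous z : continuous (fun v : 'rV[R]_3 => dist1 (v ord0) z).
Proof.
move=> v; apply: (@sum_continuous (fun l (v : 'rV[R]_3) => `|v ord0 l - z l|)) => l.
apply: (@continuous_comp _ _ _ (fun v : 'rV[R]_3 => v ord0 l - z l) Num.norm); last exact: norm_continuous.
exact: (continuousB (@coord_continuous R 1 3 ord0 l v) (@cst_continuous _ _ (z l) v)).
Qed.

(** Equal points under different indices are allowed, as [dom_fun 1 i] is the same for every [i];
    such pairs enter the minimum with the value 1. *)
Lemma finite_dist1_sep (I : finType) (z : I -> 'I_3 -> R) :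
  exists2 sg, 0 < sg & forall i j, dist1 (z i) (z j) < sg -> z i = z j.
Proof.
pose D (u : I * I) : R := if dist1 (z u.1) (z u.2) == 0 then 1 else dist1 (z u.1) (z u.2).
exists (\big[Num.min/1]_u D u).
  apply: lt_bigmin => // u _; rewrite /D; case: eqP => // /eqP h.
  by rewrite lt_neqAle eq_sym h dist1_ge0.
move=> i j h; apply: dist1_eq0; apply/eqP; apply/negPn/negP => h0.
have := bigmin_le_cond 1 (P := xpredT) D (j := (i, j)) isT.
by rewrite leNgt => /negP; apply; rewrite /D /= (negPf h0).
Qed.

(** Distinct points are at least [sg] apart. Once the sequence is within [sg / 4] of the set and
    moves by less than [sg / 4], it cannot pass from one point to another. *)
Lemma finite_limit (I : finType) (z : I -> 'I_3 -> R) (y : nat -> 'I_3 -> R) :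
  dist1 (y n.+1) (y n) @[n --> \oo] --> 0 ->
  (forall e, 0 < e -> \forall n \near \oo, exists i, dist1 (y n) (z i) < e) ->
  exists i, forall l, y n l @[n --> \oo] --> z i l.
Proof.
move=> hstep hz; have [sg s0 hsep] := finite_dist1_sep z.
have s4 : 0 < sg / 4 by rewrite divr_gt0.
have st : \forall n \near \oo, dist1 (y n.+1) (y n) < sg / 4.
  by have := cvgr_lt _ hstep _ s4; apply.
have [M _ hM] := filterI (hz _ s4) st.
have [[i hi] _] := hM M (leqnn M).
exists i => l.
have stayi n : (M <= n)%N -> dist1 (y n) (z i) < sg / 4.
  move=> /subnK <-; elim: (n - M)%N => [|k IH]; first by rewrite add0n.
  have [_ h1] := hM (k + M)%N (leq_addl _ _).
  have [[j hj] _] := hM (k + M).+1 (leqW (leq_addl _ _)).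
  have : dist1 (z i) (z j) < sg.
    have t1 := dist1_triangle (y (k + M)%N) (z i) (z j).
    have t2 := dist1_triangle (y (k + M).+1) (y (k + M)%N) (z j).
    rewrite (dist1C (z i) (y _)) in t1; rewrite (dist1C (y (k + M)%N) (y _)) in t2.
    by move: t1 t2 IH h1 hj s0; lra.
  by move=> /hsep ->.
apply/cvgrPdist_lt => e e0.
have me : 0 < Num.min e (sg / 4) by rewrite lt_min e0.
have [K _ hK] := hz _ me.
exists (maxn M K) => // n /=; rewrite geq_max => /andP[Mn Kn].
have [j hj] := hK n Kn; have hi' := stayi n Mn.
have E : z i = z j.
  apply: hsep; have t1 := dist1_triangle (y n) (z i) (z j).
  rewrite (dist1C (z i) (y n)) in t1.
  by move: hj; rewrite lt_min => /andP[_]; move: hi' t1 s0; lra.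
rewrite distrC; apply: le_lt_trans (dist1_coord _ _ l) _.
by move: hj; rewrite -E lt_min => /andP[].
Qed.

Lemma compact_pos_lb (C : set 'rV[R]_3) (g : 'rV[R]_3 -> R) : closed C ->
  (forall v, C v -> forall l, 0 <= v ord0 l <= 1) ->
  (forall v, C v -> {for v, continuous g}) -> (forall v, C v -> 0 < g v) ->
  exists2 dl, 0 < dl & forall v, C v -> dl <= g v.
Proof.
move=> clC C01 cg g0.
have [C0|/set0P nC] := eqVneq C set0; first by exists 1 => // v; rewrite C0.
have cC : compact C.
  apply: (@subclosed_compact _ _ [set v : 'rV[R]_3 | forall l, `[0, 1]%classic (v ord0 l)]) => //.
    by apply: (@rV_compact R 3 (fun=> `[0, 1]%classic)) => _; exact: segment_compact.
have gC : {within C, continuous g}.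
  apply: continuous_in_subspaceT => v; rewrite inE; exact: cg.
have [v vC hv] := compact_EVT_min nC cC gC.
exists (g v); first by apply: g0; exact: set_mem.
by move=> u Cu; apply: hv; exact: mem_set.
Qed.

Lemma closed_coord_ge (f : 'rV[R]_3 -> R) (m : R) : continuous f ->
  closed [set v | m <= f v].
Proof.
by move=> cf; apply: (@closed_comp _ _ f [set r | m <= r]) => [v _|]; [exact: cf|exact: closed_ge].
Qed.

Lemma closed_simplex3 : closed [set v : 'rV[R]_3 | \sum_l v ord0 l = 1].
Proof.
apply: (@closed_comp _ _ (fun v : 'rV[R]_3 => \sum_l v ord0 l) [set r | r = 1]) => [v _|].
  apply: (@sum_continuous (fun l (v : 'rV[R]_3) => v ord0 l)) => l; exact: coord_continuous.
exact: closed_eq.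
Qed.

Lemma coord_powR_continuous (b : R) (v : 'rV[R]_3) l : 0 < v ord0 l ->
  {for v, continuous (fun v : 'rV[R]_3 => v ord0 l `^ b)}.
Proof.
move=> v0; apply: (@continuous_comp _ _ _ (fun v : 'rV[R]_3 => v ord0 l) (fun t => t `^ b)).
  exact: coord_continuous.
exact: powR_continuous.
Qed.

Lemma pow_sum_continuous (b : R) (v : 'rV[R]_3) : (forall l, 0 < v ord0 l) ->
  {for v, continuous (fun v : 'rV[R]_3 => pow_sum b (v ord0))}.
Proof.
move=> v0; apply: (@sum_continuous (fun l (v : 'rV[R]_3) => v ord0 l `^ b)) => l.
exact: coord_powR_continuous.
Qed.

Lemma drift_sqr_continuous (p c b : R) (v : 'rV[R]_3) : (forall l, 0 < v ord0 l) ->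
  {for v, continuous (fun v : 'rV[R]_3 => \sum_j urn_drift p c b (v ord0) j ^+ 2)}.
Proof.
move=> v0; have S0 : 0 < pow_sum b (v ord0).
  by rewrite /pow_sum (bigD1 ord0)//= ltr_wpDr ?powR_gt0 ?sumr_ge0// => l _; exact: powR_ge0.
apply: (@sum_continuous (fun l (v : 'rV[R]_3) => urn_drift p c b (v ord0) l ^+ 2)) => l.
have hS : {for v, continuous (fun v : 'rV[R]_3 => (pow_sum b (v ord0))^-1)}.
  have S1 : pow_sum b (v ord0) != 0 by rewrite gt_eqF.
  have hp := @pow_sum_continuous b v v0.
  exact: (@continuousV _ _ (fun v : 'rV[R]_3 => pow_sum b (v ord0)) v S1 hp).
have hs : {for v, continuous (fun v : 'rV[R]_3 => share b (v ord0) l)}.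
  exact: (continuousM (@coord_powR_continuous b v l (v0 l)) hS).
have h : {for v, continuous (fun v : 'rV[R]_3 => urn_drift p c b (v ord0) l)}.
  exact: (continuousB (continuousD (@cst_continuous _ _ p v)
    (continuousM (@cst_continuous _ _ c v) hs)) (@coord_continuous R 1 3 ord0 l v)).
exact: (continuousM h h).
Qed.

Lemma potential_ln_continuous (p c b : R) (v : 'rV[R]_3) : (forall l, 0 < v ord0 l) ->
  {for v, continuous (fun v : 'rV[R]_3 =>
    p * (\sum_l ln (v ord0 l)) + c / b * ln (pow_sum b (v ord0)))}.
Proof.
move=> v0; have S0 : 0 < pow_sum b (v ord0).
  by rewrite /pow_sum (bigD1 ord0)//= ltr_wpDr ?powR_gt0 ?sumr_ge0// => l _; exact: powR_ge0.
have h1 : {for v, continuous (fun v : 'rV[R]_3 => \sum_l ln (v ord0 l))}.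
  apply: (@sum_continuous (fun l (v : 'rV[R]_3) => ln (v ord0 l))) => l.
  apply: (@continuous_comp _ _ _ (fun v : 'rV[R]_3 => v ord0 l) (@ln R)).
    exact: coord_continuous.
  exact: continuous_ln.
have h2 : {for v, continuous (fun v : 'rV[R]_3 => ln (pow_sum b (v ord0)))}.
  apply: (@continuous_comp _ _ _ (fun v : 'rV[R]_3 => pow_sum b (v ord0)) (@ln R)).
    exact: pow_sum_continuous.
  exact: continuous_ln.
exact: (continuousD (continuousM (@cst_continuous _ _ p v) h1)
  (continuousM (@cst_continuous _ _ (c / b) v) h2)).
Qed.

End Topology.

Lemma col_cvgP (R : realType) (f : nat -> 'cV[R]_3) (v : 'cV[R]_3) :
  (f n @[n --> \oo] --> v) <-> (forall l, f n l ord0 @[n --> \oo] --> v l ord0).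
Proof.
split=> [h l|h]; first exact: (cvg_comp _ _ h (@coord_continuous R 3 1 l ord0 v)).
apply/cvg_ballP => e e0.
have : \forall n \near \oo, forall l, ball (v l ord0) e (f n l ord0).
  by apply: filter_forall => l; have /cvg_ballP/(_ e e0) := h l.
by apply: filterS => n hn; split=> // l k; rewrite (ord1 k).
Qed.

Section Convergence.
Context {R : realType} {d : measure_display} {T : measurableType d}.
Variables (a b : R) (P : probability T R) (x0 : 'cV[nat]_3).
Variable x : nat -> T -> 'cV[nat]_3.
Hypothesis a0 : 0 < a.
Hypothesis b0 : 0 < b.
Hypothesis hx : urn_process (sym_mx a) b x0 P x.

Let p := urn_share a.
Let c := urn_gain a.
Let n0 := ball_count x0.
Let p0 : 0 < p. Proof. exact: urn_share_gt0. Qed.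
Let pc1 : 3 * p + c = 1. Proof. exact: urn_share_gain. Qed.

Lemma urn_converges_state (v : 'cV[R]_3) w : (forall n, level x0 n (x n w)) ->
  (forall l, state_prop (x n w) l @[n --> \oo] --> v l ord0) -> urn_converges x0 x v w.
Proof.
move=> lv h; apply/col_cvgP => l.
have -> : (fun n => proportions R x0 x n w l ord0) = (fun n => state_prop (x n w) l).
  by apply/funext => n; rewrite mxE /state_prop (lv n).
exact: h.
Qed.

Lemma measurable_urn_converges (v : 'cV[R]_3) : measurable (urn_converges x0 x v).
Proof.
have mx : forall n Y, measurable (x n @^-1` Y) by case: hx.
pose F l m n := x n @^-1` [set s | `|(s l ord0)%:R / (n + n0)%:R - v l ord0| <= m.+1%:R^-1].
have -> : urn_converges x0 x v =
    \bigcap_(l : 'I_3) \bigcap_m \bigcup_N \bigcap_k F l m (N + k)%N.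
  apply/seteqP; split=> w.
    move=> /col_cvgP h l _ m _.
    have m0 : 0 < m.+1%:R^-1 :> R by rewrite invr_gt0.
    have /cvgrPdist_le/(_ _ m0)[N _ hN] := h l.
    exists N => // k _; rewrite /F/= distrC.
    by have := hN (N + k)%N (leq_addr _ _); rewrite mxE.
  move=> h; apply/col_cvgP => l; apply/cvgrPdist_le => e e0.
  have [N _ hN] := h l I (Num.truncn e^-1) I.
  exists N => // n /= Nn; have := hN (n - N)%N I; rewrite /F/= subnKC// mxE distrC.
  move=> /le_trans; apply; rewrite -[leRHS]invrK lef_pV2 ?posrE ?invr_gt0//.
  exact/ltW/truncnS_gt.
apply: fin_bigcap_measurable => // l _; apply: bigcapT_measurable => m.
by apply: bigcupT_measurable => N; apply: bigcapT_measurable => k; exact: mx.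
Qed.

Lemma urn_limit_quad : 1 <= a \/ b <= 1 ->
  {ae P, forall w, urn_converges x0 x (barycenter R) w}.
Proof.
move=> hab; have h2 : 0 < 1 + 2 * a by move: a0; lra.
have hc : c <= 0 \/ c < 1 /\ b <= 1.
  case: hab => h; [left|right]; first by rewrite /c /urn_gain pmulr_lle0 ?invr_gt0//; lra.
  by split=> //; rewrite /c /urn_gain ltr_pdivrMr// mul1r; move: a0; lra.
have K0 : 0 < 2 * (1 - Num.max 0 c).
  rewrite mulr_gt0// subr_gt0; have [c0|c0] := leP c 0; first by [].
  by case: hc => [|[]]; move: c0; lra.
have := lyapunov_cvg0 a0 b0 hx
  (lyapunov_pair_quad p0 (urn_share_gain_gt0 a0) pc1 b0 hc).
apply: filterS2 (urn_path_ae a0 b0 hx) => w path cv.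
apply: urn_converges_state => [n|l]; first by case: (path n).
rewrite mxE; apply/cvgrPdist_lt => e e0.
have Ke : 0 < 2 * (1 - Num.max 0 c) * e ^+ 2 by rewrite mulr_gt0// exprn_gt0.
have /cvgr_lt /(_ _ Ke) := cv; apply: filterS => n.
rewrite ltr_pM2l// => h; rewrite distrC -(ltr_pXn2r (n := 2)) ?nnegrE ?(ltW e0)//.
apply: le_lt_trans h; rewrite -normrX ger0_norm ?sqr_ge0//.
by rewrite (bigD1 l)//= lerDl sumr_ge0// => k _; exact: sqr_ge0.
Qed.

Lemma state_step_cvg0 w : (forall n, level x0 n (x n w) /\
    exists i, x n.+1 w = add_ball (x n w) i) ->
  dist1 (state_prop (x n.+1 w)) (state_prop (x n w)) @[n --> \oo] --> (0 : R).
Proof.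
move=> path; apply: (@squeeze_cvgr _ _ _ _ (fun=> 0) (fun n => 3 * n.+1%:R^-1)).
- apply: nearW => n; rewrite dist1_ge0/=.
  have [lv [i ->]] := path n; have s0 := level_pos hx lv.
  rewrite (state_prop_add_ball _ s0); apply: dist1_le => l.
  apply: le_trans (simplex_step_dist _ _ (simplex3_state_prop s0) _) _ => //.
  by rewrite lef_pV2 ?posrE// ler_nat lv ltnS leq_addr.
- exact: cvg_cst.
- by rewrite -(mulr0 3); apply: cvgM; [exact: cvg_cst|exact: cvg_harmonic].
Qed.

Hypothesis a1 : a < 1.
Hypothesis b1 : 1 < b.

Let c0 : 0 < c. Proof. by rewrite /c divr_gt0//; move: a0 a1; lra. Qed.

(** Compactness is applied where all coordinates are at least [p / 2], so that all powers are
    continuous. A coordinate below [p / 2] has drift above [p / 2], which explains the bound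
    [(p / 2) ^ 2]. *)
Lemma drift_lb_away (rs : seq R) (e : R) : 0 < e ->
  (forall r, 0 < r -> equil_gap a b r = 0 -> r \in rs) ->
  exists2 dl, 0 < dl & forall y, simplex3 y -> \sum_l urn_drift p c b y l ^+ 2 < dl ->
    exists u : 'I_(size rs) * 'I_3, dist1 y (dom_fun rs`_u.1 u.2) < e.
Proof.
move=> e0 hrs.
pose C : set 'rV[R]_3 := [set v | (\bigcap_l [set v : 'rV[R]_3 | p / 2 <= v ord0 l]) v /\
  \sum_l v ord0 l = 1 /\
  (\bigcap_(u : 'I_(size rs) * 'I_3) [set v : 'rV[R]_3 | e <= dist1 (v ord0) (dom_fun rs`_u.1 u.2)]) v].
have clC : closed C.
  apply: closedI; last apply: closedI.
  - by apply: closed_bigI => l _; apply: closed_coord_ge; exact: coord_continuous.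
  - exact: closed_simplex3.
  - by apply: closed_bigI => u _; apply: closed_coord_ge; exact: dist1_continuous.
have p20 : 0 < p / 2 by rewrite divr_gt0.
have Cpos v : C v -> forall l, 0 < v ord0 l.
  by move=> [h _] l; exact: lt_le_trans (h l I).
have Cs v : C v -> simplex3 (v ord0).
  by move=> Cv; split; [move=> l; exact/ltW/Cpos|case: Cv => _ []].
have gpos v : C v -> 0 < \sum_l urn_drift p c b (v ord0) l ^+ 2.
  move=> Cv;rewrite lt_neqAle sumr_ge0 ?andbT => [|l _]; last exact: sqr_ge0.
  apply/eqP => /esym /eqP; rewrite psumr_eq0; last by move=> l _; exact: sqr_ge0.
  move=> /allP h; have {}h l : urn_drift p c b (v ord0) l = 0.
    by move/(_ l (mem_index_enum l)): h; rewrite /= sqrf_eq0 => /eqP.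
  have [r [i [r0 vE]]] := equil_dom_fun p0 c0 b1 (Cs v Cv) h.
  have gap0 : equil_gap a b r = 0.
    have r2 : 0 < 2 + r by move: r0; lra.
    have rb : 0 < r `^ b + 2 by rewrite ltr_wpDl// powR_ge0.
    have h2 : 0 < 1 + 2 * a by move: a0; lra.
    have := h i; rewrite vE urn_drift_dom_fun// eqxx => /eqP.
    by rewrite mulf_eq0 invr_eq0 !mulf_eq0 !(gt_eqF r2, gt_eqF rb, gt_eqF h2) !orbF pnatr_eq0/= => /eqP.
  have rrs := hrs _ r0 gap0.
  have hi : (index r rs < size rs)%N by rewrite index_mem.
  have [_ [_ /(_ (Ordinal hi, i) I)]] := Cv.
  rewrite /= nth_index// -vE /dist1 big1 ?leNgt ?e0// => l _.
  by rewrite subrr normr0.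
have [dl dl0 hdl] := @compact_pos_lb R C _ clC
  (fun v Cv l => introT andP (conj (ltW (Cpos v Cv l)) (simplex3_le1 l (Cs v Cv))))
  (fun v Cv => @drift_sqr_continuous _ p c b v (Cpos v Cv)) gpos.
exists (Num.min dl ((p / 2) ^+ 2)); first by rewrite lt_min dl0 exprn_gt0.
move=> y sy; rewrite lt_min => /andP[ydl yp]; apply: contrapT => /forallNP hn.
pose v : 'rV[R]_3 := \row_l y l; have vE : v ord0 = y by apply/funext => l; rewrite mxE.
have : C v; last by move=> /hdl; rewrite vE leNgt ydl.
split; [|split].
- move=> l _ /=; rewrite vE.
  have hl : `|urn_drift p c b y l| <= p / 2.
    rewrite -(ler_pXn2r (n := 2)) ?nnegrE ?(ltW p20)// -normrX ger0_norm ?sqr_ge0//.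
    apply: le_trans (ltW yp); rewrite (bigD1 l)//= lerDl sumr_ge0// => k _; exact: sqr_ge0.
  have : p <= urn_prob p c b y l by rewrite lerDl mulr_ge0 ?share_ge0// ltW.
  by move: hl; rewrite ler_norml /urn_drift => /andP[_]; lra.
- by rewrite vE; case: sy.
- by move=> u _ /=; rewrite vE leNgt; apply/negP/hn.
Qed.

Lemma urn_limit_ae (rs : seq R) :
  (forall r, 0 < r -> equil_gap a b r = 0 -> r \in rs) ->
  {ae P, forall w, exists r i, r \in rs /\
    forall l, state_prop (x n w) l @[n --> \oo] --> dom_fun r i l}.
Proof.
move=> hrs.
have := lyapunov_cvg0 a0 b0 hx (lyapunov_pair_potential p0 (ltW c0) pc1 b1).
apply: filterS2 (urn_path_ae a0 b0 hx) => w path cv.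
have [|u hu] := @finite_limit R ('I_(size rs) * 'I_3)%type
  (fun u => dom_fun rs`_u.1 u.2) (fun n => state_prop (x n w)) (state_step_cvg0 path).
  move=> e e0; have [dl dl0 hdl] := drift_lb_away e0 hrs.
  have /cvgr_lt /(_ _ dl0) := cv; apply: filterS => n; apply: hdl; apply: simplex3_state_prop.
  by apply: (level_pos hx (n := n)); case: (path n).
exists rs`_u.1, u.2; split=> //; exact: mem_nth.
Qed.

End Convergence.

(** * Limits of positive probability *)

Section PositiveLimit.
Context {R : realType} {d : measure_display} {T : measurableType d}.
Variables (a b : R) (P : probability T R) (x0 : 'cV[nat]_3).
Variable x : nat -> T -> 'cV[nat]_3.
Hypothesis a0 : 0 < a.
Hypothesis a1 : a < 1.
Hypothesis b1 : 1 < b.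
Hypothesis hx : urn_process (sym_mx a) b x0 P x.

Let p := urn_share a.
Let c := urn_gain a.
Let n0 := ball_count x0.

Let b0 : 0 < b. Proof. by move: b1; lra. Qed.
Let p0 : 0 < p. Proof. exact: urn_share_gt0. Qed.
Let c0 : 0 < c. Proof. by rewrite /c divr_gt0//; move: a0 a1; lra. Qed.
Let pc1 : 3 * p + c = 1. Proof. exact: urn_share_gain. Qed.
Let n0_gt0 : (0 < n0)%N. Proof. by case: hx. Qed.

(** Two counts are rounded down and the third colour takes the rest, so each is off by at most 2.
    [K] makes this error small against [dl] and leaves room for the initial balls. *)
Lemma state_near (z : 'I_3 -> R) (dl : R) : (forall l, 0 < z l) -> \sum_l z l = 1 ->
  0 < dl -> exists M, forall N, (M <= N)%N -> exists s, [/\ level x0 N s,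
    forall l, (x0 l ord0 <= s l ord0)%N & forall l, `|state_prop s l - z l| <= dl].
Proof.
move=> z0 z1 dl0; pose K := 2 / dl + \sum_l (n0%:R + 2) / z l.
have q0 : 0 <= n0%:R + 2 :> R by rewrite addr_ge0.
exists (Num.truncn K).+1 => N hN; set t := (N + n0)%N.
have Kt : K <= t%:R.
  by apply: le_trans (ltW (truncnS_gt _)) _; rewrite ler_nat (leq_trans hN)// leq_addr.
have t0 : 0 < t%:R :> R by rewrite ltr0n addn_gt0 n0_gt0 orbT.
have h1 : 2 / t%:R <= dl.
  rewrite ler_pdivrMr// -ler_pdivrMl// mulrC; apply: le_trans Kt.
  by rewrite lerDl sumr_ge0// => l _; rewrite divr_ge0// ltW.
have h2 l : n0%:R + 2 <= z l * t%:R.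
  rewrite mulrC -ler_pdivrMr//; apply: le_trans Kt.
  rewrite /K (bigD1 l)//= [leRHS]addrCA lerDl addr_ge0 ?sumr_ge0//; first by rewrite divr_ge0 ?ltW.
  by move=> k _; rewrite divr_ge0// ltW.
have [j [k [ij ik jk]]] := ord3_compl ord0; set i := ord0 in ij ik.
pose f l := Num.truncn (z l * t%:R).
have fb l : (f l)%:R <= z l * t%:R < (f l)%:R + 1.
  by rewrite natr1 truncn_itv// mulr_ge0 ?ltW.
have zs : z i + z j + z k = 1 by rewrite -z1; symmetry; exact: sum3.
have fle : (f j + f k <= t)%N.
  rewrite -(ler_nat R) natrD.
  have : z i * t%:R + z j * t%:R + z k * t%:R = t%:R by rewrite -!mulrDl zs mul1r.
  have /andP[? ?] := fb j; have /andP[? ?] := fb k.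
  have := mulr_ge0 (ltW (z0 i)) (ltW t0); lra.
pose s : 'cV[nat]_3 := \col_l if l == i then (t - (f j + f k))%N else f l.
have si : s i ord0 = (t - (f j + f k))%N by rewrite mxE eqxx.
have sj : s j ord0 = f j by rewrite mxE eq_sym (negPf ij).
have sk : s k ord0 = f k by rewrite mxE eq_sym (negPf ik).
have ls : level x0 N s.
  rewrite /level/= /ball_count (sum3 _ ij ik jk) si sj sk.
  by rewrite -[LHS]/(t - (f j + f k) + f j + f k)%N -addnA subnK.
have near l : z l * t%:R - 2 <= (s l ord0)%:R <= z l * t%:R + 2.
  case: (ord3_cases l ij ik jk) => ->; rewrite ?si ?sj ?sk.
  - rewrite natrB// natrD.
    have : z i * t%:R + z j * t%:R + z k * t%:R = t%:R by rewrite -!mulrDl zs mul1r.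
    by have /andP[? ?] := fb j; have /andP[? ?] := fb k; move=> ?; apply/andP; split; lra.
  - by have /andP[? ?] := fb j; apply/andP; split; lra.
  - by have /andP[? ?] := fb k; apply/andP; split; lra.
exists s; split=> // l.
  apply: (@leq_trans n0); first by rewrite /n0 /ball_count (bigD1 l)//= leq_addr.
  by rewrite -(ler_nat R); have /andP[h _] := near l; have := h2 l; move: h; lra.
apply: le_trans h1; rewrite /state_prop ls -/n0 -/t.
have -> : (s l ord0)%:R / t%:R - z l = ((s l ord0)%:R - z l * t%:R) / t%:R.
  by rewrite mulrBl mulfK// gt_eqF.
rewrite normrM normfV (gtr0_norm t0) ler_wpM2r ?invr_ge0 ?(ltW t0)//.
by rewrite ler_norml; have /andP[? ?] := near l; apply/andP; split; lra.
Qed.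

(** A step of size at most [rho] out of the box lands in a shell between [rho] and [2 * rho]. There
    the potential is below its maximum by some [eps], while a late and close start can lose less
    than [eps]. *)
Lemma stay_near_positive (z : 'I_3 -> R) (rho : R) : 0 < rho -> simplex3 z ->
  (forall y, simplex3 y -> (forall l, `|y l - z l| <= 2 * rho) ->
    (forall l, p / 2 <= y l) /\
    (y <> z -> urn_potential p c b y < urn_potential p c b z)) ->
  exists N, (0 < P [set w | forall k, near_states x0 z rho (N + k) (x (N + k)%N w)])%E.
Proof.
move=> rho0 sz hmax; have p20 : 0 < p / 2 by rewrite divr_gt0.
pose Q (v : 'rV[R]_3) : R := p * (\sum_l ln (v ord0 l)) + c / b * ln (pow_sum b (v ord0)).
pose row y : 'rV[R]_3 := \row_l (y l).
have rowE y : row y ord0 = y by apply/funext => l; rewrite mxE.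
have QE y : (forall l, p / 2 <= y l) -> urn_potential p c b y = Q (row y).
  by move=> hy; rewrite urn_potential_ln// /Q rowE.
have zb l : `|z l - z l| <= 2 * rho by rewrite subrr normr0 mulr_ge0// ltW.
have zp2 : forall l, p / 2 <= z l by case: (hmax z sz zb).
have zpos l : 0 < z l by exact: lt_le_trans (zp2 l).
(* The shell; upper bounds are written with opposite signs so that [closed_coord_ge] covers all
   conditions. *)
pose C : set 'rV[R]_3 := [set v | (\bigcap_l [set v : 'rV[R]_3 | p / 2 <= v ord0 l]) v /\
  \sum_l v ord0 l = 1 /\ rho <= dist1 (v ord0) z /\
  (\bigcap_l [set v : 'rV[R]_3 | z l - 2 * rho <= v ord0 l]) v /\
  (\bigcap_l [set v : 'rV[R]_3 | - (z l + 2 * rho) <= - v ord0 l]) v].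
have cc l : continuous (fun v : 'rV[R]_3 => v ord0 l) by exact: coord_continuous.
have clC : closed C.
  apply: closedI; last apply: closedI; last apply: closedI; last apply: closedI.
  - by apply: closed_bigI => l _; exact: closed_coord_ge.
  - exact: closed_simplex3.
  - by apply: closed_coord_ge; exact: dist1_continuous.
  - by apply: closed_bigI => l _; exact: closed_coord_ge.
  - by apply: closed_bigI => l _; apply: closed_coord_ge => v; exact: (continuousN (cc l v)).
have Cpos v : C v -> forall l, 0 < v ord0 l.
  by move=> [h _] l; exact: lt_le_trans (h l I).
have Cs v : C v -> simplex3 (v ord0).
  by move=> Cv; split; [move=> l; exact/ltW/Cpos|case: Cv => _ []].
have Ccont v : C v -> {for v, continuous (fun v => Q (row z) - Q v)}.
  move=> Cv; exact: (continuousB (@cst_continuous _ _ (Q (row z)) v)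
    (@potential_ln_continuous _ p c b v (Cpos v Cv))).
have Cgt v : C v -> 0 < Q (row z) - Q v.
  move=> Cv; case: (Cv) => _ [_ [hd [h1 h2]]].
  have [|hp /(_ _)] := hmax _ (Cs v Cv).
    move=> l; have := h1 l I; have := h2 l I; rewrite /= ler_norml => *.
    by apply/andP; split; lra.
  rewrite subr_gt0 !QE// (_ : row (v ord0) = v); last by apply/rowP => l; rewrite mxE.
  apply=> E; move: hd; rewrite E /dist1 big1 ?leNgt ?rho0// => l _.
  by rewrite subrr normr0.
have [eps e0 heps] := @compact_pos_lb R C _ clC
  (fun v Cv l => introT andP (conj (ltW (Cpos v Cv l)) (simplex3_le1 l (Cs v Cv)))) Ccont Cgt.
have e20 : 0 < eps / 2 by rewrite divr_gt0.
have [dl dl0 hdl] : exists2 dl, 0 < dl & forall y, (forall l, `|y l - z l| <= dl) ->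
    Q (row z) - Q (row y) < eps / 2.
  have zr l : 0 < row z ord0 l by rewrite mxE.
  have := @potential_ln_continuous _ p c b (row z) zr.
  move=> /cvgrPdist_lt/(_ _ e20)/nbhs_ballP[dl /= dl0 hdl].
  exists (dl / 2); first by rewrite divr_gt0.
  move=> y hy; have : ball (row z) dl (row y).
    split=> // i l; rewrite -ball_normE/= !mxE distrC.
    by apply: le_lt_trans (hy l) _; move: dl0; lra.
  by move=> /hdl /=; apply: le_lt_trans; exact: ler_norm.
have [C' [g0 [M [C0 /andP[g00 g01] _ hdrift _]]]] := lyapunov_pair_potential p0 (ltW c0) pc1 b1.
have md0 : 0 < Num.min dl rho by rewrite lt_min dl0.
have [N1 hN1] := state_near zpos sz.2 md0.
(* The demands on the starting time: total error below [eps / 2], steps at most [g0] and at most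
   [rho]. *)
pose K := C' / (eps / 2) + g0^-1 + rho^-1.
have K1 : 0 <= C' / (eps / 2) by rewrite divr_ge0 ?(ltW e20).
have K2 : 0 < g0^-1 by rewrite invr_gt0.
have K3 : 0 < rho^-1 by rewrite invr_gt0.
pose N := maxn N1 (Num.truncn K).+1.
have KN : K < N%:R by apply: lt_le_trans (truncnS_gt _) _; rewrite ler_nat leq_maxr.
have Kt k : K < (N + n0 + k)%:R.
  by apply: lt_le_trans KN _; rewrite ler_nat -addnA leq_addr.
have invle k (u : R) : 0 < u -> u^-1 <= K -> (N + n0 + k).+1%:R^-1 <= u.
  move=> u0 uK; rewrite -[leRHS]invrK lef_pV2 ?posrE ?invr_gt0//.
  by apply: (le_trans uK); apply: ltW; apply: lt_le_trans (Kt k) _; rewrite ler_nat.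
have ip k : 0 < (N + n0 + k).+1%:R^-1 :> R by rewrite invr_gt0 ltr0n.
have gk k : (N + n0 + k).+1%:R^-1 <= g0 by apply: invle => //; rewrite /K; lra.
have rk k : (N + n0 + k).+1%:R^-1 <= rho by apply: invle => //; rewrite /K; lra.
have [s0 [ls0 xs0 hs0]] := hN1 N (leq_maxl _ _).
have Us0 : near_states x0 z rho N s0.
  by split=> // l; apply: le_trans (hs0 l) _; rewrite ge_min lexx orbT.
pose V s := urn_potential p c b z - urn_potential p c b (state_prop s).
have box s n : near_states x0 z rho n s -> (forall l, p / 2 <= state_prop s l) /\
    (state_prop s <> z -> urn_potential p c b (state_prop s) < urn_potential p c b z).
  move=> [ls hs]; apply: hmax; first exact: simplex3_state_prop (level_pos hx ls).
  by move=> l; apply: le_trans (hs l) _; rewrite ler_peMl ?(ltW rho0)//; lra.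
exists N; apply: (stay_positive a0 b0 hx (@near_states_level _ _ _ _) C0 e0 Us0 _ (V := V)).
- exact: (reach_gt0 a0 b0 hx).
- move=> k s Us; rewrite subr_ge0; have [_ h] := box _ _ Us.
  by have [->//|/eqP/h/ltW] := eqVneq (state_prop s) z.
- move=> k s i Us nU; have [ls hs] := Us; have s1 := level_pos hx ls.
  have ls' : level x0 (N + k.+1) (add_ball s i) by rewrite addnS; exact: level_add_ball.
  have sy := simplex3_state_prop (R := R) (level_pos hx ls').
  set y := state_prop (add_ball s i) in sy *.
  have yb l : `|y l - z l| <= 2 * rho.
    rewrite -[y l - z l](subrKA (state_prop s l)) mulr2n mulrDl mul1r.
    apply: le_trans (ler_normD _ _) _; apply: lerD; last exact: hs.
    rewrite /y state_prop_add_ball//; apply: le_trans (simplex_step_dist _ _ _ _) _ => //.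
      exact: simplex3_state_prop.
    by rewrite ls -/n0 addnAC; exact: rk.
  have [yp _] := hmax y sy yb.
  have far : rho <= dist1 y z.
    rewrite leNgt; apply/negP => h; apply: nU; split=> // l.
    exact: le_trans (dist1_coord _ _ l) (ltW h).
  have Cy : C (row y).
    split; [|split; [|split; [|split]]]; rewrite ?rowE//.
    - by move=> l _ /=; rewrite rowE.
    - by case: sy.
    - by move=> l _ /=; have := yb l; rewrite rowE ler_norml => /andP[]; lra.
    - by move=> l _ /=; have := yb l; rewrite rowE ler_norml => /andP[]; lra.
  by have := heps _ Cy; rewrite /V !QE.
- move=> k s Us; have [ls hs] := Us; have s1 := level_pos hx ls.
  have -> : step_mean (urn_pr a b) V s = urn_potential p c b z -
      step_mean (urn_pr a b) (fun s' => urn_potential p c b (state_prop s')) s.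
    rewrite -[X in X - _]mulr1 -(urn_pr_sum1 a0 b0 s1) mulr_sumr -sumrB.
    by apply: eq_bigr => i _; rewrite /V mulrBr [urn_potential _ _ _ _ * _]mulrC.
  rewrite (step_mean_urn a0 b0)// ls -/n0 -/p -/c (_ : (N + k + n0) = (N + n0 + k))%N; last exact: addnAC.
  have gb : (0 : R) <= (N + n0 + k).+1%:R^-1 <= g0.
    by apply/andP; split; [exact/ltW/ip|exact: gk].
  have := hdrift _ _ (simplex3_state_prop s1) gb.
  have : 0 <= (N + n0 + k).+1%:R^-1 * \sum_j urn_drift p c b (state_prop s) j ^+ 2.
    by rewrite mulr_ge0 ?(ltW (ip k))// sumr_ge0// => l _; exact: sqr_ge0.
  move: (_ * \sum_j _) => u u0 h.
  apply: (le_trans (lerB (lexx _) h)).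
  rewrite -subr_ge0 (_ : _ - _ = u)//; last by rewrite /V; ring.
have [hp _] := box _ _ Us0.
have h1 : V s0 < eps / 2.
  rewrite /V !QE//; apply: hdl => l; apply: le_trans (hs0 l) _.
  by rewrite ge_min lexx.
have h2 : C' / (N + n0)%:R < eps / 2.
  have t0 : 0 < (N + n0)%:R :> R by rewrite ltr0n addn_gt0 n0_gt0 orbT.
  rewrite ltr_pdivrMr// mulrC -ltr_pdivrMr//.
  by have := Kt 0%N; rewrite addn0 /K; lra.
by move: h1 h2; lra.
Qed.

(** With positive probability the path stays in the box, and almost surely it converges to an
    equilibrium. As [rho <= sg / 4], the box contains no equilibrium other than the target. *)
Lemma limit_positive (rs : seq R) (r e : R) (i : 'I_3) (v : 'cV[R]_3) :
  (forall r, 0 < r -> equil_gap a b r = 0 -> r \in rs) -> r \in rs ->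
  0 < r -> equil_gap a b r = 0 ->
  (forall j, i != j -> c * b * share b (dom_fun r i) j < dom_fun r i j) ->
  0 < e ->
  (forall t, r - e < t -> t < r -> 0 < equil_gap a b t) ->
  (forall t, r < t -> t < r + e -> equil_gap a b t < 0) ->
  (forall l, v l ord0 = dom_fun r i l) ->
  (0 < P (urn_converges x0 x v))%E.
Proof.
move=> hrs rrs r0 gap0 hst e0 hlo hhi vE.
have drift0 l : urn_drift p c b (dom_fun r i) l = 0.
  by have := @urn_drift_dom_fun R a b r i l a0 r0; rewrite gap0 mulr0 mul0r; exact.
have [rho1 rho10 hmax] := urn_potential_strict_max a0 a1 b1 r0 drift0 hst e0 hlo hhi.
have [sg s0 hsep] := finite_dist1_sep
  (fun u : 'I_(size rs) * 'I_3 => dom_fun rs`_u.1 u.2).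
pose rho := Num.min (rho1 / 2) (sg / 4).
have rho0 : 0 < rho by rewrite lt_min !divr_gt0.
have [rh1 rh2] : rho <= rho1 / 2 /\ rho <= sg / 4 by rewrite /rho !ge_min !lexx orbT.
have hmax' y : simplex3 y -> (forall l, `|y l - dom_fun r i l| <= 2 * rho) ->
    (forall l, p / 2 <= y l) /\
    (y <> dom_fun r i -> urn_potential p c b y < urn_potential p c b (dom_fun r i)).
  by move=> sy hy; apply: hmax => // l; apply: le_trans (hy l) _; move: rh1; lra.
have [N hN] := stay_near_positive rho0 (dom_fun_simplex i r0) hmax'.
set D := [set w | _] in hN.
have mD : measurable D by exact: (measurable_stay_forever hx).
have mv : measurable (urn_converges x0 x v) by exact: (measurable_urn_converges hx).
rewrite lt_neqAle measure_ge0 andbT; apply/negP => /eqP v0.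
suff PD : P D = 0%E by rewrite PD ltxx in hN.
apply/negligibleP => //.
have nv : {ae P, forall w, ~ urn_converges x0 x v w}.
  exists (urn_converges x0 x v); split=> //; move=> w /= /contrapT //.
have : {ae P, forall w, ~ D w}; last first.
  by apply: negligibleS => w /= Dw nD; exact: nD.
have lim := urn_limit_ae a0 b0 hx a1 b1 hrs.
apply: filterS2 (urn_path_ae a0 b0 hx) (filterI lim nv) => w path [[r' [i' [r'rs cv]]] ncv] Dw.
apply: ncv; apply: urn_converges_state => [n|l]; first by case: (path n).
rewrite vE; suff -> : dom_fun r i = dom_fun r' i' by exact: cv.
have ir : (index r rs < size rs)%N by rewrite index_mem.
have ir' : (index r' rs < size rs)%N by rewrite index_mem.
have := hsep (Ordinal ir, i) (Ordinal ir', i'); rewrite /= !nth_index//; apply.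
have h k : `|dom_fun r i k - dom_fun r' i' k| <= rho.
  have cvk : `|dom_fun r i k - state_prop (x n w) k| @[n --> \oo] -->
      `|dom_fun r i k - dom_fun r' i' k|.
    by apply: cvg_norm; apply: cvgB; [exact: cvg_cst|exact: cv].
  rewrite -(cvg_lim _ cvk)//; apply: limr_le; first by apply/cvg_ex; eexists; exact: cvk.
  exists N => // n /= Nn; have [_ /(_ k)] := Dw (n - N)%N.
  by rewrite subnKC// distrC.
by apply: le_lt_trans (dist1_le h) _; move: rh2 s0; lra.
Qed.

End PositiveLimit.

(** * The three phases *)

Lemma equil_phase_fun (R : realType) (a b r : R) : 0 < a -> a < 1 -> 0 < r ->
  equil_gap a b r = 0 -> [/\ phase_dom a r, a * r < 1 & phase_fun a b r = 0].
Proof.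
move=> a0 a1 r0 gap0; have dr := phase_dom_equil a0 a1 r0 gap0.
split=> //; first by case/andP: dr.
by apply/eqP; rewrite phase_fun_equil_gap// gap0.
Qed.

Lemma equil_subcritical (R : realType) (a b r : R) : 0 < a -> a < 1 -> b < beta_crit a ->
  0 < r -> equil_gap a b r = 0 -> r = 1.
Proof.
move=> a0 a1 hb r0 gap0; have [dr ar f0] := equil_phase_fun a0 a1 r0 gap0.
apply/eqP; rewrite eq_le !leNgt; apply/andP; split; apply/negP => r1.
  have lr : 0 < ln r by rewrite ln_gt0.
  have := lt_le_trans hb (beta_crit_le a0 a1 r1 ar); rewrite ltr_pdivlMr//.
  by move: f0 => /eqP; rewrite subr_eq0 => /eqP ->; rewrite ltxx.
have := phase_fun_lt1 a0 a1 (ltW (lt_trans hb (beta_crit_ub a0 a1))) dr r1.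
by rewrite f0 ltxx.
Qed.

Section Limits.
Context {R : realType} {d : measure_display} {T : measurableType d}.
Variables (a b : R) (P : probability T R) (x0 : 'cV[nat]_3).
Variable x : nat -> T -> 'cV[nat]_3.
Hypothesis a0 : 0 < a.
Hypothesis a1 : a < 1.
Hypothesis hx : urn_process (sym_mx a) b x0 P x.

Let barycenterE i l : barycenter R l ord0 = dom_fun 1 i l.
Proof. by rewrite mxE /dom_fun if_same; congr (1 / _); lra. Qed.

Let dominant_ptE (r : R) i l : dominant_pt r i l ord0 = dom_fun r i l.
Proof. by rewrite mxE. Qed.

Lemma subcritical_limit : 0 < b -> b < beta_crit a ->
  {ae P, forall w, urn_converges x0 x (barycenter R) w}.
Proof.
move=> b0 hb; have [b1|b1] := leP b 1.
  by apply: (urn_limit_quad a0 b0 hx); right.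
have h (r : R) : 0 < r -> equil_gap a b r = 0 -> r \in [:: 1].
  by move=> r0 gap0; rewrite inE; exact/eqP/(equil_subcritical a0 a1 hb).
apply: filterS2 (urn_path_ae a0 b0 hx) (urn_limit_ae a0 b0 hx a1 b1 h).
move=> w path [r [i [+ cv]]]; rewrite inE => /eqP rE.
apply: (urn_converges_state (x := x)) => [n|l]; first by case: (path n).
by rewrite (barycenterE i) -rE.
Qed.

Lemma supercritical_limit (rp : R) : (1 + 2 * a) / (1 - a) < b -> 1 < rp ->
  (forall r, 1 < r -> r < rp -> phase_fun a b r < 0) ->
  (forall r, rp < r -> a * r < 1 -> 0 < phase_fun a b r) ->
  {ae P, forall w, exists i, urn_converges x0 x (dominant_pt rp i) w}.
Proof.
move=> hb rp1 hlo hhi.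
have b1 : 1 < b.
  by apply: lt_trans hb; rewrite ltr_pdivlMr ?subr_gt0// mul1r; move: a0; lra.
have b0 : 0 < b by move: b1; lra.
have [rs [hrs rsE]] : exists rs : seq R,
    (forall r, 0 < r -> equil_gap a b r = 0 -> r \in rs) /\
    forall r, r \in rs -> [\/ r = 1, r = rp | [/\ 0 < r, r < 1 & equil_gap a b r = 0]].
  have cases r : 0 < r -> equil_gap a b r = 0 -> 1 <= r -> r \in [:: 1; rp].
    move=> r0 gap0; have [dr ar f0] := equil_phase_fun a0 a1 r0 gap0.
    rewrite le_eqVlt => /predU1P[<-|r1]; first by rewrite inE eqxx.
    rewrite !inE; apply/orP; right; rewrite eq_le !leNgt; apply/andP.
    split; apply/negP => h; first by have := hhi _ h ar; rewrite f0 ltxx.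
    by have := hlo _ r1 h; rewrite f0 ltxx.
  (* Zeros below 1 are treated by cases: if there is one, it is unique by [phase_roots_lo] and
     repelling. *)
  have [[rm [m0 m1 mgap]]|hn] := pselect (exists r, [/\ 0 < r, r < 1 & equil_gap a b r = 0]).
    exists [:: rm; 1; rp]; split=> [r r0 gap0|r].
      have [r1|r1] := leP 1 r; first by rewrite inE cases ?orbT.
      have [dr _ f0] := equil_phase_fun a0 a1 r0 gap0.
      have [dm _ fm] := equil_phase_fun a0 a1 m0 mgap.
      by rewrite (phase_roots_lo a0 a1 hb dr dm r1 m1 f0 fm) inE eqxx.
    by rewrite !inE => /or3P[/eqP->|/eqP->|/eqP->]; [constructor 3|constructor 1|constructor 2].
  exists [:: 1; rp]; split=> [r r0 gap0|r].
    have [r1|r1] := leP 1 r; first exact: cases.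
    by exfalso; apply: hn; exists r.
  by rewrite !inE => /orP[/eqP->|/eqP->]; [constructor 1|constructor 2].
have no1 : {ae P, forall w, forall i, ~ (forall l, state_prop (x n w) l @[n --> \oo] --> dom_fun (1 : R) i l)}.
  by apply: filter_forall => i; exact: (barycenter_no_limit a0 a1 b1 hx).
have nom : {ae P, forall w, forall u : 'I_(size rs) * 'I_3, 0 < rs`_u.1 < 1 ->
    equil_gap a b rs`_u.1 = 0 ->
    ~ (forall l, state_prop (x n w) l @[n --> \oo] --> dom_fun rs`_u.1 u.2 l)}.
  apply: filter_forall => u.
  have [[/andP[r0 r1] gap0]|hn] := pselect (0 < rs`_u.1 < 1 /\ equil_gap a b rs`_u.1 = 0).
    by have := minor_no_limit a0 a1 b1 hx u.2 r0 r1 gap0; apply: filterS.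
  by apply: nearW => w h1 h2; exfalso; exact: hn.
have lim := urn_limit_ae a0 b0 hx a1 b1 hrs.
apply: filterS2 (filterI (urn_path_ae a0 b0 hx) lim) (filterI no1 nom).
move=> w [path [r [i [rrs cv]]]] [n1 nm]; exists i.
apply: (urn_converges_state (x := x)) => [n|l]; first by case: (path n).
rewrite dominant_ptE; case: (rsE r rrs) => [rE|<-|[r0 r1 gap0]].
- by exfalso; apply: (n1 i); rewrite -rE.
- exact: cv.
have ir : (index r rs < size rs)%N by rewrite index_mem.
have := nm (Ordinal ir, i); rewrite /= nth_index// r0 r1 => h.
by exfalso; exact: h.
Qed.

Variables (r1 r2 : R).
Hypothesis hb1 : beta_crit a < b.
Hypothesis hb2 : b < (1 + 2 * a) / (1 - a).
Hypothesis r11 : 1 < r1.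
Hypothesis r12 : r1 < r2.
Hypothesis ar2 : a * r2 < 1.
Hypothesis fr1 : phase_fun a b r1 = 0.
Hypothesis fr2 : phase_fun a b r2 = 0.
Hypothesis hf1 : forall r, 1 < r -> r < r1 -> 0 < phase_fun a b r.
Hypothesis hf2 : forall r, r1 < r -> r < r2 -> phase_fun a b r < 0.
Hypothesis hf3 : forall r, r2 < r -> a * r < 1 -> 0 < phase_fun a b r.

Let b1 : 1 < b.
Proof.
apply: lt_trans hb1; apply: lt_le_trans (beta_crit_lb a0 a1).
by rewrite invf_gt1 ?subr_gt0// ltrBlDr ltrDl.
Qed.

Let b0 : 0 < b. Proof. by move: b1; lra. Qed.

Let r21 : 1 < r2. Proof. exact: lt_trans r12. Qed.

Let dom_gt1 t : 1 <= t -> a * t < 1 -> phase_dom a t.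
Proof. exact: phase_domW. Qed.

Let equil_mid r : 0 < r -> equil_gap a b r = 0 -> r \in [:: 1; r1; r2].
Proof.
move=> r0 gap0; have [dr ar f0] := equil_phase_fun a0 a1 r0 gap0.
rewrite !inE; have [rlt|rgt|->] := ltgtP r 1; last by [].
  by have := phase_fun_lt1 a0 a1 (ltW hb2) dr rlt; rewrite f0 ltxx.
have [rlt1|rgt1|->] := ltgtP r r1; last by rewrite orbT.
  by have := hf1 rgt rlt1; rewrite f0 ltxx.
have [rlt2|rgt2|//] := ltgtP r r2.
  by have := hf2 rgt1 rlt2; rewrite f0 ltxx.
by have := hf3 rgt2 ar; rewrite f0 ltxx.
Qed.

Lemma critical_limit : 0 < phase_quad a b r1 ->
  {ae P, forall w, urn_converges x0 x (barycenter R) w \/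
    exists i, urn_converges x0 x (dominant_pt r2 i) w}.
Proof.
move=> hq; have gap1 : equil_gap a b r1 = 0.
  apply/eqP; rewrite -phase_fun_equil_gap ?fr1//; apply: dom_gt1; first exact: ltW.
  by apply: lt_trans ar2; rewrite ltr_pM2l.
have no1 : {ae P, forall w, forall i, ~ (forall l, state_prop (x n w) l @[n --> \oo] --> dom_fun r1 i l)}.
  by apply: filter_forall => i; exact: (saddle_no_limit a0 a1 b1 hx).
have lim := urn_limit_ae a0 b0 hx a1 b1 equil_mid.
apply: filterS2 (filterI (urn_path_ae a0 b0 hx) lim) no1.
move=> w [path [r [i [+ cv]]]] n1; rewrite !inE => /or3P[/eqP rE|/eqP rE|/eqP rE].
- left; apply: (urn_converges_state (x := x)) => [n|l]; first by case: (path n).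
  by rewrite (barycenterE i) -rE.
- by exfalso; apply: (n1 i); rewrite -rE.
- right; exists i; apply: (urn_converges_state (x := x)) => [n|l]; first by case: (path n).
  by rewrite dominant_ptE -rE.
Qed.

Lemma critical_barycenter : (0 < P (urn_converges x0 x (barycenter R)))%E.
Proof.
have a1' : 0 < 1 - a by rewrite subr_gt0.
have h2 : 0 < 1 + 2 * a by move: a0; lra.
have ha : 0 < 1 + a by rewrite addr_gt0.
(* Left of 1 [phase_dom] ends at [2 a / (1 + a)], at distance [(1 - a) / (1 + a)]; right of 1 the
   sign of [phase_fun] holds up to [r1]. *)
pose e := Num.min ((1 - a) / (1 + a)) (r1 - 1).
have gap0 : equil_gap a b 1 = 0.
  by apply/eqP; rewrite -phase_fun_equil_gap ?phase_fun1// dom_gt1 ?mulr1.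
apply: (limit_positive a0 a1 b1 hx (r := 1) (e := e) (i := ord0) equil_mid) => //.
- by rewrite inE eqxx.
- move=> j _; rewrite share_dom_fun// powR1 !if_same /dom_fun if_same.
  rewrite (_ : 1 + 2 = 2 + 1 :> R) ?mul1r; last by rewrite addrC.
  rewrite gtr_pMl ?invr_gt0 ?addr_gt0// /urn_gain mulrAC ltr_pdivrMr// mul1r.
  by rewrite [ltLHS]mulrC -ltr_pdivlMr.
- by rewrite lt_min subr_gt0 r11 divr_gt0.
- move=> t; rewrite ltrBlDr -ltrBlDl /e lt_min => /andP[+ _] t1.
  rewrite ltr_pdivlMr// => ht.
  have dt : phase_dom a t.
    apply/andP; split; first by move: ht; lra.
    by apply: lt_trans a1; rewrite gtr_pMr.
  by rewrite -phase_fun_equil_gap// phase_fun_lt1// ltW.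
- move=> t t1; rewrite -ltrBlDl /e lt_min => /andP[_]; rewrite ltrBlDr subrK => tr.
  rewrite -phase_fun_equil_gap//; first exact: hf1.
  apply: dom_gt1; first exact: ltW.
  by apply: lt_trans ar2; rewrite ltr_pM2l// (lt_trans tr).
Qed.

Lemma critical_dominant i : (0 < P (urn_converges x0 x (dominant_pt r2 i)))%E.
Proof.
have r20 : 0 < r2 by apply: lt_trans r21.
have gap0 : equil_gap a b r2 = 0.
  by apply/eqP; rewrite -phase_fun_equil_gap ?fr2// dom_gt1// ltW.
(* The sign of [phase_fun] is known from [r1] to [r2] and from [r2] to the pole [1 / a]. *)
pose e := Num.min (r2 - r1) (a^-1 - r2).
have c0 : 0 < urn_gain a by rewrite divr_gt0 ?subr_gt0// addr_gt0// mulr_gt0.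
apply: (limit_positive a0 a1 b1 hx (r := r2) (e := e) (i := i) equil_mid) => //.
- by rewrite !inE eqxx !orbT.
- move=> j ij; apply: (equil_minor_stable (p := urn_share a)) => // l.
  by have := @urn_drift_dom_fun R a b r2 i l a0 r20; rewrite gap0 mulr0 mul0r; exact.
- by rewrite lt_min !subr_gt0 r12 -[a^-1]mul1r ltr_pdivlMr// mulrC.
- move=> t; rewrite ltrBlDr -ltrBlDl /e lt_min ltrBDr => /andP[ht _] tr.
  have rt : r1 < t by move: ht; lra.
  rewrite -phase_fun_equil_gap//; first exact: hf2.
  apply: dom_gt1; first by apply/ltW/(lt_trans r11).
  by apply: lt_trans ar2; rewrite ltr_pM2l.
- move=> t rt; rewrite -ltrBlDl /e lt_min => /andP[_]; rewrite ltrBlDr subrK => ta.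
  have at1 : a * t < 1 by rewrite mulrC -ltr_pdivlMr// mul1r.
  rewrite -phase_fun_equil_gap//; first exact: hf3.
  by apply: dom_gt1 => //; apply/ltW/(lt_trans r21).
Qed.

End Limits.

Theorem theorem1p1 (R : realType) :
  (exists beta1 : R -> R,
    [/\ forall a : R, 0 < a -> a < 1 ->
          1 < beta1 a /\ beta1 a < (1 + 2 * a) / (1 - a),
        forall a b : R, 0 < a -> a < b -> b < 1 -> beta1 a < beta1 b,
        beta1 a @[a --> 1^'-] --> +oo &
        forall a beta : R, 0 < a -> a < 1 -> 0 < beta ->
        [/\ beta < beta1 a ->
              forall (d : measure_display) (T : measurableType d)
                (P : probability T R) (x0 : 'cV[nat]_3)
                (x : nat -> T -> 'cV[nat]_3),
              urn_process (sym_mx a) beta x0 P x ->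
              {ae P, forall w, urn_converges x0 x (barycenter R) w},
            beta1 a < beta -> beta < (1 + 2 * a) / (1 - a) ->
              exists r2 : R, 1 < r2 /\
              forall (d : measure_display) (T : measurableType d)
                (P : probability T R) (x0 : 'cV[nat]_3)
                (x : nat -> T -> 'cV[nat]_3),
              urn_process (sym_mx a) beta x0 P x ->
              [/\ {ae P, forall w, urn_converges x0 x (barycenter R) w \/
                     exists i : 'I_3, urn_converges x0 x (dominant_pt r2 i) w},
                  (0 < P (urn_converges x0 x (barycenter R)))%E &
                  forall i : 'I_3,
                    (0 < P (urn_converges x0 x (dominant_pt r2 i)))%E] &
            (1 + 2 * a) / (1 - a) < beta ->
              exists rp : R, 1 < rp /\
              forall (d : measure_display) (T : measurableType d)
                (P : probability T R) (x0 : 'cV[nat]_3)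
                (x : nat -> T -> 'cV[nat]_3),
              urn_process (sym_mx a) beta x0 P x ->
              {ae P, forall w,
                 exists i : 'I_3, urn_converges x0 x (dominant_pt rp i) w}]]) /\
  (forall a beta : R, 1 <= a -> 0 < beta ->
    forall (d : measure_display) (T : measurableType d)
      (P : probability T R) (x0 : 'cV[nat]_3) (x : nat -> T -> 'cV[nat]_3),
    urn_process (sym_mx a) beta x0 P x ->
    {ae P, forall w, urn_converges x0 x (barycenter R) w}).
Proof.
split; last first.
  move=> a b a1 b0 d T P x0 x hx; apply: (urn_limit_quad _ b0 hx); last by left.
  exact: lt_le_trans a1.
exists (@beta_crit R); split.
- move=> a a0 a1; split; last exact: beta_crit_ub.
  apply: lt_le_trans (beta_crit_lb a0 a1).
  by rewrite invf_gt1 ?subr_gt0// ltrBlDr ltrDl.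
- exact: beta_crit_incr.
- exact: beta_crit_cvg.
- move=> a b a0 a1 b0; split.
  + by move=> hb d T P x0 x hx; exact: (subcritical_limit a0 a1 hx b0 hb).
  + move=> hb1 hb2.
    (* The roots are chosen before the urn, so [r2] depends on [a] and [b] only. *)
    have [r1 [r2 [r11 r12 ar2 hq [f1 f2 hf1 hf2 hf3]]]] := phase_roots_mid a0 a1 hb1 hb2.
    exists r2; split; first exact: lt_trans r12.
    move=> d T P x0 x hx; split=> [||i].
    * exact: (critical_limit a0 a1 hx hb1 hb2 r11 r12 ar2 f1 hf1 hf2 hf3 hq).
    * exact: (critical_barycenter a0 a1 hx hb1 hb2 r11 r12 ar2 hf1 hf2 hf3).
    * exact: (critical_dominant a0 a1 hx hb1 hb2 r11 r12 ar2 f2 hf1 hf2 hf3).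
  + move=> hb; have [rp [rp1 arp frp hlo hhi]] := phase_roots_hi a0 a1 hb.
    exists rp; split=> // d T P x0 x hx.
    exact: (supercritical_limit a0 a1 hx hb rp1 hlo hhi).
Qed.
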